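(* Let $\Lambda$ be a finite, strongly connected $k$-graph, let $\delta\in(0,1)$ be such that $w_\delta$ is a weight satisfying $w_\delta(\lambda)=\operatorname{diam}[\lambda]$ for all $\lambda\in F\mathcal B_\Lambda$, and fix a choice function $\tau$. Let $\mu_\delta$ be the finite Borel measure on $X_{\mathcal B_\Lambda}$ determined by $\mu_\delta([\lambda])=\mathcal T(\pi_\tau(\chi_{[\lambda]})|D|^{-\delta})$ for all $\lambda\in F\mathcal B_\Lambda$. Then $\pi_\tau(f)|D|^{-\delta}$ is Connes measurable for all $f\in C(X_{\mathcal B_\Lambda})$, and its Dixmier trace is given by $$\mathcal T\big(\pi_\tau(f)|D|^{-\delta}\big)=\lim_{s\searrow1}(s-1)\operatorname{Tr}\big(\pi_\tau(f)|D|^{-\delta s}\big)=\int_{X_{\mathcal B_\Lambda}}f(x)\,d\mu_\delta(x).$$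
   Context: $\mathbb N=\{0,1,2,\dots\}$. A $k$-graph ($k\ge 1$) is a countable small category $\Lambda$ with a functor $d:\Lambda\to\mathbb N^k$ ($\mathbb N^k$ viewed as a one-object category under addition) such that whenever $d(\lambda)=m+n$ there are unique $\mu,\nu\in\Lambda$ with $d(\mu)=m$, $d(\nu)=n$, $\lambda=\mu\nu$. Here $\lambda\in\Lambda$ means $\lambda$ is a morphism; $\Lambda^n=d^{-1}(n)$; $\Lambda^0$ is identified with the objects (vertices); $r,s:\Lambda\to\Lambda^0$ are range and source. $\Lambda$ is finite if every $\Lambda^n$ is finite, and strongly connected if for all $v,w\in\Lambda^0$ there is $\lambda\in\Lambda$ with $r(\lambda)=v$, $s(\lambda)=w$. With $e_i$ the standard basis of $\mathbb N^k$, the adjacency matrices are $A_i(v,w)=\#\{\lambda\in\Lambda^{e_i}: r(\lambda)=v,\ s(\lambda)=w\}$; $\rho_i$ is the spectral radius of $A_i$. For $\Lambda$ finite and strongly connected, $x^\Lambda\in(0,\infty)^{\Lambda^0}$ is the unique positive vector with $\sum_v x^\Lambda_v=1$ and $A_ix^\Lambda=\rho_ix^\Lambda$ for $1\le i\le k$. The stationary $k$-Bratteli diagram $\mathcal B_\Lambda$ has vertex set $\bigsqcup_{n\ge0}\mathcal V_n$, each $\mathcal V_n$ a copy of $\Lambda^0$, and edge set $\bigsqcup_{n\ge1}\mathcal E_n$, where for $n\equiv i \pmod k$, $1\le i\le k$, $\mathcal E_n$ contains exactly $A_i(p,q)$ edges with range $p\in\mathcal V_{n-1}$ and source $q\in\mathcal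 V_n$. $F\mathcal B_\Lambda$ is the set of finite paths $\eta=\eta_1\cdots\eta_m$ ($\eta_i\in\mathcal E_i$, $s(\eta_i)=r(\eta_{i+1})$), of length $|\eta|=m$; vertices in $\mathcal V_0$ are the paths of length $0$. $X_{\mathcal B_\Lambda}$ is the set of infinite paths $(x_n)_{n\ge1}$, $x_n\in\mathcal E_n$, $s(x_n)=r(x_{n+1})$, with the topology generated by the cylinder sets $[\lambda]$ = set of infinite paths with initial segment $\lambda\in F\mathcal B_\Lambda$; $\chi_{[\lambda]}$ is the characteristic function of $[\lambda]$. A weight is a function $w:F\mathcal B_\Lambda\to(0,\infty)$ with $\sum_{v\in\mathcal V_0}w(v)\le1$, $\lim_{n}\sup\{w(\lambda):|\lambda|=n\}=0$, and $w(\lambda)<w(\eta)$ whenever $\eta$ is a proper initial segment of $\lambda$. For $\delta\in(0,1)$ and $|\eta|=qk+t$ with $q\in\mathbb N$, $0\le t\le k-1$, $$w_\delta(\eta)=\big(\rho_1^{q+1}\cdots\rho_t^{q+1}\rho_{t+1}^q\cdots\rho_k^q\big)^{-1/\delta}x^\Lambda_{s(\eta)}.$$ For $x\ne y$ in $X_{\mathcal B_\Lambda}$, $x\wedge y$ is the longest common initial segment in $F\mathcal B_\Lambda$ ($\emptyset$ if $r(x)\neq r(y)$); $d_\delta(x,y)=w_\delta(x\wedge y)$ if $x\wedge y\ne\emptyset$, $d_\delta(x,y)=1$ if $x\wedge y=\emptyset$, and $d_\delta(x,x)=0$; $\operatorname{diam}[\lambda]=\sup\{d_\delta(x,y):x,y\in[\lambda]\}$.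 Under the hypotheses of the claim, $X_{\mathcal B_\Lambda}$ is a Cantor set and $d_\delta$ is an ultrametric inducing its topology. A choice function is a map $\tau=(\tau_+,\tau_-):F\mathcal B_\Lambda\to X_{\mathcal B_\Lambda}\times X_{\mathcal B_\Lambda}$ with $\tau(\gamma)\in[\gamma]\times[\gamma]$ and $d_\delta(\tau_+(\gamma),\tau_-(\gamma))=\operatorname{diam}[\gamma]$. On $\mathcal H=\ell^2(F\mathcal B_\Lambda,\mathbb C^2)$, for $f\in C(X_{\mathcal B_\Lambda})$, put $\pi_\tau(f)=\bigoplus_\gamma\mathrm{diag}(f(\tau_+(\gamma)),f(\tau_-(\gamma)))$ and $D=\bigoplus_\gamma\frac1{\operatorname{diam}[\gamma]}\begin{pmatrix}0&1\\1&0\end{pmatrix}$; then $|D|^{-1}$ is multiplication by $\operatorname{diam}[\gamma]$ on the $\gamma$-summand. Let $\sigma_0(T)\ge\sigma_1(T)\ge\cdots$ be the singular values of a compact operator $T$ on a separable Hilbert space, with multiplicity. The Dixmier–Macaev ideal $\mathcal M_{1,\infty}$ consists of the compact $T$ with $\limsup_n\frac1{\ln n}\sum_{j=1}^n\sigma_j(T)<\infty$. For a (dilation-invariant) generalized limit $\omega$ on $\ell^\infty(\mathbb N)$ (a state vanishing on $c_0$), the Dixmier trace $\mathcal T_\omega$ is the linear functional on $\mathcal M_{1,\infty}$ given on positive $T$ by $\mathcal T_\omega(T)=\omega\big(\big(\frac1{\ln(2+n)}\sum_{j\le n}\sigma_j(T)\big)_n\big)$. $T\in\mathcal M_{1,\infty}$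 is measurable in the sense of Connes if $\mathcal T_\omega(T)$ is the same for all such $\omega$; the common value is denoted $\mathcal T(T)$ and called its Dixmier trace. For positive $T$, Connes measurability is equivalent to existence and finiteness of $\lim_{s\searrow1}(s-1)\operatorname{Tr}(T^s)$, and then $\mathcal T(T)$ equals this limit. Under the hypotheses of the claim each $\pi_\tau(\chi_{[\lambda]})|D|^{-\delta}$ is Connes measurable, the number $\mathcal T(\pi_\tau(\chi_{[\lambda]})|D|^{-\delta})$ does not depend on $\tau$, and there is a unique finite Borel measure $\mu_\delta$ with the stated values on cylinder sets. *)

(* Defs.v *)
From HB Require Import structures.
From mathcomp Require Import all_boot all_order all_algebra.
From mathcomp Require Import finmap.
From mathcomp Require Import all_classical all_reals all_analysis.
From mathcomp Require Import complex ring.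

Set Implicit Arguments.
Unset Strict Implicit.
Unset Printing Implicit Defensive.

Import Order.TTheory GRing.Theory Num.Theory.
Import numFieldNormedType.Exports.
Local Open Scope classical_set_scope.
Local Open Scope ring_scope.
Local Open Scope complex_scope.

(* R[i] carries its norm topology under the alias R[i]^o. *)

(** * Operators on the Hilbert space ell^2(I) *)

Section Ell2.
Variables (R : realType) (I : choiceType).
Local Notation C := R[i].

Definition square_summable (x : I -> C) : Prop :=
  (\esum_(i in [set: I]) (Normc.normc (x i) ^+ 2)%:E < +oo)%E.

Definition ell2_pred : {pred I -> C} := fun x => `[< square_summable x >].

Lemma normc_sqD (x y : C) :
  Normc.normc (x + y) ^+ 2 <= 2 * Normc.normc x ^+ 2 + 2 * Normc.normc y ^+ 2.
Proof.
have n0 z : 0 <= Normc.normc z :> R by case: z => a b; rewrite sqrtr_ge0.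
have h := le_normcD x y.
apply: (@le_trans _ _ ((Normc.normc x + Normc.normc y) ^+ 2)).
  by rewrite ler_sqr ?nnegrE ?addr_ge0 ?n0.
rewrite -subr_ge0.
set a := Normc.normc x; set b := Normc.normc y.
have -> : 2 * a ^+ 2 + 2 * b ^+ 2 - (a + b) ^+ 2 = (a - b) ^+ 2 by ring.
exact: sqr_ge0.
Qed.

Lemma ell2_submod_closed : submod_closed ell2_pred.
Proof.
split.
  apply/asboolP; rewrite /square_summable esum1 ?ltry// => i _.
  by rewrite (_ : (0 : I -> C) i = 0)// Normc.normc0 expr0n /=.
move=> a x y /asboolP hx /asboolP hy; apply/asboolP.
rewrite /square_summable.
pose g i := ((2 * Normc.normc a ^+ 2) * Normc.normc (x i) ^+ 2)%:E : \bar R.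
pose h i := (2 * Normc.normc (y i) ^+ 2)%:E : \bar R.
have g0 i : (0 <= g i)%E.
  by rewrite lee_fin; apply: mulr_ge0; [apply: mulr_ge0|]; rewrite ?sqr_ge0 ?ler0n.
have h0 i : (0 <= h i)%E.
  by rewrite lee_fin; apply: mulr_ge0; rewrite ?sqr_ge0 ?ler0n.
apply: (@le_lt_trans _ _ (\esum_(i in [set: I]) (g i + h i)%E)).
  apply: le_esum => i _; rewrite lee_fin.
  apply: le_trans (normc_sqD _ _) _.
  by rewrite Normc.normcM exprMn mulrA.
rewrite esumD//.
have Z (c : R) (u : I -> R) : 0 <= c -> (forall i, 0 <= u i) ->
    (\esum_(i in [set: I]) (u i)%:E < +oo)%E ->
    (\esum_(i in [set: I]) (c * u i)%:E < +oo)%E.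
  move=> c0 u0 hu.
  apply: (@le_lt_trans _ _ (c%:E * \esum_(i in [set: I]) (u i)%:E)%E).
    apply: ub_ereal_sup => _ [A hA <-].
    rewrite (eq_fsbigr (fun i => c%:E * (u i)%:E)%E); last first.
      by move=> i _; rewrite EFinM.
    rewrite -ge0_mule_fsumr; last by move=> i; rewrite lee_fin.
    by rewrite lee_wpmul2l ?lee_fin// ereal_sup_ubound//; exists A.
  rewrite lte_mul_pinfty//.
apply: lte_add_pinfty; apply: Z => //; try by move=> i; exact: sqr_ge0.
by apply: mulr_ge0; rewrite ?sqr_ge0 ?ler0n.
Qed.

HB.instance Definition _ :=
  GRing.isSubmodClosed.Build C (I -> C) ell2_pred ell2_submod_closed.

Record ell2 := Ell2 { ell2_val :> I -> C; ell2_valP : ell2_val \in ell2_pred }.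

HB.instance Definition _ := [isSub for ell2_val].
HB.instance Definition _ := [Choice of ell2 by <:].
HB.instance Definition _ := [SubChoice_isSubLmodule of ell2 by <:].


Lemma basis_vec_subproof (i : I) : (fun j => (j == i)%:R) \in ell2_pred.
Proof.
apply/asboolP; rewrite /square_summable.
pose a j : \bar R := ((j == i)%:R)%:E.
rewrite (_ : esum _ _ = \esum_(j in [set i]) a j).
  by rewrite esum_set1 ?lee_fin ?ltry// /a eqxx.
rewrite [RHS]esum_mkcond; apply: eq_esum => j _; rewrite /a.
rewrite (_ : (j \in [set i]) = (j == i)); last by apply/idP/eqP; rewrite inE.
by case: eqP => _; rewrite ?Normc.normc0 ?Normc.normc1 ?expr0n ?expr1n.
Qed.

Definition basis_vec (i : I) : ell2 := Ell2 (basis_vec_subproof i).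

End Ell2.

Section Operators.
Variables (R : realType) (I : choiceType).
Local Notation C := R[i].
Local Notation H := (ell2 R I).
Implicit Types (x y : H) (T P : H -> H).

(* The sum of an absolutely summable family. *)
Definition rsum (f : I -> R) : R :=
  fine (\esum_(i in [set: I]) (Num.max (f i) 0)%:E)
  - fine (\esum_(i in [set: I]) (Num.max (- f i) 0)%:E).

Definition csum (f : I -> C) : C :=
  rsum (fun i => complex.Re (f i)) +i* rsum (fun i => complex.Im (f i)).

Definition inner x y : C := csum (fun i => x i * conjc (y i)).

Definition hnorm x : R := Num.sqrt (complex.Re (inner x x)).

Definition bounded_op T : Prop :=
  linear T /\ exists M : R, forall x, hnorm (T x) <= M * hnorm x.

Definition compact_op T : Prop :=
  linear T /\
  forall u : nat -> H, (exists M : R, forall n, hnorm (u n) <= M) ->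
    exists phi : nat -> nat, {homo phi : m n / (m < n)%N} /\
      exists y, hnorm (T (u (phi n)) - y) @[n --> \oo] --> (0 : R).

(* The order of R[i] is such that 0 <= z means that z is a nonnegative real. *)
Definition positive_op P : Prop :=
  bounded_op P /\ forall x, 0 <= inner (P x) x.

Definition adjoint T : H -> H :=
  xget (fun=> 0) [set S : H -> H | forall x y, inner (T x) y = inner x (S y)].

(* |T|, the positive square root of the composite of T with its adjoint *)
Definition abs_op T : H -> H :=
  xget (fun=> 0)
    [set P : H -> H | positive_op P /\ forall x, P (P x) = adjoint T (T x)].

Definition op_eigenspace (P : H -> H) (t : R) : set H :=
  [set x | P x = t%:C *: x].

Definition has_dim (E : set H) (m : nat) : Prop :=
  exists e : 'I_m -> H, (forall i, E (e i)) /\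
    forall x, E x -> exists! c : 'I_m -> C, x = \sum_i c i *: e i.

(* s lists the eigenvalues of |T| in decreasing order, each positive one
   repeated according to its multiplicity, and 0 filling up the list when there
   are finitely many positive ones. *)
Definition is_singular_values T (s : nat -> R) : Prop :=
  [/\ nonincreasing_seq s, (forall n, 0 <= s n), s n @[n --> \oo] --> (0 : R) &
      forall t : R, 0 < t ->
        exists m : nat, ([set n | s n = t] #= `I_m)%card /\
                        has_dim (op_eigenspace (abs_op T) t) m].

Definition singular_values T : nat -> R :=
  xget (fun=> 0) [set s | is_singular_values T s].

Definition dixmier_macaev T : Prop :=
  compact_op T /\
  (limn_esup (fun n => ((\sum_(1 <= j < n.+1) singular_values T j)
                          / ln (n%:R))%:E) < +oo)%E.

Definition trace_class T : Prop :=
  (\esum_(i in [set: I])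
     (complex.Re (inner (abs_op T (basis_vec R i)) (basis_vec R i)))%:E < +oo)%E.

Definition op_trace T : C :=
  csum (fun i => inner (T (basis_vec R i)) (basis_vec R i)).

(* The diagonal operator with bounded coefficients a; if a is unbounded, the
   vectors outside its domain are sent to 0. *)
Definition diag_op (a : I -> C) : H -> H :=
  fun x => insubd (0 : H) (fun i => a i * x i).

End Operators.

(** * Dixmier traces *)

Section Dixmier.
Variable R : realType.
Local Notation C := R[i].

Definition bounded_sequence (u : nat -> C) : Prop :=
  exists M : R, forall n, Normc.normc (u n) <= M.

(* Only the values of w on bounded sequences are relevant. *)
Definition generalized_limit (w : (nat -> C) -> C) : Prop :=
  [/\ forall (a : C) u v, bounded_sequence u -> bounded_sequence v ->
        w (fun n => a * u n + v n) = a * w u + w v,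
      forall u, bounded_sequence u -> (forall n, 0 <= u n) -> 0 <= w u,
      w (fun=> 1) = 1 &
      forall u, u n @[n --> \oo] --> (0 : C^o) -> w u = 0].

(* D_m u = (u_0, ..., u_0, u_1, ..., u_1, ...), each term repeated m times *)
Definition dilation_invariant (w : (nat -> C) -> C) : Prop :=
  forall m u, (0 < m)%N -> bounded_sequence u ->
    w (fun n => u (n %/ m)%N) = w u.

Variable I : choiceType.
Local Notation H := (ell2 R I).
Implicit Types (T A : H -> H).

Definition dixmier_pos (w : (nat -> C) -> C) T : C :=
  w (fun n => ((\sum_(j < n.+1) singular_values T j) / ln (n.+2)%:R)%:C).

Definition re_op T : H -> H := fun x => 2^-1 *: (T x + adjoint T x).
Definition im_op T : H -> H := fun x => (2 * 'i)^-1 *: (T x - adjoint T x).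
Definition pos_part A : H -> H := fun x => 2^-1 *: (abs_op A x + A x).
Definition neg_part A : H -> H := fun x => 2^-1 *: (abs_op A x - A x).

(* The linear extension to all of the ideal of the functional given on positive
   operators by dixmier_pos: T is decomposed as
   (Re T)_+ - (Re T)_- + i ((Im T)_+ - (Im T)_-). *)
Definition dixmier_trace (w : (nat -> C) -> C) T : C :=
  dixmier_pos w (pos_part (re_op T)) - dixmier_pos w (neg_part (re_op T))
  + 'i * (dixmier_pos w (pos_part (im_op T))
          - dixmier_pos w (neg_part (im_op T))).

Definition common_dixmier_value T : set C :=
  [set c | forall w, generalized_limit w -> dilation_invariant w ->
             dixmier_trace w T = c].

Definition connes_measurable T : Prop :=
  dixmier_macaev T /\ common_dixmier_value T !=set0.

Definition connes_trace T : C := xget 0 (common_dixmier_value T).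

End Dixmier.

(** * Higher-rank graphs *)

(* A countable category whose composition is total, with arbitrary values
   outside of composable pairs: kcomp l m is the composite l m when the source
   of l is the range of m. *)
Record kgraph (k : nat) := KGraph {
  kobj : countType;
  kmor : countType;
  krng : kmor -> kobj;
  ksrc : kmor -> kobj;
  idm : kobj -> kmor;
  kcomp : kmor -> kmor -> kmor;
  deg : kmor -> {ffun 'I_k -> nat};
  rng_idm : forall v, krng (idm v) = v;
  src_idm : forall v, ksrc (idm v) = v;
  rng_comp : forall l m, ksrc l = krng m -> krng (kcomp l m) = krng l;
  src_comp : forall l m, ksrc l = krng m -> ksrc (kcomp l m) = ksrc m;
  comp_idl : forall l, kcomp (idm (krng l)) l = l;
  comp_idr : forall l, kcomp l (idm (ksrc l)) = l;
  kcompA : forall l m n, ksrc l = krng m -> ksrc m = krng n ->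
    kcomp l (kcomp m n) = kcomp (kcomp l m) n;
  deg_idm : forall v, deg (idm v) = 0;
  deg_comp : forall l m, ksrc l = krng m -> deg (kcomp l m) = deg l + deg m;
  factorization : forall l m n, deg l = m + n ->
    exists! p : kmor * kmor,
      [/\ deg p.1 = m, deg p.2 = n, ksrc p.1 = krng p.2 & l = kcomp p.1 p.2]
}.

Section KGraph.
Variables (k : nat) (L : kgraph k).

Definition kgraph_finite : Prop :=
  forall n : {ffun 'I_k -> nat}, finite_set [set l : kmor L | deg l = n].

Definition strongly_connected : Prop :=
  forall v w : kobj L, exists l, krng l = v /\ ksrc l = w.

Definition unit_deg (i : 'I_k) : {ffun 'I_k -> nat} := [ffun j => (j == i) : nat].

Definition adj (i : 'I_k) (v w : kobj L) : nat :=
  #|` fset_set [set l | [/\ deg l = unit_deg i, krng l = v & ksrc l = w]]|.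

Variable R : realType.

Definition is_eigenvalue (i : 'I_k) (z : R[i]) : Prop :=
  exists u : kobj L -> R[i], (exists v, u v != 0) /\
    forall v, \sum_(w \in [set: kobj L]) (adj i v w)%:R * u w = z * u v.

Definition spectral_radius (i : 'I_k) : R :=
  sup [set Normc.normc z | z in [set z | is_eigenvalue i z]].

(* The defining property of the vector x^Lambda *)
Definition perron_frobenius_vector (x : kobj L -> R) : Prop :=
  [/\ forall v, 0 < x v,
      \sum_(v \in [set: kobj L]) x v = 1 &
      forall i v, \sum_(w \in [set: kobj L]) (adj i v w)%:R * x w
                  = spectral_radius i * x v].

End KGraph.

(** * The stationary Bratteli diagram *)

Section Bratteli.
(* The rank is k.+1, so that it ranges over the positive integers. *)
Variables (k : nat) (L : kgraph k.+1).
Local Notation V := (kobj L).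

(* The edge (p, q, j) is the j-th one with range p and source q. *)
Definition edge : Type := (V * V * nat)%type.
Definition erng (e : edge) : V := e.1.1.
Definition esrc (e : edge) : V := e.1.2.

(* Edges are numbered from 0: is_edge n is membership in the set of edges from
   level n.+1 to level n, for which the relevant matrix is, counting the colours
   from 0, that of colour n mod k.+1. *)
Definition is_edge (n : nat) (e : edge) : bool :=
  (e.2 < adj (inZp n) (erng e) (esrc e))%N.

Fixpoint fpath_from (n : nat) (v : V) (s : seq (V * V * nat)) : bool :=
  if s is e :: s' then
    [&& erng e == v, is_edge n e & fpath_from n.+1 (esrc e) s']
  else true.

(* A finite path is given by its range, a vertex at level 0, and the sequence
   of its edges, which is empty for the paths of length 0. *)
Record fin_path := FPath {
  fpath_val : V * seq (V * V * nat);
  fpath_valP : fpath_from 0 fpath_val.1 fpath_val.2 }.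

HB.instance Definition _ := [isSub for fpath_val].
HB.instance Definition _ := [Countable of fin_path by <:].

Definition vertex_path (v : V) : fin_path := @FPath (v, [::]) isT.
Definition frng (l : fin_path) : V := (fpath_val l).1.
Definition fedges (l : fin_path) : seq edge := (fpath_val l).2.
Definition flen (l : fin_path) : nat := size (fedges l).
Definition fsrc (l : fin_path) : V := last (frng l) (map esrc (fedges l)).

Definition proper_initial (h l : fin_path) : Prop :=
  [/\ frng h = frng l, prefix (fedges h : seq (V * V * nat)) (fedges l) &
      (flen h < flen l)%N].

Record inf_path := IPath {
  ip :> nat -> edge;
  ip_edge : forall n, is_edge n (ip n);
  ip_comp : forall n, esrc (ip n) = erng (ip n.+1) }.

HB.instance Definition _ := gen_eqMixin inf_path.
HB.instance Definition _ := gen_choiceMixin inf_path.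

Lemma initial_subproof (x : inf_path) (n : nat) :
  fpath_from 0 (erng (x 0%N)) (mkseq x n).
Proof.
rewrite /mkseq; move: 0%N => m.
elim: n m => //= n IH m; rewrite eqxx ip_edge /=.
by rewrite ip_comp; exact: IH.
Qed.

Definition initial_path (x : inf_path) (n : nat) : fin_path :=
  @FPath (erng (x 0%N), mkseq x n) (initial_subproof x n).

Definition cylinder (l : fin_path) : set inf_path := [set x | initial_path x (flen l) = l].

HB.instance Definition _ :=
  isSubBaseTopological.Build inf_path (range cylinder) id.

(* The Borel sigma-algebra. The library requires measurable types to be
   pointed, whence the parameter x0. *)
Definition pointed_inf_path (x0 : inf_path) : Type := inf_path.
HB.instance Definition _ (x0 : inf_path) :=
  Choice.copy (pointed_inf_path x0) inf_path.
HB.instance Definition _ (x0 : inf_path) := isPointed.Build (pointed_inf_path x0) x0.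
Definition borel_inf_path (x0 : inf_path) : measurableType _ :=
  @g_sigma_algebraType (pointed_inf_path x0) (@open inf_path).

(* x /\ y, for x different from y *)
Definition first_diff (x y : inf_path) : nat :=
  xget 0%N [set n | (forall i, (i < n)%N -> x i = y i) /\ x n <> y n].

Definition path_meet (x y : inf_path) : option fin_path :=
  if erng (x 0%N) == erng (y 0%N) then Some (initial_path x (first_diff x y))
  else None.

Variable R : realType.

Definition is_weight (w : fin_path -> R) : Prop :=
  [/\ forall l, 0 < w l,
      \sum_(v \in [set: V]) w (vertex_path v) <= 1,
      sup [set w l | l in [set l | flen l = n]] @[n --> \oo] --> (0 : R) &
      forall h l, proper_initial h l -> w l < w h].

Definition path_dist (w : fin_path -> R) (x y : inf_path) : R :=
  if x == y then 0 else if path_meet x y is Some l then w l else 1.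

Definition diam (w : fin_path -> R) (l : fin_path) : R :=
  sup [set path_dist w p.1 p.2 | p in cylinder l `*` cylinder l].

Definition w_delta (xL : V -> R) (delta : R) (l : fin_path) : R :=
  let q := (flen l %/ k.+1)%N in
  let t := (flen l %% k.+1)%N in
  (\prod_(i < k.+1) spectral_radius L R i ^+ (q + (i < t)%N)) `^ (- delta^-1)
  * xL (fsrc l).

Definition choice_function (w : fin_path -> R) (tau : fin_path -> inf_path * inf_path) :=
  forall l, [/\ cylinder l (tau l).1, cylinder l (tau l).2 &
                path_dist w (tau l).1 (tau l).2 = diam w l].

(* ell^2(F, C^2) is ell^2(F x bool), with true for the first component of C^2
   (that of tau_+) and false for the second. *)
Definition basis_index : choiceType := (fin_path * bool)%type.

Definition pi_tau (tau : fin_path -> inf_path * inf_path) (f : inf_path -> R[i]) :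
    ell2 R basis_index -> ell2 R basis_index :=
  diag_op (fun p : basis_index => f (if p.2 then (tau p.1).1 else (tau p.1).2)).

(* |D| ^ - r: on the summand of l, D is the matrix (diam l)^-1 [0 1; 1 0],
   whose absolute value is the scalar (diam l)^-1. *)
Definition absD_inv_pow (w : fin_path -> R) (r : R) :
    ell2 R basis_index -> ell2 R basis_index :=
  diag_op (fun p : basis_index => (diam w p.1 `^ r)%:C).

Definition cylinder_indic (l : fin_path) (x : inf_path) : R[i] :=
  (\1_(cylinder l) x : R)%:C.

Definition cintegral (x0 : inf_path)
    (mu : {finite_measure set (borel_inf_path x0) -> \bar R})
    (f : inf_path -> R[i]) : R[i] :=
  (\int[mu]_x complex.Re (f x)) +i* (\int[mu]_x complex.Im (f x)).

End Bratteli.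

(* Main.v *)
Require Import Defs.
From mathcomp Require Import all_boot all_order all_algebra finmap.
From mathcomp Require Import all_classical all_reals all_analysis.
From mathcomp Require Import measurable_realfun complex ring lra.

Set Implicit Arguments.
Unset Strict Implicit.
Unset Printing Implicit Defensive.

Import Order.TTheory GRing.Theory Num.Theory.
Import numFieldNormedType.Exports.
Local Open Scope classical_set_scope.
Local Open Scope ring_scope.
Local Open Scope complex_scope.

(* All operators involved are diagonal in the standard basis, indexed by the finite
   paths (twice), with coefficients f(tau) a, where a = diam ^ delta. Put
   rho = rho_1 ... rho_k and sort the paths into blocks, by the quotient of the
   length by k. In block q the weights a are comparable to rho ^ -q, and since
   A = A_1 ... A_k satisfies A x = rho x with x > 0, the sum of the weights of a
   block is bounded and bounded below; so there are about rho ^ q paths in it.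
   The sum of the n + 1 first singular values is then, up to a bounded error, the
   sum of |f(tau)| a over the blocks up to q, with ln n = q ln rho + O(1). Hence
   both the Dixmier trace and, by Frobenius' version of Abel's theorem, the limit
   of (s - 1) Tr are equal to (ln rho)^-1 times the Cesaro limit of the block sums
   of f(tau) a as soon as this limit exists. When f is the indicator function of
   a cylinder, it exists by the mean ergodic theorem for the power-bounded matrix
   A / rho, and the hypothesis on mu identifies it as (ln rho) mu(cylinder). For
   continuous f, which is uniformly close to linear combinations of such
   indicator functions, it follows that the limit is ln rho times the integral. *)

(** * Sums of families of real numbers *)

(** The matrix A / rho may be periodic, so the block sums over a cylinder can oscillate and only
    their averages are controlled; every asymptotic statement is therefore kept in the averaged form
    [asymp]. Multiplied by f(tau), the weights of a block come in no definite order, so the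
    eigenvalues are never listed explicitly: the partial sums of the singular values are bounded on
    both sides by sums over finite index sets (Ky Fan), and finite index sets are easily compared
    with unions of blocks. That the weights are merely comparable to rho ^ -q is harmless: the
    constants shift ln n by a bounded amount, and in the zeta function they are raised to the power
    s - 1, which makes them tend to 1. Adjoint, modulus, singular values and Connes trace are all
    chosen by [xget] from a defining property, so the property must each time be shown to be
    realized and then exploited. For the trace this takes an actual dilation-invariant generalized
    limit; without one, every number would be a common value. Only cylinders of length j k are
    treated: behind them the diagram starts again with the first colour. *)

Section Sums.
Variables (R : realType) (I : choiceType).
Implicit Types (f g u v : I -> R) (s : seq I).

(** Summability of nonnegative families is phrased through duplicate-free lists, so that estimates
    are made on finite real sums; [bounded_sumsP] translates to [esum]. *)
Definition bounded_sums u : Prop :=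
  exists M : R, forall s, uniq s -> \sum_(i <- s) u i <= M.

Definition nsum u : R := fine (\esum_(i in [set: I]) (u i)%:E).

Lemma fsbig_set_seq u s : uniq s ->
  (\sum_(i \in [set` s]) (u i)%:E)%E = (\sum_(i <- s) u i)%:E.
Proof. by move=> us; rewrite -fsbig_seq// sumEFin. Qed.

Lemma esum_le_bound u (M : \bar R) :
  (forall s, uniq s -> ((\sum_(i <- s) u i)%:E <= M)%E) ->
  (\esum_(i in [set: I]) (u i)%:E <= M)%E.
Proof.
move=> h; apply: ub_ereal_sup => _ [A [Afin _] <-].
by rewrite fsbig_finite//= sumEFin; apply: h.
Qed.

Lemma sum_le_esum u s : (forall i, 0 <= u i) -> uniq s ->
  ((\sum_(i <- s) u i)%:E <= \esum_(i in [set: I]) (u i)%:E)%E.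
Proof.
move=> u0 us; rewrite -fsbig_set_seq//.
apply: ereal_sup_ubound; exists [set` s] => //; split.
Qed.

Lemma bounded_sumsP u : (forall i, 0 <= u i) ->
  (bounded_sums u <-> (\esum_(i in [set: I]) (u i)%:E < +oo)%E).
Proof.
move=> u0; split.
  move=> [M hM]; apply: (@le_lt_trans _ _ M%:E); last exact: ltry.
  by apply: esum_le_bound => s us; rewrite lee_fin hM.
move=> h; exists (nsum u) => s us; rewrite -lee_fin fineK ?sum_le_esum//.
by rewrite ge0_fin_numE// esum_ge0// => i _; rewrite lee_fin.
Qed.

Lemma nsumE u : (forall i, 0 <= u i) -> bounded_sums u ->
  (\esum_(i in [set: I]) (u i)%:E = (nsum u)%:E)%E.
Proof.
move=> u0 /(bounded_sumsP u0) h; rewrite fineK// ge0_fin_numE//.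
by rewrite esum_ge0// => i _; rewrite lee_fin.
Qed.

Lemma sum_le_nsum u s : (forall i, 0 <= u i) -> bounded_sums u -> uniq s ->
  \sum_(i <- s) u i <= nsum u.
Proof. by move=> u0 bu us; rewrite -lee_fin -nsumE// sum_le_esum. Qed.

Lemma nsum_le u (M : R) : (forall i, 0 <= u i) ->
  (forall s, uniq s -> \sum_(i <- s) u i <= M) -> nsum u <= M.
Proof.
move=> u0 h; rewrite -lee_fin -nsumE//; last by exists M.
by apply: esum_le_bound => s us; rewrite lee_fin h.
Qed.

Lemma nsum_ge0 u : (forall i, 0 <= u i) -> 0 <= nsum u.
Proof. by move=> u0; apply/fine_ge0/esum_ge0 => i _; rewrite lee_fin. Qed.

Lemma eq_nsum u v : u =1 v -> nsum u = nsum v.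
Proof. by move=> /funext ->. Qed.

Lemma le_bounded_sums u v : (forall i, u i <= v i) ->
  bounded_sums v -> bounded_sums u.
Proof.
move=> uv [M hM]; exists M => s us; apply: le_trans (hM _ us).
by apply: ler_sum => i _.
Qed.

Lemma bounded_sumsD u v : bounded_sums u -> bounded_sums v ->
  bounded_sums (fun i => u i + v i).
Proof.
move=> [M hM] [N hN]; exists (M + N) => s us.
by rewrite big_split/= lerD ?hM ?hN.
Qed.

Lemma bounded_sumsZ (c : R) u : 0 <= c -> bounded_sums u ->
  bounded_sums (fun i => c * u i).
Proof.
move=> c0 [M hM]; exists (c * M) => s us.
by rewrite -mulr_sumr ler_wpM2l// hM.
Qed.

Lemma nsumD u v : (forall i, 0 <= u i) -> (forall i, 0 <= v i) ->
  bounded_sums u -> bounded_sums v ->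
  nsum (fun i => u i + v i) = nsum u + nsum v.
Proof.
move=> u0 v0 bu bv; apply: EFin_inj; rewrite EFinD -!nsumE//.
- by rewrite -esumD// => i _; rewrite lee_fin.
- by move=> i; rewrite addr_ge0.
- exact: bounded_sumsD.
Qed.

Lemma le_nsum u v : (forall i, 0 <= u i) -> (forall i, u i <= v i) ->
  bounded_sums v -> nsum u <= nsum v.
Proof.
move=> u0 uv bv; apply: nsum_le => // s us.
apply: (@le_trans _ _ (\sum_(i <- s) v i)); first exact: ler_sum.
by apply: sum_le_nsum => // i; apply: le_trans (uv i).
Qed.

Lemma nsumZ (c : R) u : 0 <= c -> (forall i, 0 <= u i) -> bounded_sums u ->
  nsum (fun i => c * u i) = c * nsum u.
Proof.
move=> c0 u0 bu; apply/eqP; rewrite eq_le; apply/andP; split.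
  apply: nsum_le => [i|s us]; first exact: mulr_ge0.
  by rewrite -mulr_sumr ler_wpM2l// sum_le_nsum.
have [->|cn0] := eqVneq c 0.
  by rewrite mul0r nsum_ge0// => i; rewrite mul0r.
have cp : 0 < c by rewrite lt_neqAle eq_sym cn0.
rewrite -ler_pdivlMl//; apply: nsum_le => // s us.
rewrite ler_pdivlMl// mulr_sumr; apply: sum_le_nsum => // [i|].
  exact: mulr_ge0.
exact: bounded_sumsZ.
Qed.

Lemma nsum_eq0 u : (forall i, 0 <= u i) -> bounded_sums u -> nsum u = 0 ->
  forall i, u i = 0.
Proof.
move=> u0 bu h i; apply/eqP; rewrite eq_le u0 andbT -h.
by have := @sum_le_nsum u [:: i] u0 bu isT; rewrite big_seq1.
Qed.

Lemma nsum1 u i0 : (forall i, i != i0 -> u i = 0) -> 0 <= u i0 ->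
  nsum u = u i0.
Proof.
move=> h u0; have u0' i : 0 <= u i by have [->//|/h->] := eqVneq i i0.
have key s : uniq s -> \sum_(i <- s) u i <= u i0.
  move=> us; have [i0s|i0s] := boolP (i0 \in s).
    by rewrite (bigD1_seq i0)//= big1 ?addr0// => i /h.
  rewrite big_seq big1// => i is_; apply: h.
  by apply: contraNneq i0s => <-.
apply/eqP; rewrite eq_le nsum_le//=.
have := @sum_le_nsum u [:: i0] u0' _ isT; rewrite big_seq1; apply.
by exists (u i0).
Qed.

Definition abs_bounded f := bounded_sums (fun i => `|f i|).

Lemma abs_boundedZ (c : R) f : abs_bounded f -> abs_bounded (fun i => c * f i).
Proof.
move=> bf; apply: le_bounded_sums (bounded_sumsZ (normr_ge0 c) bf) => i.
by rewrite normrM.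
Qed.

Let pos0 f i : 0 <= Num.max (f i) 0. Proof. by rewrite le_max lexx orbT. Qed.

Let bpos f : abs_bounded f -> bounded_sums (fun i => Num.max (f i) 0).
Proof.
by apply: le_bounded_sums => i; rewrite ge_max ler_norm normr_ge0.
Qed.
Let bneg f : abs_bounded f -> bounded_sums (fun i => Num.max (- f i) 0).
Proof.
by apply: le_bounded_sums => i; rewrite ge_max -normrN ler_norm normr_ge0.
Qed.

(** From f⁺ + v = f⁻ + u, additivity on nonnegative families shows that any splitting of [f]
    computes [rsum], not only the canonical one. Linearity of [rsum] follows by choosing convenient
    splittings. *)
Lemma rsum_diff f u v : (forall i, 0 <= u i) -> (forall i, 0 <= v i) ->
  bounded_sums u -> bounded_sums v -> (forall i, f i = u i - v i) ->
  rsum f = nsum u - nsum v.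
Proof.
move=> u0 v0 bu bv fuv.
have bf : abs_bounded f.
  apply: le_bounded_sums (bounded_sumsD bu bv) => i; rewrite fuv.
  by rewrite (le_trans (ler_normB _ _))// !ger0_norm.
rewrite /rsum -/(nsum (fun i => Num.max (f i) 0)) -/(nsum (fun i => Num.max (- f i) 0)).
apply/eqP; rewrite subr_eq addrAC eq_sym subr_eq -!nsumD//; try exact: bneg; try exact: bpos.
  apply/eqP/eq_nsum => i; rewrite fuv /Num.max.
  by case: ltP => ?; case: ltP => ?; lra.
by move=> i; exact: (pos0 (fun i => - f i)).
Qed.

Lemma rsum_nsum u : (forall i, 0 <= u i) -> rsum u = nsum u.
Proof.
move=> u0; rewrite /rsum (_ : (fun i => _) = (fun i => (u i)%:E)); last first.
  by apply/funext => i; rewrite max_l.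
rewrite [X in _ - fine X](_ : _ = 0%E) ?subr0// esum1// => i _.
by rewrite max_r// oppr_le0.
Qed.

Lemma rsumD f g : abs_bounded f -> abs_bounded g ->
  rsum (fun i => f i + g i) = rsum f + rsum g.
Proof.
move=> bf bg.
rewrite (@rsum_diff _ (fun i => Num.max (f i) 0 + Num.max (g i) 0)
                      (fun i => Num.max (- f i) 0 + Num.max (- g i) 0)).
- rewrite !nsumD//; try exact: bneg; try exact: bpos;
    try by move=> i; rewrite le_max lexx orbT.
  by rewrite /rsum /nsum; ring.
- by move=> i; rewrite addr_ge0.
- by move=> i; rewrite addr_ge0 ?(pos0 (fun i => - f i)) ?(pos0 (fun i => - g i)).
- by apply: bounded_sumsD; exact: bpos.
- by apply: bounded_sumsD; exact: bneg.
- by move=> i; rewrite /Num.max; do 4 (case: ltP => ?); lra.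
Qed.

Lemma rsumN f : rsum (fun i => - f i) = - rsum f.
Proof.
rewrite /rsum opprB; congr (_ - fine _).
by apply: eq_esum => i _; rewrite opprK.
Qed.

Lemma rsumZ (c : R) f : abs_bounded f -> rsum (fun i => c * f i) = c * rsum f.
Proof.
wlog c0 : c / 0 <= c.
  move=> h bf; have [/h->//|c0] := leP 0 c.
  have := h (- c); rewrite oppr_ge0 ltW// => /(_ isT bf).
  rewrite (_ : (fun i => - c * f i) = (fun i => - (c * f i))).
    by rewrite rsumN mulNr => /oppr_inj.
  by apply/funext => i; rewrite mulNr.
move=> bf.
rewrite (@rsum_diff _ (fun i => c * Num.max (f i) 0) (fun i => c * Num.max (- f i) 0)).
- by rewrite !nsumZ ?mulrBr//; (try exact: bpos); (try exact: bneg);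
    move=> i; rewrite le_max lexx orbT.
- by move=> i; rewrite mulr_ge0.
- by move=> i; rewrite mulr_ge0// (pos0 (fun i => - f i)).
- by apply: bounded_sumsZ => //; exact: bpos.
- by apply: bounded_sumsZ => //; exact: bneg.
- by move=> i; rewrite -mulrBr; congr (_ * _); rewrite /Num.max; do 2 (case: ltP => ?); lra.
Qed.

Lemma rsum1 f i0 : (forall i, i != i0 -> f i = 0) -> rsum f = f i0.
Proof.
move=> h; wlog f0 : f h / 0 <= f i0.
  move=> H; have [/(H _ h)//|f0] := leP 0 (f i0).
  have := H (fun i => - f i); rewrite rsumN oppr_ge0 => HH.
  apply: oppr_inj; apply: HH; last exact: ltW.
  by move=> i /h ->; rewrite oppr0.
rewrite rsum_nsum; first exact: nsum1.
by move=> i; have [->//|/h->] := eqVneq i i0.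
Qed.

End Sums.

(** * Diagonal operators *)

Lemma sqr_normc (R : rcfType) (z : R[i]) :
  Normc.normc z ^+ 2 = complex.Re z ^+ 2 + complex.Im z ^+ 2.
Proof. by case: z => a b /=; rewrite sqr_sqrtr// addr_ge0 ?sqr_ge0. Qed.

Lemma normc_ge0 (R : rcfType) (z : R[i]) : 0 <= Normc.normc z.
Proof. by case: z => a b; exact: sqrtr_ge0. Qed.

Lemma normc_conj (R : rcfType) (z : R[i]) : Normc.normc z^* = Normc.normc z.
Proof. by case: z => a b /=; rewrite sqrrN. Qed.

Lemma normc_opp (R : rcfType) (z : R[i]) : Normc.normc (- z) = Normc.normc z.
Proof. by case: z => a b /=; rewrite !sqrrN. Qed.

Lemma normc_real (R : rcfType) (r : R) : Normc.normc r%:C = `|r|.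
Proof. by rewrite /= expr0n addr0 sqrtr_sqr. Qed.

Lemma abs_Re_le (R : rcfType) (z : R[i]) : `|complex.Re z| <= Normc.normc z.
Proof.
rewrite -ler_sqr ?nnegrE ?normc_ge0// sqr_normc real_normK ?num_real//.
by rewrite lerDl sqr_ge0.
Qed.

Lemma abs_Im_le (R : rcfType) (z : R[i]) : `|complex.Im z| <= Normc.normc z.
Proof.
rewrite -ler_sqr ?nnegrE ?normc_ge0// sqr_normc real_normK ?num_real//.
by rewrite lerDr sqr_ge0.
Qed.

Lemma mulc_conj (R : rcfType) (z : R[i]) : z * z^* = (Normc.normc z ^+ 2)%:C.
Proof.
by rewrite sqr_normc; case: z => a b; apply/eqP; rewrite eq_complex/=; apply/andP; split; apply/eqP; ring.
Qed.

(** * The inner product of ell^2 as an absolutely convergent sum *)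

Section Inner.
Variables (R : realType) (I : choiceType).
Local Notation C := R[i].
Local Notation H := (ell2 R I).
Local Notation nc := Normc.normc.
Implicit Types (x y z : H).

Lemma ell2_bounded_sums x : bounded_sums (fun i => nc (x i) ^+ 2).
Proof.
apply/bounded_sumsP => [i|]; first exact: sqr_ge0.
by have /asboolP := ell2_valP x.
Qed.

Lemma ell2_predP (x : I -> C) : bounded_sums (fun i => nc (x i) ^+ 2) ->
  x \in @ell2_pred R I.
Proof.
by move=> h; apply/asboolP/bounded_sumsP => // i; exact: sqr_ge0.
Qed.

Lemma ell2_eq x y : x =1 y -> x = y.
Proof. by move=> xy; apply/val_inj/funext. Qed.

Lemma ell2D x y i : (x + y) i = x i + y i. Proof. by []. Qed.
Lemma ell2N x i : (- x) i = - x i. Proof. by []. Qed.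
Lemma ell2Z (c : C) x i : (c *: x) i = c * x i. Proof. by []. Qed.

Lemma ell2_sum n (F : 'I_n -> H) i : (\sum_j F j) i = \sum_j F j i.
Proof. by elim/big_ind2: _ => // x1 u x2 v hu hv; rewrite ell2D hu hv. Qed.

Lemma basis_vecE (i j : I) : basis_vec R i j = (j == i)%:R.
Proof. by []. Qed.

Definition csummable (f : I -> C) :=
  abs_bounded (fun i => complex.Re (f i)) /\ abs_bounded (fun i => complex.Im (f i)).

Lemma csummable_inner x y : csummable (fun i => x i * (y i)^*).
Proof.
have h : bounded_sums (fun i => nc (x i * (y i)^*)).
  apply: le_bounded_sums (bounded_sumsD (ell2_bounded_sums x) (ell2_bounded_sums y)) => i.
  rewrite Normc.normcM normc_conj.
  have := normc_ge0 (x i); have := normc_ge0 (y i).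
  move: (nc _) (nc _) => a b a0 b0; have := sqr_ge0 (a - b); nra.
by split; apply: le_bounded_sums h => i; rewrite ?abs_Re_le ?abs_Im_le.
Qed.

Lemma csumD (f g : I -> C) : csummable f -> csummable g ->
  csum (fun i => f i + g i) = csum f + csum g.
Proof.
move=> [f1 f2] [g1 g2]; rewrite /csum.
rewrite (_ : (fun i => complex.Re (f i + g i)) =
  fun i => complex.Re (f i) + complex.Re (g i)); last first.
  by apply/funext => i; case: (f i) (g i) => ? ? [].
rewrite (_ : (fun i => complex.Im (f i + g i)) =
  fun i => complex.Im (f i) + complex.Im (g i)); last first.
  by apply/funext => i; case: (f i) (g i) => ? ? [].
by rewrite !rsumD.
Qed.

Lemma csumZ (c : C) (f : I -> C) : csummable f ->
  csum (fun i => c * f i) = c * csum f.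
Proof.
move=> [f1 f2]; case: c => a b; rewrite /csum.
rewrite (_ : (fun i => complex.Re _) =
  fun i => a * complex.Re (f i) + - b * complex.Im (f i)); last first.
  by apply/funext => i; case: (f i) => ? ? /=; rewrite mulNr.
rewrite (_ : (fun i => complex.Im _) =
  fun i => a * complex.Im (f i) + b * complex.Re (f i)); last first.
  by apply/funext => i; case: (f i) => ? ? /=.
rewrite !rsumD ?rsumZ//; try exact: abs_boundedZ.
by apply/eqP; rewrite eq_complex/= mulNr !eqxx.
Qed.

Lemma csum_conj (f : I -> C) : csum (fun i => (f i)^*) = (csum f)^*.
Proof.
rewrite /csum/= -rsumN; apply/eqP; rewrite eq_complex/=.
by apply/andP; split; apply/eqP; congr rsum; apply/funext => i; case: (f i).
Qed.

Lemma csum1 (f : I -> C) i0 : (forall i, i != i0 -> f i = 0) -> csum f = f i0.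
Proof.
move=> h; rewrite /csum !(@rsum1 _ _ _ i0); first by case: (f i0).
  by move=> i /h ->.
by move=> i /h ->.
Qed.

Lemma innerDl x y z : inner (x + y) z = inner x z + inner y z.
Proof.
rewrite /inner -csumD; try exact: csummable_inner.
by congr csum; apply/funext => i; rewrite ell2D mulrDl.
Qed.

Lemma innerZl (c : C) x z : inner (c *: x) z = c * inner x z.
Proof.
rewrite /inner -csumZ; last exact: csummable_inner.
by congr csum; apply/funext => i; rewrite ell2Z mulrA.
Qed.

Lemma inner_conj x y : inner y x = (inner x y)^*.
Proof.
rewrite /inner -csum_conj; congr csum; apply/funext => i.
by rewrite rmorphM/= conjcK mulrC.
Qed.

Lemma innerDr x y z : inner z (x + y) = inner z x + inner z y.
Proof.
by rewrite (inner_conj (x + y)) (inner_conj x z) (inner_conj y z) innerDl rmorphD.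
Qed.

Lemma innerZr (c : C) x z : inner z (c *: x) = c^* * inner z x.
Proof. by rewrite (inner_conj (c *: x)) (inner_conj x z) innerZl rmorphM. Qed.

Lemma inner_basisr x i : inner x (basis_vec R i) = x i.
Proof.
rewrite /inner (@csum1 _ i) ?basis_vecE ?eqxx ?rmorph1 ?mulr1// => j ji.
by rewrite basis_vecE (negPf ji) rmorph0 mulr0.
Qed.

Lemma inner_basisl x i : inner (basis_vec R i) x = (x i)^*.
Proof. by rewrite inner_conj inner_basisr. Qed.

Lemma innerxx x : inner x x = (nsum (fun i => nc (x i) ^+ 2))%:C.
Proof.
rewrite /inner /csum.
rewrite (_ : (fun i => complex.Re _) = fun i => nc (x i) ^+ 2); last first.
  by apply/funext => i; rewrite mulc_conj.
rewrite (_ : (fun i => complex.Im _) = fun i => 0); last first.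
  by apply/funext => i; rewrite mulc_conj.
rewrite rsum_nsum ?rsum_nsum//; last by move=> i; exact: sqr_ge0.
by congr (_ +i* _); rewrite /nsum esum1.
Qed.

Lemma hnormE x : hnorm x = Num.sqrt (nsum (fun i => nc (x i) ^+ 2)).
Proof. by rewrite /hnorm innerxx. Qed.

Lemma hnorm_sqr x : hnorm x ^+ 2 = nsum (fun i => nc (x i) ^+ 2).
Proof. by rewrite hnormE sqr_sqrtr// nsum_ge0// => i; exact: sqr_ge0. Qed.

Lemma hnorm_ge0 x : 0 <= hnorm x. Proof. exact: sqrtr_ge0. Qed.

Lemma innerxx_eq0 x : inner x x = 0 -> x = 0.
Proof.
rewrite innerxx => /(congr1 (@complex.Re R))/= h; apply: ell2_eq => i.
apply: (@Normc.eq0_normc R).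
have /(_ i)/eqP := nsum_eq0 (fun i => sqr_ge0 (nc (x i))) (ell2_bounded_sums x) h.
by rewrite sqrf_eq0 => /eqP.
Qed.

End Inner.

(** * Adjoint, modulus, real and imaginary parts of diagonal operators *)

Section Diag.
Variables (R : realType) (I : choiceType).
Local Notation C := R[i].
Local Notation H := (ell2 R I).
Local Notation nc := Normc.normc.
Implicit Types (x y : H) (a b : I -> C) (r : I -> R).

Definition cbounded a := exists M : R, forall i, nc (a i) <= M.

Lemma diag_opE a x i : cbounded a -> diag_op a x i = a i * x i.
Proof.
move=> [M hM]; rewrite /diag_op -/(ell2_val _) insubdK//; apply: ell2_predP.
have M0 : 0 <= M by apply: le_trans (hM i); exact: normc_ge0.
apply: le_bounded_sums (bounded_sumsZ (sqr_ge0 M) (ell2_bounded_sums x)) => j.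
rewrite Normc.normcM exprMn ler_wpM2r ?sqr_ge0//.
by rewrite ler_sqr ?nnegrE ?normc_ge0.
Qed.

Lemma cboundedM a b : cbounded a -> cbounded b -> cbounded (fun i => a i * b i).
Proof.
move=> [M hM] [N hN]; exists (M * N) => i; rewrite Normc.normcM.
by apply: ler_pM => //; exact: normc_ge0.
Qed.

Lemma cbounded_conj a : cbounded a -> cbounded (fun i => (a i)^*).
Proof. by move=> [M hM]; exists M => i; rewrite normc_conj. Qed.

Lemma cbounded_norm a : cbounded a -> cbounded (fun i => (nc (a i))%:C).
Proof. by move=> [M hM]; exists M => i; rewrite normc_real ger0_norm ?normc_ge0. Qed.

Lemma diag_op_comp a b : cbounded a -> cbounded b ->
  diag_op a \o diag_op b = diag_op (fun i => a i * b i) :> (H -> H).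
Proof.
move=> ba bb; apply/funext => x; apply: ell2_eq => i /=.
by rewrite !diag_opE ?mulrA//; exact: cboundedM.
Qed.

Lemma diag_op_compE a b x : cbounded a -> cbounded b ->
  diag_op a (diag_op b x) = diag_op (fun i => a i * b i) x.
Proof. by move=> ba bb; rewrite -diag_op_comp. Qed.

Lemma diag_op_linear a : cbounded a -> linear (diag_op a : H -> H).
Proof.
move=> ba c x y; apply: ell2_eq => i.
by rewrite ell2D ell2Z !diag_opE// ell2D ell2Z mulrDr mulrCA.
Qed.

Lemma diag_op_bounded a : cbounded a -> bounded_op (diag_op a : H -> H).
Proof.
move=> ba; split; first exact: diag_op_linear.
have [M hM] := ba; exists `|M| => x.
rewrite -ler_sqr ?nnegrE ?mulr_ge0 ?hnorm_ge0// exprMn !hnorm_sqr.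
rewrite -nsumZ ?sqr_ge0//; [|by move=> i; exact: sqr_ge0|exact: ell2_bounded_sums].
apply: le_nsum => [i|i|]; first exact: sqr_ge0.
  rewrite diag_opE// Normc.normcM exprMn ler_wpM2r ?sqr_ge0//.
  by rewrite ler_sqr ?nnegrE ?normc_ge0// (le_trans (hM i))// ler_norm.
by apply: bounded_sumsZ; [exact: sqr_ge0|exact: ell2_bounded_sums].
Qed.

Lemma diag_op_basis a i : cbounded a ->
  diag_op a (basis_vec R i) = a i *: basis_vec R i.
Proof.
move=> ba; apply: ell2_eq => j; rewrite diag_opE// ell2Z basis_vecE.
by have [->//|] := eqVneq j i; rewrite !mulr0.
Qed.

Lemma inner_diag_basis a i : cbounded a ->
  inner (diag_op a (basis_vec R i)) (basis_vec R i) = a i.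
Proof.
by move=> ba; rewrite inner_basisr diag_opE// basis_vecE eqxx mulr1.
Qed.

(** The conjugate diagonal operator shows that an adjoint exists; testing against basis vectors
    determines every coordinate of whichever adjoint was chosen. *)
Lemma adjoint_diag a : cbounded a ->
  adjoint (diag_op a : H -> H) = diag_op (fun i => (a i)^*).
Proof.
move=> ba; have bc := cbounded_conj ba; rewrite /adjoint.
case: xgetP => [S _ /= hS|/(_ (diag_op (fun i => (a i)^*)))[]/=]; last first.
  move=> x y; congr csum; apply/funext => i.
  by rewrite !diag_opE// rmorphM/= conjcK mulrA (mulrC (a i)).
apply/funext => y; apply: ell2_eq => i.
have := hS (basis_vec R i) y; rewrite diag_op_basis// innerZl !inner_basisl.
by move=> /(congr1 (@conjc _)); rewrite rmorphM/= !conjcK diag_opE// => <-.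
Qed.

Lemma positive_diag r : cbounded (fun i => (r i)%:C) -> (forall i, 0 <= r i) ->
  positive_op (diag_op (fun i => (r i)%:C) : H -> H).
Proof.
move=> br r0; split; first exact: diag_op_bounded.
move=> x; rewrite /inner /csum.
rewrite (_ : (fun i => complex.Re _) = fun i => r i * nc (x i) ^+ 2); last first.
  by apply/funext => i; rewrite diag_opE// -mulrA mulc_conj /=; ring.
rewrite (_ : (fun i => complex.Im _) = fun i => 0); last first.
  by apply/funext => i; rewrite diag_opE// -mulrA mulc_conj /=; ring.
have p i : 0 <= r i * nc (x i) ^+ 2 by rewrite mulr_ge0// sqr_ge0.
rewrite !rsum_nsum// lecE/=; apply/andP; split; last exact: nsum_ge0.
by apply/eqP; rewrite /nsum esum1.
Qed.

(** Polarization: the quadratic form of [P] is real at x, y, x + y and x + i y. The third gives the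
    imaginary part of the identity, the fourth the real part. *)
Lemma positive_hermitian (P : H -> H) : positive_op P ->
  forall x y, inner (P x) y = inner x (P y).
Proof.
move=> [[Plin _] Ppos] x y.
have PD u v : P (u + v) = P u + P v.
  by have := Plin 1 u v; rewrite !scale1r.
have PZ c u : P (c *: u) = c *: P u.
  have P0 : P 0 = 0.
    have /eqP := PD 0 0; rewrite addr0 eq_sym -subr_eq0.
    by rewrite addrK => /eqP.
  by have := Plin c u 0; rewrite P0 !addr0.
have im0 u : complex.Im (inner (P u) u) = 0.
  by have := Ppos u; rewrite lecE => /andP[/eqP/=].
have h1 := im0 (x + y).
have h2 := im0 (x + 'i%C *: y).
move: h1 h2; rewrite !PD PZ !innerDl !innerDr !innerZl !innerZr.
have := im0 x; have := im0 y; rewrite (inner_conj (P y) x).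
case: (inner (P x) x) => a1 b1; case: (inner (P y) y) => a2 b2.
case: (inner (P x) y) => a3 b3; case: (inner (P y) x) => a4 b4 /=.
move=> -> -> h1 h2; apply/eqP; rewrite eq_complex/=; apply/andP.
by split; apply/eqP; lra.
Qed.

(* With [y = P e_i - b_i e_i], the equation [P^2 e_i = b_i^2 e_i] reads
   [P y + b_i y = 0], and positivity of [P] forces [y = 0]. *)
Lemma positive_sqrt_diag (P : H -> H) r :
  cbounded (fun i => (r i)%:C) -> (forall i, 0 <= r i) ->
  positive_op P -> (forall x, P (P x) = diag_op (fun i => (r i ^+ 2)%:C) x) ->
  P = diag_op (fun i => (r i)%:C).
Proof.
move=> br r0 Pp PP; have herm := positive_hermitian Pp.
have br2 : cbounded (fun i => (r i ^+ 2)%:C).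
  have := cboundedM br br; congr cbounded; apply/funext => i.
  by rewrite expr2 -rmorphM.
have [[Plin _] Ppos] := Pp.
have PD u v c : P (c *: u + v) = c *: P u + P v by exact: Plin.
have Pe i : P (basis_vec R i) = (r i)%:C *: basis_vec R i.
  set e := basis_vec R i; pose y := - (r i)%:C *: e + P e.
  have Py : P y = - (r i)%:C *: y.
    rewrite /y PD PP diag_op_basis// scalerDr scalerA mulrNN addrC.
    by rewrite -rmorphM -expr2.
  suff y0 : y = 0.
    by apply/eqP; rewrite -subr_eq0 addrC -scaleNr -/y y0.
  (* For a zero coefficient the sign argument is void. Then [P y = 0] and [y = P e], and symmetry
     gives <y, y> = <P y, e> = 0. *)
  have := r0 i; rewrite le_eqVlt => /orP[/eqP ri0|ri0].
    have yPe : y = P e by rewrite /y -ri0 oppr0 scale0r add0r.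
    apply: innerxx_eq0; rewrite {2}yPe -herm Py -ri0 oppr0 scale0r.
    by rewrite -(scale0r 0) innerZl mul0r.
  apply: innerxx_eq0; have := Ppos y; rewrite Py innerZl innerxx.
  set n := nsum _; have n0 : 0 <= n by apply: nsum_ge0 => j; exact: sqr_ge0.
  rewrite -rmorphN -rmorphM lecR mulNr oppr_ge0 pmulr_rle0// => h.
  by congr (_%:C); apply/eqP; rewrite eq_le n0 h.
apply/funext => x; apply: ell2_eq => i; rewrite diag_opE//.
by rewrite -inner_basisr herm Pe innerZr inner_basisr; congr (_ * _); exact: conjc_real.
Qed.

Lemma abs_diag a : cbounded a ->
  abs_op (diag_op a : H -> H) = diag_op (fun i => (nc (a i))%:C).
Proof.
move=> ba; have bn := cbounded_norm ba; have bc := cbounded_conj ba.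
have sq x : adjoint (diag_op a) (diag_op a x) =
    diag_op (fun i => (nc (a i) ^+ 2)%:C) x.
  rewrite adjoint_diag// diag_op_compE//; congr (diag_op _ x).
  by apply/funext => i; rewrite mulrC mulc_conj.
rewrite /abs_op; case: xgetP => [P _ /= [Pp hP]|/(_ (diag_op (fun i => (nc (a i))%:C)))[]/=].
  apply: positive_sqrt_diag => // [i|x]; first exact: normc_ge0.
  by rewrite hP sq.
split; first by apply: positive_diag => // i; exact: normc_ge0.
move=> x; rewrite sq diag_op_compE//; congr (diag_op _ x).
by apply/funext => i; rewrite -rmorphM expr2.
Qed.

Lemma re_op_diag a : cbounded a ->
  re_op (diag_op a : H -> H) = diag_op (fun i => (complex.Re (a i))%:C).
Proof.
move=> ba; have bc := cbounded_conj ba; rewrite /re_op adjoint_diag//.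
apply/funext => x; apply: ell2_eq => i; rewrite ell2Z ell2D !diag_opE//.
  rewrite -mulrDl mulrA; congr (_ * _); case: (a i) => u v.
  rewrite -[2]/(2%:R) -(rmorph_nat (@real_complex R)) -fmorphV /=.
  by apply/eqP; rewrite eq_complex/=; apply/andP; split; apply/eqP; field.
by have [M hM] := ba; exists M => j; rewrite normc_real (le_trans (abs_Re_le _)).
Qed.

Lemma im_op_diag a : cbounded a ->
  im_op (diag_op a : H -> H) = diag_op (fun i => (complex.Im (a i))%:C).
Proof.
move=> ba; have bc := cbounded_conj ba; rewrite /im_op adjoint_diag//.
apply/funext => x; apply: ell2_eq => i; rewrite ell2Z ell2D ell2N !diag_opE//.
  rewrite -mulrBl mulrA; congr (_ * _); case: (a i) => u v.
  apply: (@mulfI _ (2 * 'i)).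
    by rewrite mulf_neq0 ?pnatr_eq0 ?neq0Ci.
  rewrite mulrA mulfV ?mul1r; last by rewrite mulf_neq0 ?pnatr_eq0 ?neq0Ci.
  rewrite -[2]/(2%:R) -(rmorph_nat (@real_complex R)).
  by apply/eqP; rewrite eq_complex/=; apply/andP; split; apply/eqP; ring.
by have [M hM] := ba; exists M => j; rewrite normc_real (le_trans (abs_Im_le _)).
Qed.

Lemma cbounded_posneg r : cbounded (fun i => (r i)%:C) ->
  cbounded (fun i => (Num.max (r i) 0)%:C) /\
  cbounded (fun i => (Num.max (- r i) 0)%:C).
Proof.
move=> [M hM]; split; exists M => i; apply: le_trans (hM i);
  rewrite !normc_real; have := normr_ge0 (r i);
  rewrite /Num.max; case: ltP; rewrite ?normr0 ?normrN.
all: by move=> *.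
Qed.

Lemma pos_part_diag r : cbounded (fun i => (r i)%:C) ->
  pos_part (diag_op (fun i => (r i)%:C) : H -> H)
  = diag_op (fun i => (Num.max (r i) 0)%:C).
Proof.
move=> br; have [bp _] := cbounded_posneg br; have bn := cbounded_norm br.
rewrite /pos_part abs_diag//; apply/funext => x; apply: ell2_eq => i.
rewrite ell2Z ell2D !diag_opE// -mulrDl mulrA; congr (_ * _).
rewrite normc_real -rmorphD -[2]/(2%:R) -(rmorph_nat (@real_complex R)) -fmorphV.
by rewrite -rmorphM; congr (_%:C); rewrite /Num.max; case: ltrP => ?;
  [rewrite ltr0_norm|rewrite ger0_norm]; lra.
Qed.

Lemma neg_part_diag r : cbounded (fun i => (r i)%:C) ->
  neg_part (diag_op (fun i => (r i)%:C) : H -> H)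
  = diag_op (fun i => (Num.max (- r i) 0)%:C).
Proof.
move=> br; have [_ bp] := cbounded_posneg br; have bn := cbounded_norm br.
rewrite /neg_part abs_diag//; apply/funext => x; apply: ell2_eq => i.
rewrite ell2Z ell2D ell2N !diag_opE// -mulrBl mulrA; congr (_ * _).
rewrite normc_real -rmorphB -[2]/(2%:R) -(rmorph_nat (@real_complex R)) -fmorphV.
rewrite -rmorphM; congr (_%:C); rewrite /Num.max; case: ltrP => ?;
  [rewrite ger0_norm|rewrite ler0_norm]; lra.
Qed.

End Diag.

(** * Compactness *)

Section UltraLimits.
Variable R : realType.
Implicit Types u v : nat -> R.

Lemma exists_free_ultrafilter :
  exists U : set_system nat, UltraFilter U /\ \oo `<=` U.
Proof. exact: ultraFilterLemma. Qed.

Variable U : set_system nat.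
Hypothesis U_ultra : UltraFilter U.
Hypothesis U_free : \oo `<=` U.

Lemma ultra_limit u (M : R) : (forall n, `|u n| <= M) ->
  exists l : R, u @ U --> l.
Proof.
move=> hM; have UP : ProperFilter U by exact: ultra_proper.
have [|p [_ hp]] := @segment_compact R (- M) M (u @ U) _.
  apply: (@filterS _ U _ setT _ _ filterT) => n _.
  by rewrite /= in_itv/= -ler_norml; exact: hM.
exists p => B Bp; have [//|h] := in_ultra_setVsetC (u @^-1` B) U_ultra.
by have [x [/= nBx Bx]] := hp (~` B) B h Bp.
Qed.

Lemma ultra_infinite (A : set nat) : U A -> forall N, exists2 n, (N <= n)%N & A n.
Proof.
move=> UA N; have UP : ProperFilter U by exact: ultra_proper.
have UN : U [set n | (N <= n)%N] by apply: U_free; exists N.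
by have [n [An Nn]] := filter_ex (filterI UA UN); exists n.
Qed.

(** Members of a free ultrafilter are infinite, so indices with smaller and smaller values can be
    picked beyond one another. This yields the genuine subsequence that [compact_op] requires. *)
Lemma ultra_subsequence (u : nat -> R) : u @ U --> (0 : R) ->
  exists phi : nat -> nat, {homo phi : m n / (m < n)%N} /\
    u (phi n) @[n --> \oo] --> (0 : R).
Proof.
move=> u0; have UP : ProperFilter U by exact: ultra_proper.
have /choice[f fP] : forall p : nat * nat,
    exists n, (p.2 <= n)%N /\ `|u n| <= p.1.+1%:R^-1.
  move=> [k N]; have : U [set n | `|u n| <= k.+1%:R^-1].
    by apply: (cvgr0_norm_le _ u0); rewrite invr_gt0.
  by move=> /ultra_infinite/(_ N)[n Nn hn]; exists n.
pose phi := fix phi k := if k is k'.+1 then f (k, (phi k').+1) else f (0%N, 0%N).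
have phiP k : `|u (phi k)| <= k.+1%:R^-1.
  by case: k => [|k] /=; [have [] := fP (0, 0)%N|have [] := fP (k.+1, (phi k).+1)].
exists phi; split.
  apply: homo_ltn; first exact: ltn_trans.
  by move=> k /=; have [] := fP (k.+1, (phi k).+1).
apply/cvgr0Pnorm_le => e e0; near=> n.
apply: le_trans (phiP n) (ltW _).
by near: n; exact: (near_infty_natSinv_lt (PosNum e0)).
Unshelve. all: by end_near. Qed.

Lemma ultra_sum (I : Type) (s : seq I) (f : I -> nat -> R) (l : I -> R) :
  (forall i, f i @ U --> l i) ->
  (fun n => \sum_(i <- s) f i n) @ U --> \sum_(i <- s) l i.
Proof.
move=> h; have UP : ProperFilter U by exact: ultra_proper.
elim: s => [|i s IH].
  rewrite big_nil (_ : (fun n => _) = fun=> 0); first exact: cvg_cst.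
  by apply/funext => n; rewrite big_nil.
rewrite big_cons (_ : (fun n => _) = (f i \+ (fun n => \sum_(i <- s) f i n))).
  exact: cvgD.
by apply/funext => n; rewrite big_cons.
Qed.

End UltraLimits.

Section CompactDiag.
Variables (R : realType) (I : choiceType).
Local Notation C := R[i].
Local Notation H := (ell2 R I).
Local Notation nc := Normc.normc.
Implicit Types (x y : H) (a : I -> C).

Lemma ell2_coord_le x (M : R) i : hnorm x <= M -> nc (x i) <= M.
Proof.
move=> xM; apply: le_trans xM; rewrite -ler_sqr ?nnegrE ?normc_ge0 ?hnorm_ge0//.
rewrite hnorm_sqr; have := @sum_le_nsum _ _ (fun i => nc (x i) ^+ 2) [:: i].
rewrite big_seq1; apply => //; first by move=> j; exact: sqr_ge0.
exact: ell2_bounded_sums.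
Qed.

Lemma ell2_sum_le x (M : R) s : uniq s -> hnorm x <= M ->
  \sum_(i <- s) nc (x i) ^+ 2 <= M ^+ 2.
Proof.
move=> us xM; apply: (@le_trans _ _ (hnorm x ^+ 2)).
  rewrite hnorm_sqr; apply: sum_le_nsum => //; last exact: ell2_bounded_sums.
  by move=> j; exact: sqr_ge0.
by rewrite ler_sqr ?nnegrE ?hnorm_ge0// (le_trans _ xM)// hnorm_ge0.
Qed.

Lemma hnorm_sqr_le x (M : R) :
  (forall s, uniq s -> \sum_(i <- s) nc (x i) ^+ 2 <= M) -> hnorm x ^+ 2 <= M.
Proof. by move=> h; rewrite hnorm_sqr nsum_le// => i; exact: sqr_ge0. Qed.

(* A bounded sequence of vectors converges coordinatewise along a free
   ultrafilter; the image sequence then converges in norm along it. *)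
Lemma compact_diag a : cbounded a ->
  (forall e : R, 0 < e -> exists s : seq I, forall i, i \notin s -> nc (a i) <= e) ->
  compact_op (diag_op a : H -> H).
Proof.
move=> ba a0; split; first exact: diag_op_linear.
move=> u [M hM].
have [U [UU Uoo]] := exists_free_ultrafilter.
have UP : ProperFilter U by exact: ultra_proper.
have /choice[vr hvr] : forall i, exists l : R, (fun n => complex.Re (u n i)) @ U --> l.
  move=> i; apply: (@ultra_limit R U UU _ M) => n.
  by apply: le_trans (abs_Re_le _) _; exact: ell2_coord_le.
have /choice[vi hvi] : forall i, exists l : R, (fun n => complex.Im (u n i)) @ U --> l.
  move=> i; apply: (@ultra_limit R U UU _ M) => n.
  by apply: le_trans (abs_Im_le _) _; exact: ell2_coord_le.
pose v0 i := vr i +i* vi i.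
have sv s : uniq s -> \sum_(i <- s) nc (v0 i) ^+ 2 <= M ^+ 2.
  move=> us.
  have c : (fun n => \sum_(i <- s) (complex.Re (u n i) ^+ 2 + complex.Im (u n i) ^+ 2))
      @ U --> \sum_(i <- s) (vr i ^+ 2 + vi i ^+ 2).
    by apply: ultra_sum => i; apply: cvgD; rewrite expr2; apply: cvgM.
  rewrite (eq_bigr (fun i => vr i ^+ 2 + vi i ^+ 2)); last by move=> i _; rewrite sqr_normc.
  apply: (cvgr_to_le c); apply: nearW => n.
  apply: le_trans (ell2_sum_le us (hM n)).
  by apply: ler_sum => i _; rewrite sqr_normc.
have v0P : v0 \in @ell2_pred R I by apply: ell2_predP; exists (M ^+ 2).
pose v := Ell2 v0P.
have hv : hnorm v ^+ 2 <= M ^+ 2 by exact: hnorm_sqr_le.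
pose T := diag_op a : H -> H.
have [A0 hA0] := ba.
suff Tv : (fun n => hnorm (T (u n) - T v)) @ U --> (0 : R).
  by have [phi [phi1 phi2]] := ultra_subsequence UU Uoo Tv; exists phi; split => //; exists (T v).
apply/cvgr0Pnorm_le => e e0.
have M0 : 0 <= M by exact: le_trans (hnorm_ge0 _) (hM 0%N).
(* Outside of [s0] the squared norm is at most d^2 times 4 M^2, the bound [buv] for u n - v; since d
   M <= e / 4, this is at most e^2 / 4. The summand 1 keeps the denominator positive. *)
pose d := e / (4 * (M + 1)).
have d0 : 0 < d by rewrite divr_gt0// mulr_gt0// ltr_wpDl.
have [s0 hs0] := a0 _ d0.
pose s := undup s0; pose A := `|A0|.
pose w n := \sum_(i <- s) A ^+ 2 *
  ((complex.Re (u n i) - vr i) ^+ 2 + (complex.Im (u n i) - vi i) ^+ 2).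
have w0 : w @ U --> (0 : R).
  rewrite (_ : 0 = \sum_(i <- s) A ^+ 2 * ((vr i - vr i) ^+ 2 + (vi i - vi i) ^+ 2)).
    apply: ultra_sum => i; apply: cvgM; first exact: cvg_cst.
    by apply: cvgD; rewrite expr2; apply: cvgM; apply: cvgB => //; exact: cvg_cst.
  by rewrite big1// => i _; rewrite !subrr expr0n addr0 mulr0.
have e2 : 0 < e ^+ 2 / 4 by rewrite divr_gt0// exprn_gt0.
apply: (filterS _ (cvgr0_norm_le _ w0 _ e2)) => n /= hw.
rewrite ger0_norm ?hnorm_ge0// -ler_sqr ?nnegrE ?hnorm_ge0 ?(ltW e0)//.
have wn i : nc ((u n - v) i) ^+ 2 =
    (complex.Re (u n i) - vr i) ^+ 2 + (complex.Im (u n i) - vi i) ^+ 2.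
  by rewrite sqr_normc ell2D ell2N /=; case: (u n i).
have Tw i : nc ((T (u n) - T v) i) ^+ 2 = nc (a i) ^+ 2 * nc ((u n - v) i) ^+ 2.
  by rewrite !ell2D !ell2N /T !diag_opE// -mulrBr Normc.normcM exprMn.
have buv s' : uniq s' -> \sum_(i <- s') nc ((u n - v) i) ^+ 2 <= 4 * M ^+ 2.
  move=> us'; apply: (@le_trans _ _
      (\sum_(i <- s') (2 * nc (u n i) ^+ 2 + 2 * nc (v i) ^+ 2))).
    apply: ler_sum => i _; rewrite ell2D ell2N.
    have := normc_sqD (u n i) (- v i); congr (_ <= _ + 2 * _ ^+ 2).
    by move: (v i) => [? ?] /=; rewrite !sqrrN.
  rewrite big_split/= -!mulr_sumr.
  have h1 := ell2_sum_le us' (hM n); have := sv _ us'; rewrite /v /=.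
  move: h1; move: (\sum_(i <- s') _) (\sum_(i <- s') _) => p q; lra.
apply: hnorm_sqr_le => s' us'.
rewrite (bigID (fun i => i \in s))/=.
have h1 : \sum_(i <- s' | i \in s) nc ((T (u n) - T v) i) ^+ 2 <= e ^+ 2 / 4.
  apply: le_trans (_ : w n <= _); last by apply: le_trans hw; exact: ler_norm.
  rewrite -big_filter /w.
  apply: (@le_trans _ _ (\sum_(i <- [seq i <- s' | i \in s]) A ^+ 2 *
    ((complex.Re (u n i) - vr i) ^+ 2 + (complex.Im (u n i) - vi i) ^+ 2))).
    apply: ler_sum => i _; rewrite Tw wn ler_wpM2r ?addr_ge0 ?sqr_ge0//.
    by rewrite /A ler_sqr ?nnegrE ?normc_ge0 ?normr_ge0// (le_trans (hA0 i))// ler_norm.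
  rewrite (perm_big [seq i <- s | i \in s'])/=.
    rewrite big_filter [leRHS](bigID (fun i => i \in s'))/= lerDl sumr_ge0// => i _.
    by rewrite mulr_ge0 ?addr_ge0 ?sqr_ge0.
  apply: uniq_perm; rewrite ?filter_uniq ?undup_uniq// => i.
  by rewrite !mem_filter andbC.
have h2 : \sum_(i <- s' | i \notin s) nc ((T (u n) - T v) i) ^+ 2 <= d ^+ 2 * (4 * M ^+ 2).
  rewrite -big_filter.
  apply: (@le_trans _ _ (\sum_(i <- [seq i <- s' | i \notin s])
      d ^+ 2 * nc ((u n - v) i) ^+ 2)).
    rewrite !big_filter; apply: ler_sum => i; rewrite mem_undup => is0.
    by rewrite Tw ler_wpM2r ?sqr_ge0// ler_sqr ?nnegrE ?normc_ge0 ?(ltW d0)// hs0.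
  by rewrite -mulr_sumr ler_wpM2l ?sqr_ge0// buv// filter_uniq.
have dM : d * M <= e / 4.
  rewrite /d mulrAC ler_pdivrMr ?mulr_gt0 ?ltr_wpDl// mulrA divfK//.
  by rewrite ler_wpM2l ?(ltW e0)// lerDl.
have h3 : (d * M) ^+ 2 <= (e / 4) ^+ 2.
  have dM0 : 0 <= d * M by apply: mulr_ge0 => //; exact: ltW.
  by rewrite ler_sqr// nnegrE (le_trans dM0).
have h4 : 0 <= e ^+ 2 by exact: sqr_ge0.
move: h1 h2 h3 h4; rewrite !exprMn mulrCA.
move: (\sum_(_ <- _ | _) _) (\sum_(_ <- _ | _) _) (d ^+ 2 * M ^+ 2) (e ^+ 2).
by move=> p1 p2 p3 p4 *; lra.
Qed.

End CompactDiag.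

(** * Singular values of diagonal operators *)

Section HasDim.
Variables (R : realType) (I : choiceType).
Local Notation C := R[i].
Local Notation H := (ell2 R I).

(** Expanding each system in the other gives matrices A and B. Uniqueness of coordinates forces A B
    = 1, and the ranks give the inequality. *)
Lemma has_dim_le (E : set H) m m' : has_dim E m -> has_dim E m' -> (m <= m')%N.
Proof.
move=> [e [Ee ue]] [e' [Ee' ue']].
have /choice[c hc] : forall i, exists c : 'I_m' -> C, e i = \sum_j c j *: e' j.
  by move=> i; have [c [hc _]] := ue' _ (Ee i); exists c.
have /choice[d hd] : forall i, exists c : 'I_m -> C, e' i = \sum_j c j *: e j.
  by move=> i; have [c' [hc' _]] := ue _ (Ee' i); exists c'.
pose A : 'M[C]_(m, m') := \matrix_(i, j) c i j.
pose B : 'M[C]_(m', m) := \matrix_(i, j) d i j.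
apply: (@mulmx1_min _ _ _ A B); apply/matrixP => i l.
have [f [hf uf]] := ue _ (Ee i).
have h1 : f = fun l => (A *m B) i l.
  apply: uf; rewrite {1}hc.
  under eq_bigr do rewrite hd scaler_sumr.
  rewrite exchange_big/=; apply: eq_bigr => j _.
  rewrite mxE scaler_suml; apply: eq_bigr => k _.
  by rewrite scalerA !mxE.
have h2 : f = fun l => (1%:M : 'M[C]_m) i l.
  apply: uf; rewrite (bigD1 i)//= mxE eqxx scale1r big1 ?addr0// => j ji.
  by rewrite mxE eq_sym (negPf ji) scale0r.
by rewrite -[LHS]/((fun l => (A *m B) i l) l) -h1 h2.
Qed.

Lemma has_dim_unique (E : set H) m m' : has_dim E m -> has_dim E m' -> m = m'.
Proof. by move=> h h'; apply/eqP; rewrite eqn_leq !(has_dim_le h, has_dim_le h'). Qed.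

Lemma has_dim_diag (r : I -> R) (t : R) (s : seq I) :
  cbounded (fun i => (r i)%:C) -> uniq s -> (forall i, (i \in s) = (r i == t)) ->
  has_dim (op_eigenspace (diag_op (fun i => (r i)%:C) : H -> H) t) (size s).
Proof.
move=> br us hs; pose e (i : 'I_(size s)) := tnth (in_tuple s) i.
have einj : injective e by apply/tuple_uniqP.
have re i : r (e i) = t by apply/eqP; rewrite -hs mem_tnth.
exists (fun i => basis_vec R (e i)); split.
  by move=> i; rewrite /op_eigenspace/= diag_op_basis// re.
move=> x /= xE.
have x0 i : i \notin s -> x i = 0.
  rewrite hs => it; have /eqP : (r i)%:C * x i = t%:C * x i.
    by rewrite -(diag_opE x i br) xE.
  rewrite -subr_eq0 -mulrBl mulf_eq0.
  by rewrite -rmorphB fmorph_eq0 subr_eq0 (negPf it) => /eqP.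
have coord (c : 'I_(size s) -> C) j :
    (\sum_i c i *: basis_vec R (e i)) (e j) = c j.
  rewrite ell2_sum (bigD1 j)// ell2Z basis_vecE eqxx mulr1 big1; first exact: addr0.
  move=> i ij; rewrite ell2Z basis_vecE (inj_eq einj) eq_sym (negPf ij); exact: mulr0.
exists (fun i => x (e i)); split.
  apply: ell2_eq => i; have [is_|is_] := boolP (i \in s).
    have /tnthP[j ->] : i \in in_tuple s by [].
    by rewrite coord.
  rewrite x0// ell2_sum big1// => j _; rewrite ell2Z basis_vecE.
  have [ij|] := eqVneq i (e j); last by rewrite mulr0.
  by move: is_; rewrite ij mem_tnth.
by move=> c hc; apply/funext => j; rewrite hc coord.
Qed.

End HasDim.

Lemma card_eq_seq (T : choiceType) (s : seq T) : uniq s ->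
  ([set` s] #= `I_(size s))%card.
Proof.
move=> us; have fs : finite_set [set` s] by exact: finite_seq.
have /finite_setP[n hn] := fs; suff -> : size s = n by [].
rewrite -(card_fset_set hn); apply: perm_size.
apply: uniq_perm => // i; rewrite in_fset_set//.
by apply/idP/idP => [h|/set_mem//]; exact: mem_set.
Qed.

(** * Decreasing rearrangements and the matching of positive values *)

Section Rearrangement.
Variables (R : realType) (I : choiceType).
Implicit Types (b : I -> R).

(** A list of singular values is known only through the multiplicities of its positive values.
    Injections between the level sets of each t > 0 glue to a single one, because different values
    have disjoint level sets. The value 0 is left out, its multiplicity not being prescribed. *)
Lemma value_injection (J : choiceType) (s : J -> R) (T : choiceType) (t0 : T) (b : T -> R) :
  (forall t, 0 < t -> ([set j | s j = t] #<= [set i | b i = t])%card) ->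
  exists phi : J -> T, (forall j, 0 < s j -> b (phi j) = s j) /\
    (forall j j', 0 < s j -> 0 < s j' -> phi j = phi j' -> j = j').
Proof.
move=> h.
have /choice[f hf] : forall t : R, exists f : J -> T, 0 < t ->
    (forall j, s j = t -> b (f j) = t) /\
    (forall j j', s j = t -> s j' = t -> f j = f j' -> j = j').
  move=> t; have [t_gt0|t_le0] := ltP 0 t; last by exists (fun=> t0).
  have /card_leP[f] := h t t_gt0.
  pose g j := if pselect (s j = t) is left p
    then val (f (SigSub (mem_set (p : [set j | s j = t] j)))) else t0.
  exists g => _; split=> [j jt|j j' jt j't].
    by rewrite /g; case: pselect => // p; have /set_mem := valP (f (SigSub (mem_set (p : [set j | s j = t] j)))).
  rewrite /g; case: pselect => // p; case: pselect => // q /val_inj.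
  by move=> /(@inj _ _ _ f); rewrite !in_setT => /(_ isT isT) [].
exists (fun j => f (s j) j); split => [j sj|j j' sj sj' E].
  by have [+ _] := hf _ sj; apply.
have ss : s j = s j'.
  have [h1 _] := hf _ sj; have [h2 _] := hf _ sj'.
  by rewrite -(h1 j)// -(h2 j')// E.
have [_ +] := hf _ sj; apply => //; by rewrite E ss.
Qed.

(** Cut at the height [s n]: the excess [p] vanishes from [n] on, so its sum over [J] is at most
    that over the head, and [J] contributes at most [n] copies of [s n]. *)
Lemma sum_le_head (s : nat -> R) (J : seq nat) n : nonincreasing_seq s ->
  (forall j, 0 <= s j) -> uniq J -> (size J <= n)%N ->
  \sum_(j <- J) s j <= \sum_(j < n) s j.
Proof.
move=> sdec s0 uJ Jn.
pose p j := Num.max (s j - s n) 0.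
have p0 j : 0 <= p j by rewrite le_max lexx orbT.
apply: (@le_trans _ _ (\sum_(j <- J) (p j + s n))).
  by apply: ler_sum => j _; rewrite -lerBlDr le_max lexx.
have pn j : (n <= j)%N -> p j = 0.
  by move=> nj; apply/max_idPr; rewrite subr_le0; exact: sdec.
rewrite big_split/= big_const_seq count_predT iter_addr_0.
have h1 : \sum_(j <- J) p j <= \sum_(j < n) p j.
  rewrite (bigID (fun j => (j < n)%N))/= [X in _ + X]big1 ?addr0; last first.
    by move=> j; rewrite -leqNgt => /pn.
  rewrite -(big_mkord xpredT p) /index_iota subn0 -big_filter.
  rewrite [leRHS](bigID (fun j => j \in J))/= -[X in _ <= X + _]big_filter.
  rewrite (perm_big [seq j <- iota 0 n | j \in J])/=.
    by rewrite lerDl sumr_ge0.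
  apply: uniq_perm; rewrite ?filter_uniq ?iota_uniq// => j.
  by rewrite !mem_filter mem_iota/= add0n andbC.
apply: (@le_trans _ _ (\sum_(j < n) p j + s n *+ n)).
  by rewrite lerD// ler_wpMn2l.
rewrite -[X in _ *+ X]card_ord -sumr_const -big_split/=.
apply: ler_sum => j _; rewrite /p max_l ?subrK// subr_ge0; exact/sdec/ltnW.
Qed.

Definition vanishing b :=
  forall e, 0 < e -> exists s : seq I, forall i, i \notin s -> b i < e.

Lemma seq_argmax b (s : seq I) : s != [::] ->
  exists2 i, i \in s & forall j, j \in s -> b j <= b i.
Proof.
elim: s => // x s IH _; have [->|s0] := eqVneq s [::].
  by exists x; rewrite ?inE// => j; rewrite inE => /eqP ->.
have [i is_ hi] := IH s0; have [xi|ix] := leP (b x) (b i).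
  exists i; first by rewrite inE is_ orbT.
  by move=> j; rewrite inE => /predU1P[->//|/hi].
exists x; first by rewrite inE eqxx.
by move=> j; rewrite inE => /predU1P[->//|/hi/le_trans]; apply; exact: ltW.
Qed.

Lemma vanishing_argmax b (F : seq I) : (forall i, 0 <= b i) -> vanishing b ->
  (exists i, i \notin F) -> exists i, i \notin F /\ forall j, j \notin F -> b j <= b i.
Proof.
move=> b0 vb [i1 i1F].
have [[i iF bi]|none] := pselect (exists2 i, i \notin F & 0 < b i); last first.
  exists i1; split => // j jF; rewrite leNgt; apply/negP => bj.
  by apply: none; exists j => //; exact: le_lt_trans bj.
have [s hs] := vb _ bi; pose s' := [seq j <- i :: s | j \notin F].
have is' : i \in s' by rewrite mem_filter iF inE eqxx.
have [|m] := @seq_argmax b s'; first by apply: contraTneq is' => ->.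
rewrite mem_filter => /andP[mF _] hm; exists m; split => // j jF.
have [js|js] := boolP (j \in s).
  by apply: hm; rewrite mem_filter jF inE js orbT.
by apply: le_trans (ltW (hs _ js)) _; exact: hm.
Qed.

Lemma uniq_notin (T : eqType) (s s' : seq T) : uniq s' -> (size s < size s')%N ->
  exists2 i, i \in s' & i \notin s.
Proof.
move=> us' ss'; suff : ~~ all (fun i => i \in s) s' by case/allPn => i; exists i.
apply: contraL ss' => /allP h; rewrite -leqNgt; exact: uniq_leq_size.
Qed.

(* [e n] maximizes [b] outside of [e 0, ..., e (n - 1)]. *)
Lemma exists_rearrangement b : (forall i, 0 <= b i) -> vanishing b ->
  (forall F : seq I, exists i, i \notin F) ->
  exists e : nat -> I, [/\ injective e, nonincreasing_seq (b \o e),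
    (forall i, 0 < b i -> exists n, e n = i) &
    b (e n) @[n --> \oo] --> (0 : R)].
Proof.
move=> b0 vb infI.
have /choice[g hg] : forall F : seq I,
    exists i, i \notin F /\ forall j, j \notin F -> b j <= b i.
  by move=> F; exact: vanishing_argmax.
pose L := fix L n := if n is n'.+1 then rcons (L n') (g (L n')) else [::].
pose e n := g (L n).
have LP n i : i \in L n -> exists2 m, (m < n)%N & i = e m.
  elim: n => // n IH /=; rewrite mem_rcons inE => /predU1P[->|/IH[m mn ->]].
    by exists n.
  by exists m => //; exact: ltn_trans mn _.
have PL n m : (m < n)%N -> e m \in L n.
  elim: n => // n IH; rewrite ltnS leq_eqVlt /= mem_rcons inE => /predU1P[->|/IH->].
    by rewrite eqxx.
  by rewrite orbT.
have eL n : e n \notin L n by have [] := hg (L n).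
have sL n : size (L n) = n by elim: n => //= n IH; rewrite size_rcons IH.
have uL n : uniq (L n) by elim: n => //= n IH; rewrite rcons_uniq IH andbT eL.
have be n j : j \notin L n -> b j <= b (e n) by have [_] := hg (L n); apply.
have eL' n m : (n <= m)%N -> e m \notin L n.
  by move=> nm; apply/negP => /LP[l ln E]; move: (eL m); rewrite E PL// (leq_trans ln).
clearbody e; clearbody L; clear hg.
have einj : injective e.
  move=> m n E; case: (ltngtP m n) => // lt.
    by move: (eL n); rewrite -E PL.
  by move: (eL m); rewrite E PL.
have dec : nonincreasing_seq (b \o e).
  by apply/nonincreasing_seqP => n; apply: be; exact: eL'.
exists e; split => //.
  (* An index never reached would compete for every maximum, so all [b (e n)] would be at least
     [b i], against the vanishing of [b]. *)
  move=> i bi; apply: contrapT => hi.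
  have iL n : i \notin L n by apply/negP => /LP[m _ E]; apply: hi; exists m.
  have [s hs] := vb _ bi.
  have [|j /LP[m _ ->] ms] := uniq_notin (uL (size s).+1) (s := s); first by rewrite sL.
  by have := hs _ ms; rewrite ltNge be.
apply/cvgr0Pnorm_le => x x0; have [s hs] := vb _ x0.
have [|j /LP[m _ ->] ms] := uniq_notin (uL (size s).+1) (s := s); first by rewrite sL.
exists m => // n /= mn; rewrite ger0_norm//.
by apply: le_trans (ltW (hs _ ms)); exact: (dec m n).
Qed.

End Rearrangement.

(** * Partial sums of singular values as maxima over finite index sets (Ky Fan) *)

Section SingularValues.
Variables (R : realType) (I : choiceType) (b : I -> R).
Local Notation H := (ell2 R I).
Hypothesis I_infinite : forall F : seq I, exists i, i \notin F.
Hypothesis b_ge0 : forall i, 0 <= b i.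
Hypothesis b_vanishing : vanishing b.
Hypothesis b_bounded : cbounded (fun i => (b i)%:C).
Variable T : H -> H.
Hypothesis absT : abs_op T = diag_op (fun i => (b i)%:C).

Let level t : 0 < t -> exists s : seq I, uniq s /\ forall i, (i \in s) = (b i == t).
Proof.
move=> t0; have [s hs] := b_vanishing t0.
exists [seq i <- undup s | b i == t]; split; first by rewrite filter_uniq// undup_uniq.
move=> i; rewrite mem_filter mem_undup; have [bi|//] := eqVneq (b i) t.
by apply: contraT => /hs; rewrite bi ltxx.
Qed.

(** The rearrangement of [b] shows that some list qualifies. The list actually chosen is then
    compared with [b] through [has_dim_unique], which makes the multiplicities agree. *)
Lemma singular_values_diag : is_singular_values T (singular_values T).
Proof.
rewrite /singular_values; case: xgetP => [s _ //|].
have [e [einj edec ehit e0]] := exists_rearrangement b_ge0 b_vanishing I_infinite.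
move=> /(_ (b \o e))[]; split=> // [n|t t0]; first exact: b_ge0.
have [s [us hs]] := level t0.
exists (size s); split; last by rewrite absT; exact: has_dim_diag.
apply: card_eq_trans (card_eq_seq us).
have -> : [set` s] = e @` [set n | (b \o e) n = t].
  apply/seteqP; split => [i|_ [n bn <-]]; last by rewrite /= hs -bn; exact: eqxx.
  rewrite /= hs => /eqP bi; have [|n ni] := ehit i; first by rewrite bi.
  by exists n => //=; rewrite ni.
by rewrite card_eq_sym; apply: inj_card_eq => ? ? _ _; exact: einj.
Qed.

Lemma singular_values_ge0 n : 0 <= singular_values T n.
Proof. by have [] := singular_values_diag. Qed.

Let card_level t : 0 < t ->
  ([set n | singular_values T n = t] #= [set i | b i = t])%card.
Proof.
move=> t0; have [_ _ _ /(_ t t0)[m [hm dm]]] := singular_values_diag.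
have [s [us hs]] := level t0.
have -> : [set i | b i = t] = [set` s].
  by apply/seteqP; split => i /=; rewrite hs => /eqP.
have := has_dim_diag b_bounded us hs; rewrite -absT => /has_dim_unique/(_ dm) E.
by rewrite (card_eq_trans hm)// -E card_eq_sym card_eq_seq.
Qed.

Lemma sum_le_singular (F : seq I) n : uniq F -> (size F <= n)%N ->
  \sum_(i <- F) b i <= \sum_(j < n) singular_values T j.
Proof.
move=> uF Fn; have [sdec s0 _ _] := singular_values_diag.
have [|phi [h1 h2]] := @value_injection R I b nat 0%N (singular_values T).
  by move=> t t0; have := card_level t0; rewrite card_eq_le => /andP[].
pose F' := [seq i <- F | 0 < b i].
have -> : \sum_(i <- F) b i = \sum_(j <- map phi F') singular_values T j.
  rewrite big_map big_filter [LHS](bigID (fun i => 0 < b i))/=.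
  rewrite [X in _ + X]big1 ?addr0; first by apply: eq_bigr => i /h1.
  by move=> i; rewrite -leNgt => bi; apply/eqP; rewrite eq_le bi b_ge0.
apply: sum_le_head => //.
  rewrite map_inj_in_uniq ?filter_uniq// => i j; rewrite !mem_filter.
  by move=> /andP[bi _] /andP[bj _]; exact: h2.
by rewrite size_map (leq_trans _ Fn)// size_filter count_size.
Qed.

Lemma singular_le_sum n : exists F : seq I, [/\ uniq F, (size F <= n)%N &
  \sum_(j < n) singular_values T j <= \sum_(i <- F) b i].
Proof.
have [sdec s0 _ _] := singular_values_diag.
have [i0 _] := I_infinite [::].
have [|phi [h1 h2]] := @value_injection R nat (singular_values T) I i0 b.
  by move=> t t0; have := card_level t0; rewrite card_eq_le => /andP[].
pose J := [seq j <- iota 0 n | 0 < singular_values T j].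
exists (map phi J); split.
- rewrite map_inj_in_uniq ?filter_uniq ?iota_uniq// => i j; rewrite !mem_filter.
  by move=> /andP[bi _] /andP[bj _]; exact: h2.
- by rewrite size_map size_filter (leq_trans (count_size _ _))// size_iota.
rewrite big_map big_filter -(big_mkord xpredT (singular_values T)).
rewrite /index_iota subn0 (bigID (fun j => 0 < singular_values T j))/=.
rewrite [X in _ + X]big1 ?addr0; first by apply: ler_sum => j /h1 ->.
by move=> i; rewrite -leNgt => bi; apply/eqP; rewrite eq_le bi s0.
Qed.

End SingularValues.

(** * Existence of dilation-invariant generalized limits *)

Lemma leq_fact_self n : (n <= n`!)%N.
Proof. by case: n => // n; rewrite factS leq_pmulr ?fact_gt0. Qed.

Lemma leq_factorial m n : (m <= n)%N -> (m`! <= n`!)%N.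
Proof.
move=> mn; rewrite -(subnK mn); elim: (n - m)%N => // k IH.
by rewrite addSn factS (leq_trans IH)// leq_pmull.
Qed.

Section LogMean.
Variable R : realType.
Implicit Types (u v : nat -> R).

(* [logw n] is the integral of 1/t over [n, n+1] for [n > 0], so that the
   weights of a block [jm, jm + m) add up to [logw j]. *)
Definition logw (n : nat) : R := if n is 0%N then 0 else ln n.+1%:R - ln n%:R.

Definition logsum u (p q : nat) : R := \sum_(p <= n < q) u n * logw n.

(** Means are taken at factorials because every positive m <= k divides k!, so that the indices from
    m to k! - 1 fall into complete blocks of length m. *)
Definition logmean u (k : nat) : R := logsum u 0 k`! / ln k`!%:R.

Lemma logw_ge0 n : 0 <= logw n.
Proof. by case: n => //= n; rewrite subr_ge0 ler_ln ?posrE ?ltr0n// ler_nat. Qed.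

Lemma sum_logw p q : (0 < p <= q)%N ->
  \sum_(p <= n < q) logw n = ln q%:R - ln p%:R.
Proof.
move=> /andP[p0 pq]; rewrite -(telescope_sumr (fun n => ln n%:R) pq).
by apply: eq_big_nat => n /andP[pn _]; case: n pn => //; rewrite leqn0 gtn_eqF.
Qed.

Lemma sum_logw0 q : (0 < q)%N -> \sum_(0 <= n < q) logw n = ln q%:R.
Proof.
move=> q0; rewrite big_ltn// add0r sum_logw ?q0//.
by rewrite ln1 subr0.
Qed.

Lemma abs_logsum u (M : R) p q : (forall n, (p <= n < q)%N -> `|u n| <= M) ->
  `|logsum u p q| <= M * \sum_(p <= n < q) logw n.
Proof.
move=> uM; apply: le_trans (ler_norm_sum _ _ _) _.
rewrite mulr_sumr !big_nat; apply: ler_sum => n /uM h.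
by rewrite normrM (ger0_norm (logw_ge0 _)) ler_wpM2r// logw_ge0.
Qed.

Lemma logsum_dilate u m J : (0 < m)%N -> (0 < J)%N ->
  logsum (fun n => u (n %/ m)%N) m (J * m) = logsum u 1 J.
Proof.
move=> m0; elim: J => // J IH _; case: J IH => [_|J IH].
  by rewrite mul1n /logsum !big_geq.
rewrite /logsum (@big_cat_nat _ _ _ (J.+1 * m))/=; last 2 first.
- by rewrite leq_pmull.
- by rewrite leq_pmul2r.
rewrite -/(logsum _ _ _) IH// [RHS]big_nat_recr//=; congr (_ + _).
rewrite (eq_big_nat _ _ (F2 := fun n => u J.+1 * logw n)); last first.
  move=> n /andP[n1 n2]; congr (u _ * _); apply/eqP.
  by rewrite eqn_leq -ltnS ltn_divLR// n2 leq_divRL.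
rewrite -mulr_sumr sum_logw ?muln_gt0 ?m0 ?leq_pmul2r ?leqnSn//.
rewrite !natrM !lnM ?posrE ?ltr0n//; congr (_ * _); ring.
Qed.

Lemma ln_nat_large (e D : R) : 0 < e -> \forall k \near \oo, D <= e * ln k%:R.
Proof.
move=> e0; near=> k.
have k0 : (0 < k)%N by near: k; exists 1%N.
rewrite mulrC -ler_pdivrMr// -[D / e]expRK ler_ln ?posrE ?expR_gt0 ?ltr0n//.
by near: k; exact: nbhs_infty_ger.
Unshelve. all: by end_near. Qed.

Lemma ln_fact_cvg (e D : R) : 0 < e -> \forall k \near \oo, D <= e * ln k`!%:R.
Proof.
move=> e0; near=> k.
have k0 : (0 < k)%N by near: k; exists 1%N.
apply: (@le_trans _ _ (e * ln k%:R)); first by near: k; exact: ln_nat_large.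
rewrite ler_wpM2l ?(ltW e0)// ler_ln ?posrE ?ltr0n ?fact_gt0// ler_nat.
exact: leq_fact_self.
Unshelve. all: by end_near. Qed.

Lemma abs_logmean_le u (M : R) k : (forall n, `|u n| <= M) -> `|logmean u k| <= M.
Proof.
move=> uM; have M0 : 0 <= M by exact: le_trans (uM 0%N).
have l0 : 0 <= ln k`!%:R :> R by rewrite ln_ge0// ler1n fact_gt0.
rewrite /logmean normrM normfV (ger0_norm l0).
have [->|lp] := eqVneq (ln k`!%:R) (0 : R); first by rewrite invr0 mulr0.
rewrite ler_pdivrMr; last by rewrite lt_neqAle eq_sym lp.
by rewrite -sum_logw0 ?fact_gt0// abs_logsum.
Qed.

Lemma logmeanD (c : R) u v k :
  logmean (fun n => c * u n + v n) k = c * logmean u k + logmean v k.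
Proof.
rewrite /logmean /logsum mulrA -mulrDl; congr (_ / _).
by rewrite mulr_sumr -big_split/=; apply: eq_bigr => n _; rewrite mulrDl mulrA.
Qed.

Lemma logmean_small u (M : R) : (forall n, `|u n| <= M) ->
  (forall e, 0 < e -> exists D : R, forall k, `|logsum u 0 k`!| <= e * ln k`!%:R + D) ->
  logmean u k @[k --> \oo] --> (0 : R).
Proof.
move=> uM h; apply/cvgr0Pnorm_le => e e0.
have [|D hD] := h (e / 2); first by rewrite divr_gt0.
near=> k.
have lk : D <= e / 2 * ln k`!%:R by near: k; apply: ln_fact_cvg; rewrite divr_gt0.
have l1 : 1 <= 1 * ln k`!%:R :> R by near: k; exact: ln_fact_cvg.
rewrite mul1r in l1; have l0 : 0 < ln k`!%:R :> R by apply: lt_le_trans l1.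
rewrite /logmean normrM normfV (gtr0_norm l0) ler_pdivrMr//.
apply: le_trans (hD k) _; move: lk; move: (ln _) => x; lra.
Unshelve. all: by end_near. Qed.

Lemma logmean0 u : u n @[n --> \oo] --> (0 : R) ->
  (exists M : R, forall n, `|u n| <= M) -> logmean u k @[k --> \oo] --> (0 : R).
Proof.
move=> u0 [M uM]; apply: (logmean_small uM) => e e0.
have M0 : 0 <= M by exact: le_trans (uM 0%N).
have [N _ hN] := cvgr0_norm_le _ u0 _ e0.
exists (M * ln N.+1%:R) => k.
have l0 : 0 <= ln N.+1%:R :> R by rewrite ln_ge0// ler1n.
have lk : 0 <= ln k`!%:R :> R by rewrite ln_ge0// ler1n fact_gt0.
have [kN|Nk] := leqP k`! N.+1.
  apply: (@le_trans _ _ (M * ln k`!%:R)).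
    by rewrite -sum_logw0 ?fact_gt0// abs_logsum.
  rewrite -[leLHS]add0r lerD ?mulr_ge0 ?(ltW e0)// ler_wpM2l//.
  by rewrite ler_ln ?posrE ?ltr0n ?fact_gt0// ler_nat.
rewrite /logsum (@big_cat_nat _ _ _ N.+1)//=; last exact: ltnW.
rewrite -/(logsum _ _ _) -/(logsum _ _ _) addrC (le_trans (ler_normD _ _))// lerD//.
  apply: (@le_trans _ _ (e * \sum_(N.+1 <= n < k`!) logw n)).
    by apply: abs_logsum => n /andP[Nn _]; apply: hN => /=; exact: ltnW.
  rewrite ler_wpM2l ?(ltW e0)// sum_logw ?(ltnW Nk)//; lra.
by rewrite -sum_logw0// abs_logsum.
Qed.

(** Write k! = J m. By [logsum_dilate] the dilated sum from m to J m equals the original one from 1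
    to J. What remains are the dilated terms below m and the original ones from J to J m; each range
    has logarithmic weight ln m, whatever k is. *)
Lemma logmean_dilate u (M : R) m : (0 < m)%N -> (forall n, `|u n| <= M) ->
  logmean (fun n => u (n %/ m)%N - u n) k @[k --> \oo] --> (0 : R).
Proof.
move=> m0 uM; have M0 : 0 <= M by exact: le_trans (uM 0%N).
have l0 : 0 <= ln m%:R :> R by rewrite ln_ge0// ler1n.
apply: (@logmean_small _ (M + M)) => [n|e e0].
  by rewrite (le_trans (ler_normB _ _))// lerD.
exists (M * ln m%:R + M * ln m%:R + (M + M) * ln m`!%:R) => k.
have lk : 0 <= ln k`!%:R :> R by rewrite ln_ge0// ler1n fact_gt0.
have lm : 0 <= ln m`!%:R :> R by rewrite ln_ge0// ler1n fact_gt0.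
(* For k < m divisibility fails, but then k! <= m! and a constant suffices. *)
have [km|mk] := ltnP k m.
  apply: (@le_trans _ _ ((M + M) * ln k`!%:R)).
    rewrite -sum_logw0 ?fact_gt0// abs_logsum// => n _.
    by rewrite (le_trans (ler_normB _ _))// lerD.
  rewrite -[leLHS]add0r lerD ?mulr_ge0 ?(ltW e0)//.
  rewrite -[leLHS]add0r lerD ?addr_ge0 ?mulr_ge0// ler_wpM2l ?addr_ge0//.
  by rewrite ler_ln ?posrE ?ltr0n ?fact_gt0// ler_nat leq_factorial ?(ltnW km).
have /dvdnP[J kJ] : (m %| k`!)%N by rewrite dvdn_fact ?m0.
have J0 : (0 < J)%N by have := fact_gt0 k; rewrite kJ muln_gt0 => /andP[].
have mJm : (m <= J * m)%N by rewrite leq_pmull.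
have JJm : (J <= J * m)%N by rewrite leq_pmulr.
have -> : logsum (fun n => u (n %/ m)%N - u n) 0 k`! =
    logsum (fun n => u (n %/ m)%N) 0 m - u 0%N * logw 0 - logsum u J (J * m).
  rewrite kJ; transitivity (logsum (fun n => u (n %/ m)%N) 0 (J * m) - logsum u 0 (J * m)).
    by rewrite /logsum -sumrB; apply: eq_bigr => n _; rewrite mulrBl.
  rewrite {1}/logsum (@big_cat_nat _ _ _ m)//= -/(logsum _ _ _) -/(logsum _ _ _).
  rewrite logsum_dilate// [logsum u 0 _]/logsum (@big_cat_nat _ _ _ J)//= -/(logsum _ _ _).
  have -> : logsum u 0 J = u 0%N * logw 0 + logsum u 1 J by rewrite /logsum big_ltn.
  rewrite /logsum [logw 0]/=; ring.
rewrite /= mulr0 subr0; apply: (@le_trans _ _ (M * ln m%:R + M * ln m%:R)); last first.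
  rewrite -[leLHS]add0r lerD ?mulr_ge0 ?(ltW e0)// -[leLHS]addr0 lerD//.
  by rewrite mulr_ge0 ?addr_ge0.
apply: le_trans (ler_normB _ _) _; apply: lerD.
  by rewrite -sum_logw0// abs_logsum.
apply: (@le_trans _ _ (M * \sum_(J <= n < J * m) logw n)); first exact: abs_logsum.
rewrite sum_logw ?J0// natrM lnM ?posrE ?ltr0n// ler_wpM2l//; lra.
Qed.

End LogMean.

(** * Limits of logarithmic means along a free ultrafilter *)

Section GeneralizedLimit.
Variable R : realType.
Local Notation C := R[i].
Local Notation nc := Normc.normc.

(** Guarantees that the quantifier over generalized limits in [common_dixmier_value] is not vacuous,
    so that [connes_trace] is a determined number. Dilation invariance comes from the logarithmic
    means, existence of the limit from the ultrafilter. *)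
Lemma exists_generalized_limit :
  exists w : (nat -> C) -> C, generalized_limit w /\ dilation_invariant w.
Proof.
have [U [UU Uoo]] := exists_free_ultrafilter.
have UP : ProperFilter U by exact: ultra_proper.
pose bnd (u : nat -> R) := exists M : R, forall n, `|u n| <= M.
pose L (u : nat -> R) : R := lim (logmean u @ U).
have Lc u : bnd u -> logmean u @ U --> L u.
  move=> [M uM]; have [l hl] := @ultra_limit R U UU (logmean u) M (fun k => abs_logmean_le k uM).
  by rewrite /L (cvg_lim _ hl).
have LE u l : logmean u @ U --> l -> L u = l by move=> h; exact: cvg_lim.
have LD c u v : bnd u -> bnd v -> L (fun n => c * u n + v n) = c * L u + L v.
  move=> bu bv; apply: LE.
  rewrite (_ : logmean _ = (fun k => c * logmean u k) \+ logmean v); last first.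
    by apply/funext => k; rewrite logmeanD.
  by apply: cvgD; [apply: cvgM; [exact: cvg_cst|exact: Lc]|exact: Lc].
have L0 u : logmean u @ \oo --> (0 : R) -> L u = 0.
  by move=> h; apply: LE => B /h; exact: Uoo.
have bRe u : bounded_sequence u -> bnd (fun n => complex.Re (u n)).
  by move=> [M hM]; exists M => n; exact: le_trans (abs_Re_le _) (hM n).
have bIm u : bounded_sequence u -> bnd (fun n => complex.Im (u n)).
  by move=> [M hM]; exists M => n; exact: le_trans (abs_Im_le _) (hM n).
have bZ c u : bnd u -> bnd (fun n => c * u n).
  by move=> [M hM]; exists (`|c| * M) => n; rewrite normrM ler_wpM2l.
have bD u v : bnd u -> bnd v -> bnd (fun n => u n + v n).
  move=> [M hM] [N hN]; exists (M + N) => n.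
  by apply: le_trans (ler_normD _ _) _; apply: lerD.
have L00 : L (fun=> 0) = 0.
  apply: L0; apply: logmean0; first exact: cvg_cst.
  by exists 0 => n; rewrite normr0.
exists (fun u => L (fun n => complex.Re (u n)) +i* L (fun n => complex.Im (u n))).
split; [split|].
- move=> [a b] u v bu bv.
  rewrite (_ : (fun n => complex.Re _) = fun n => a * complex.Re (u n) +
      (- b * complex.Im (u n) + complex.Re (v n))); last first.
    by apply/funext => n; case: (u n) (v n) => ? ? [? ?] /=; ring.
  rewrite (_ : (fun n => complex.Im _) = fun n => a * complex.Im (u n) +
      (b * complex.Re (u n) + complex.Im (v n))); last first.
    by apply/funext => n; case: (u n) (v n) => ? ? [? ?] /=; ring.
  have h1 := bRe _ bu; have h2 := bIm _ bu; have h3 := bRe _ bv; have h4 := bIm _ bv.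
  rewrite (LD a)//; last by apply: bD => //; exact: bZ.
  rewrite (LD (- b))// (LD a)//; last by apply: bD => //; exact: bZ.
  rewrite (LD b)//.
  by apply/eqP; rewrite eq_complex/=; apply/andP; split; apply/eqP; ring.
- move=> u bu u0.
  have -> : (fun n => complex.Im (u n)) = fun=> 0.
    by apply/funext => n; have := u0 n; rewrite lecE => /andP[/eqP].
  rewrite L00 lecE/= eqxx/=.
  apply: (cvgr_to_ge (Lc _ (bRe _ bu))); apply: nearW => k.
  rewrite /logmean divr_ge0 ?ln_ge0 ?ler1n ?fact_gt0// sumr_ge0// => n _.
  by rewrite mulr_ge0 ?logw_ge0//; have := u0 n; rewrite lecE => /andP[].
- rewrite (_ : (fun n => complex.Im 1) = fun=> 0) ?L00//.
  congr (_ +i* _); apply: LE.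
  apply: (cvg_trans _ (@cvg_cst _ (1 : R) _ U _)).
  apply: near_eq_cvg; apply: Uoo; near=> k.
  have l1 : 1 <= 1 * ln k`!%:R :> R by near: k; exact: ln_fact_cvg.
  rewrite mul1r in l1; have l0 : 0 < ln k`!%:R :> R by apply: lt_le_trans l1.
  rewrite /logmean /logsum; under eq_bigr do rewrite mul1r.
  by rewrite sum_logw0 ?fact_gt0// divff// gt_eqF.
- move=> u u0.
  have cu : (fun n => nc (u n)) @ \oo --> (0 : R).
    apply/cvgr0Pnorm_le => e e0; have e0' : 0 < e%:C by rewrite ltcR.
    apply: (filterS _ (cvgr0_norm_le _ u0 _ e0')) => n /=.
    by rewrite lecR ger0_norm// normc_ge0.
  have cl (f : C -> R) : (forall z, `|f z| <= nc z) ->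
      logmean (fun n => f (u n)) @ \oo --> (0 : R).
    move=> hf; have c : (fun n => f (u n)) @ \oo --> (0 : R).
      apply/cvgr0Pnorm_le => e e0.
      apply: (filterS _ (cvgr0_norm_le _ cu _ e0)) => n.
      rewrite ger0_norm ?normc_ge0// => h.
      exact: le_trans (hf _) h.
    apply: logmean0 => //; have [M [_ hM]] := cvg_seq_bounded (cvgP _ c).
    by exists (M + 1) => n; apply: hM => //; rewrite ltrDl.
  rewrite !L0//; first by apply: cl; exact: abs_Im_le.
  by apply: cl; exact: abs_Re_le.
move=> m u m0 bu; have D v : bnd v -> L (fun n => v (n %/ m)%N) = L v.
  move=> bv; have bv' : bnd (fun n => v (n %/ m)%N).
    by have [M hM] := bv; exists M.
  have [M hM] := bv; have h := L0 _ (logmean_dilate m0 hM).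
  have := LD (-1) v _ bv bv'; rewrite mulN1r (_ : L _ = 0).
    by move/eqP; rewrite eq_sym addrC subr_eq0 => /eqP.
  by rewrite -h; congr L; apply/funext => n; rewrite mulN1r addrC.
by rewrite (D (fun n => complex.Re (u n)))// ?(D (fun n => complex.Im (u n)))//;
  [exact: bIm|exact: bRe].
Unshelve. all: by end_near. Qed.

Lemma generalized_limit_cvg (w : (nat -> C) -> C) (x : nat -> R) (c : R) :
  generalized_limit w -> x @ \oo --> c -> w (fun n => (x n)%:C) = c%:C.
Proof.
move=> [wlin _ w1 w0] xc.
have bx : bounded_sequence (fun n => (x n - c)%:C).
  have xc' : (fun n => x n - c) @ \oo --> c - c by apply: cvgB => //; exact: cvg_cst.
  have [M [_ hM]] := cvg_seq_bounded (cvgP _ xc').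
  by exists (M + 1) => n; rewrite normc_real; apply: hM => //; rewrite ltrDl.
have b1 : bounded_sequence (fun=> 1 : C).
  by exists 1 => n; rewrite Normc.normc1.
have := wlin c%:C _ _ b1 bx; rewrite w1 mulr1 (w0 (fun n => (x n - c)%:C)) ?addr0; last first.
  apply/cvgr0Pnorm_le => e; rewrite ltcE => /andP[/eqP ie re].
  apply: (filterS _ (cvgr_distC_le _ _ xc _ re)) => n /= h; rewrite lecE ie eqxx/= expr0n/= addr0 sqrtr_sqr.
  exact: h.
by move=> <-; congr w; apply/funext => n; rewrite -rmorphD addrC subrK.
Qed.

Lemma complex_cvg (T : Type) (F : set_system T) (FF : Filter F) (x y : T -> R)
    (l m : R) : x @ F --> l -> y @ F --> m ->
  (fun t => (x t +i* y t : C^o)) @ F --> (l +i* m : C^o).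
Proof.
move=> xl ym; apply/cvgrPdist_le => e; rewrite ltcE => /andP[/eqP ie re].
have re2 : 0 < complex.Re e / 2 by rewrite divr_gt0.
near=> t.
have h1 : `|l - x t| <= complex.Re e / 2 by near: t; exact: (cvgr_dist_le _ _ xl).
have h2 : `|m - y t| <= complex.Re e / 2 by near: t; exact: (cvgr_dist_le _ _ ym).
rewrite lecE/= ie eqxx/= -ler_sqr ?nnegrE ?sqrtr_ge0 ?(ltW re)//.
rewrite sqr_sqrtr ?addr_ge0 ?sqr_ge0//.
rewrite -(real_normK (num_real (l - x t))) -(real_normK (num_real (m - y t))).
have n1 := normr_ge0 (l - x t); have n2 := normr_ge0 (m - y t).
move: h1 h2 n1 n2 re; move: `|l - x t| `|m - y t| (complex.Re e) => u v r.
move=> *; nra.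
Unshelve. all: by end_near. Qed.

End GeneralizedLimit.

(** * Diagonal operators with geometrically decaying weights *)

Lemma eq_ler (R : numDomainType) (x y : R) : x = y -> x <= y.
Proof. by move->. Qed.

Section Levels.
Variables (R : realType) (I : choiceType) (lev : I -> nat) (lv : nat -> seq I).
Hypothesis lv_uniq : forall q, uniq (lv q).
Hypothesis mem_lv : forall q i, (i \in lv q) = (lev i == q).
Variables (a : I -> R) (rho c1 c2 K1 K2 : R).
Hypothesis rho_gt1 : 1 < rho.
Hypothesis c1_gt0 : 0 < c1.
Hypothesis c2_gt0 : 0 < c2.
Hypothesis a_ge : forall i, c1 * rho ^- lev i <= a i.
Hypothesis a_le : forall i, a i <= c2 * rho ^- lev i.
Hypothesis K1_gt0 : 0 < K1.
Hypothesis lsum_ge : forall q, K1 <= \sum_(i <- lv q) a i.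
Hypothesis lsum_le : forall q, \sum_(i <- lv q) a i <= K2.
Implicit Types (g : I -> R).

Definition lsum g q : R := \sum_(i <- lv q) g i * a i.
Definition below Q : seq I := flatten [seq lv q | q <- iota 0 Q].

(* Equivalent to the convergence of [S Q / Q] to [G], in a form that is visibly
   stable under bounded perturbations of [S]. *)
Definition asymp (S : nat -> R) (G : R) : Prop :=
  forall e, 0 < e -> exists D : R, forall Q, `|S Q - G * Q%:R| <= e * Q%:R + D.

Let rho_gt0 : 0 < rho. Proof. exact: lt_trans rho_gt1. Qed.
Let rhoX_gt0 q : 0 < rho ^- q. Proof. by rewrite invr_gt0 exprn_gt0. Qed.

Lemma level_weight_gt0 i : 0 < a i.
Proof. by apply: lt_le_trans (a_ge i); rewrite mulr_gt0. Qed.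

Lemma mem_below Q i : (i \in below Q) = (lev i < Q)%N.
Proof.
apply/flattenP/idP => [[_ /mapP[q + ->]]|lQ].
  by rewrite mem_iota mem_lv add0n => /andP[_ qQ] /eqP ->.
by exists (lv (lev i)); [rewrite map_f// mem_iota|rewrite mem_lv].
Qed.

Lemma belowS Q : below Q.+1 = below Q ++ lv Q.
Proof. by rewrite /below -addn1 iotaD map_cat flatten_cat/= cats0. Qed.

Lemma below_uniq Q : uniq (below Q).
Proof.
elim: Q => // Q IH; rewrite belowS cat_uniq IH lv_uniq andbT.
by apply/hasPn => i; rewrite mem_lv mem_below => /eqP ->; rewrite ltnn.
Qed.

Lemma sum_below Q (F : I -> R) :
  \sum_(i <- below Q) F i = \sum_(q < Q) \sum_(i <- lv q) F i.
Proof.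
elim: Q => [|Q IH]; first by rewrite big_nil big_ord0.
by rewrite belowS big_cat/= IH big_ord_recr.
Qed.

Lemma sum_le_below (F : I -> R) (s : seq I) Q : (forall i, 0 <= F i) -> uniq s ->
  (forall i, i \in s -> (lev i < Q)%N) ->
  \sum_(i <- s) F i <= \sum_(i <- below Q) F i.
Proof.
move=> F0 us sQ; rewrite [leRHS](bigID (fun i => i \in s))/=.
have P : perm_eq [seq i <- below Q | i \in s] s.
  apply: uniq_perm; rewrite ?filter_uniq ?below_uniq// => i.
  by rewrite mem_filter mem_below; case: (boolP (i \in s)) => // /sQ ->.
by rewrite -[X in _ <= X + _]big_filter (perm_big _ P) lerDl sumr_ge0.
Qed.

Lemma sum_constr (s : seq I) (c : R) : \sum_(i <- s) c = c * (size s)%:R.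
Proof. by rewrite big_const_seq count_predT iter_addr_0 mulr_natr. Qed.

Lemma size_lv_le q : (size (lv q))%:R <= K2 / c1 * rho ^+ q.
Proof.
have h : c1 * rho ^- q * (size (lv q))%:R <= K2.
  rewrite -sum_constr; apply: le_trans (lsum_le q).
  by rewrite !big_seq; apply: ler_sum => i; rewrite mem_lv => /eqP <-.
rewrite mulrAC ler_pdivlMr// mulrC; move: h.
by rewrite mulrAC ler_pdivrMr ?exprn_gt0.
Qed.

Lemma size_lv_ge q : K1 / c2 * rho ^+ q <= (size (lv q))%:R.
Proof.
have h : K1 <= c2 * rho ^- q * (size (lv q))%:R.
  rewrite -sum_constr; apply: le_trans (lsum_ge q) _.
  by rewrite !big_seq; apply: ler_sum => i; rewrite mem_lv => /eqP <-.
rewrite mulrAC ler_pdivrMr// mulrC [leRHS]mulrC; move: h.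
by rewrite mulrAC ler_pdivlMr ?exprn_gt0// mulrC.
Qed.

Lemma K2_gt0 : 0 < K2.
Proof. by apply: lt_le_trans K1_gt0 (le_trans (lsum_ge 0) (lsum_le 0)). Qed.

Lemma size_below_le Q : (size (below Q))%:R <= K2 / c1 / (rho - 1) * rho ^+ Q.
Proof.
have r1 : 0 < rho - 1 by rewrite subr_gt0.
elim: Q => [|Q IH].
  by rewrite expr0 mulr1 !divr_ge0 ?ltW// K2_gt0.
rewrite belowS size_cat natrD.
apply: le_trans (lerD IH (size_lv_le Q)) _.
rewrite exprS; set x := rho ^+ Q; set y := K2 / c1.
by rewrite [leRHS](_ : _ = y / (rho - 1) * x + y * x)//; field; rewrite gt_eqF.
Qed.

Lemma size_lv_gt0 q : (0 < size (lv q))%N.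
Proof.
rewrite -(ltr_nat R); apply: lt_le_trans (size_lv_ge q).
by rewrite mulr_gt0 ?divr_gt0 ?exprn_gt0.
Qed.

Lemma size_below_ge Q : (Q <= size (below Q))%N.
Proof.
by elim: Q => // Q IH; rewrite belowS size_cat -addn1 leq_add// size_lv_gt0.
Qed.

Lemma levels_infinite (F : seq I) : exists i, i \notin F.
Proof.
have [|i _ iF] := uniq_notin (below_uniq (size F).+1) (s := F); last by exists i.
by apply: leq_trans (size_below_ge _).
Qed.

Lemma between_sizes m : exists Q, (size (below Q) <= m < size (below Q.+1))%N.
Proof.
elim: m => [|m [Q /andP[Qm mQ]]]; first by exists 0%N; rewrite belowS size_lv_gt0.
have [mQ'|mQ'] := ltnP m.+1 (size (below Q.+1)).
  by exists Q; rewrite mQ' andbT (leq_trans Qm).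
exists Q.+1; rewrite mQ'/= belowS size_cat.
by apply: (@leq_trans (size (below Q.+1)).+1); rewrite // -addn1 leq_add2l size_lv_gt0.
Qed.

Lemma ln_between : exists D : R, forall Q m,
  (size (below Q) <= m < size (below Q.+1))%N ->
  `|ln (m.+1%:R) - ln rho * Q%:R| <= D.
Proof.
set A := K2 / c1 / (rho - 1) * rho.
(* For Q > 0 the lower bound counts the block just below Q, whence the term [ln rho] in the error.
   For Q = 0 there is no such block and only m + 1 >= 1 is available, whence the minimum with 1. *)
pose B := Num.min 1 (K1 / c2).
have A0 : 0 < A.
  by rewrite mulr_gt0// divr_gt0 ?subr_gt0// divr_gt0// K2_gt0.
have B0 : 0 < B by rewrite lt_min ltr01/= divr_gt0.
have L0 : 0 < ln rho by rewrite ln_gt0.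
have hA Q : (size (below Q.+1))%:R <= A * rho ^+ Q.
  by apply: le_trans (size_below_le _) _; rewrite exprS mulrA.
have B1 : B <= 1 by rewrite ge_min lexx.
have BK : B <= K1 / c2 by rewrite ge_min lexx orbT.
clearbody A B.
exists (`|ln A| + (`|ln B| + ln rho)) => Q m /andP[Qm mQ].
have m0 : 0 < m.+1%:R :> R by rewrite ltr0n.
have h1 : ln m.+1%:R <= ln A + ln rho * Q%:R.
  have -> : ln A + ln rho * Q%:R = ln (A * rho ^+ Q).
    by rewrite lnM ?posrE ?exprn_gt0// lnXn// mulr_natr.
  rewrite ler_ln ?posrE ?mulr_gt0 ?exprn_gt0//.
  by apply: le_trans (hA Q); rewrite ler_nat.
have h2 : ln B + ln rho * Q%:R <= ln m.+1%:R + ln rho.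
  have -> : ln B + ln rho * Q%:R = ln (B * rho ^+ Q).
    by rewrite lnM ?posrE ?exprn_gt0// lnXn// mulr_natr.
  rewrite -lnM ?posrE// ler_ln ?posrE ?mulr_gt0 ?exprn_gt0//.
  case: Q Qm {mQ h1} => [|Q] Qm.
    rewrite expr0 mulr1 (le_trans B1)//.
    by rewrite -[leLHS]mul1r ler_pM ?ler01// ?ler1n// ltW.
  rewrite exprSr mulrA ler_wpM2r ?(ltW rho_gt0)//.
  apply: (@le_trans _ _ (K1 / c2 * rho ^+ Q)).
    by rewrite ler_wpM2r ?exprn_ge0 ?(ltW rho_gt0).
  apply: le_trans (size_lv_ge Q) _; rewrite ler_nat.
  by rewrite (leq_trans _ (leqnSn m))// (leq_trans _ Qm)// belowS size_cat leq_addl.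
move: h1 h2; have := ler_norm (ln A); have := ler_norm (- ln B); rewrite normrN.
have := normr_ge0 (ln A); have := normr_ge0 (ln B).
rewrite ler_norml; move: L0 (ln m.+1%:R) (ln rho * Q%:R).
by move=> *; apply/andP; split; lra.
Qed.

(** * Partial sums of singular values against block sums *)

Section SingularSums.
Variables (g : I -> R) (M G : R) (s : nat -> R).
Hypothesis g_ge0 : forall i, 0 <= g i.
Hypothesis g_le : forall i, g i <= M.
Hypothesis s_ge : forall (F : seq I) n, uniq F -> (size F <= n)%N ->
  \sum_(i <- F) g i * a i <= \sum_(j < n) s j.
Hypothesis s_le : forall n, exists F : seq I, [/\ uniq F, (size F <= n)%N &
  \sum_(j < n) s j <= \sum_(i <- F) g i * a i].
Hypothesis gG : asymp (fun Q => \sum_(q < Q) lsum g q) G.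

Let M_ge0 : 0 <= M.
Proof. by have [i _] := levels_infinite [::]; exact: le_trans (g_le i). Qed.

Let ga_ge0 i : 0 <= g i * a i.
Proof. by rewrite mulr_ge0// ltW// level_weight_gt0. Qed.

(* By the Ky Fan bounds the partial sum of the singular values up to [m] differs
   from that over the levels below [Q] by at most the contribution of one level
   and of [m] terms of size [rho ^- Q], which is bounded. *)
Lemma singular_sum_between : exists D : R, forall Q m,
  (size (below Q) <= m < size (below Q.+1))%N ->
  `|\sum_(j < m) s j - \sum_(q < Q) lsum g q| <= D.
Proof.
exists (M * K2 + M * c2 * (K2 / c1 / (rho - 1))) => Q m /andP[Qm mQ].
have e0 : 0 <= M * c2 * (K2 / c1 / (rho - 1)).
  by rewrite !mulr_ge0 ?invr_ge0 ?(ltW c2_gt0) ?(ltW c1_gt0) ?(ltW K2_gt0) ?subr_ge0 ?(ltW rho_gt1).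
have h1 : \sum_(q < Q) lsum g q <= \sum_(j < m) s j.
  by rewrite -sum_below; apply: s_ge => //; exact: below_uniq.
rewrite ger0_norm ?subr_ge0// lerBlDl.
have [F [uF Fm sF]] := s_le m; apply: (le_trans sF).
rewrite (bigID (fun i => lev i < Q.+1)%N)/= addrA; apply: lerD.
  rewrite -big_filter; apply: (@le_trans _ _ (\sum_(i <- below Q.+1) g i * a i)).
    apply: sum_le_below => //; first by rewrite filter_uniq.
    by move=> i; rewrite mem_filter => /andP[].
  rewrite belowS big_cat/= sum_below lerD2l.
  apply: (@le_trans _ _ (\sum_(i <- lv Q) M * a i)).
    by apply: ler_sum => i _; rewrite ler_wpM2r// ltW// level_weight_gt0.
  by rewrite -mulr_sumr ler_wpM2l.
apply: (@le_trans _ _ (\sum_(i <- F) M * (c2 * rho ^- Q.+1))).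
  rewrite [leRHS](bigID (fun i => lev i < Q.+1)%N)/= -[leLHS]add0r lerD//.
    by rewrite sumr_ge0// => i _; rewrite !mulr_ge0 ?(ltW c2_gt0) ?(ltW (rhoX_gt0 _)).
  apply: ler_sum => i; rewrite -leqNgt => Qi.
  apply: ler_pM => //; first exact/ltW/level_weight_gt0.
  apply: le_trans (a_le i) _; rewrite ler_wpM2l ?(ltW c2_gt0)//.
  by rewrite lef_pV2 ?posrE ?exprn_gt0// ler_weXn2l// ltW.
rewrite sum_constr.
rewrite (_ : _ * _ * _ = M * c2 * ((size F)%:R / rho ^+ Q.+1)); last first.
  by rewrite -!mulrA (mulrC (size F)%:R).
rewrite ler_wpM2l ?mulr_ge0 ?(ltW c2_gt0)// ler_pdivrMr ?exprn_gt0//.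
apply: le_trans (size_below_le _); rewrite ler_nat.
exact: leq_trans Fm (ltnW mQ).
Qed.

Lemma singular_sum_asymp e : 0 < e -> exists D : R, forall m,
  `|\sum_(j < m) s j - G / ln rho * ln m.+1%:R| <= e * ln m.+1%:R + D.
Proof.
move=> e0; have L0 : 0 < ln rho by rewrite ln_gt0.
have [D1 h1] := singular_sum_between; have [D2 h2] := ln_between.
(* By [ln_between], [e * ln rho * Q] is [e * ln m.+1] up to a constant. *)
have [|D3 h3] := gG (e := e * ln rho); first by rewrite mulr_gt0.
exists (D1 + D3 + `|G / ln rho| * D2 + e * D2) => m.
have [Q Qm] := between_sizes m.
have {}h1 := h1 _ _ Qm; have {}h2 := h2 _ _ Qm; have {}h3 := h3 Q.
have h4 : `|G * Q%:R - G / ln rho * ln m.+1%:R| <= `|G / ln rho| * D2.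
  have -> : G * Q%:R - G / ln rho * ln m.+1%:R =
      - (G / ln rho * (ln m.+1%:R - ln rho * Q%:R)) by field; rewrite gt_eqF.
  by rewrite normrN normrM ler_wpM2l.
have h5 : e * ln rho * Q%:R <= e * ln m.+1%:R + e * D2.
  rewrite -mulrA -mulrDr ler_wpM2l ?(ltW e0)//.
  by move: h2; rewrite ler_norml => /andP[h _]; rewrite -lerBlDl lerNr in h *; lra.
move: h1 h3 h4 h5; rewrite !ler_norml => /andP[? ?] /andP[? ?] /andP[? ?] ?.
by apply/andP; split; lra.
Qed.

End SingularSums.

(* Frobenius' theorem that a Cesaro limit is an Abel limit, in a form with
   explicit error bounds and finite sums. *)
Lemma abel_bound (C : nat -> R) (G e D z : R) N : 0 <= z -> z <= 1 ->
  (forall Q, `|\sum_(q < Q) C q - G * Q%:R| <= e * Q%:R + D) ->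
  `|\sum_(q < N) z ^+ q * C q - G * \sum_(q < N) z ^+ q| <=
    e * (\sum_(q < N) z ^+ q) + D.
Proof.
move=> z0 z1 h; pose T Q := \sum_(q < Q) C q - G * Q%:R.
pose E N := \sum_(q < N) z ^+ q * C q - G * \sum_(q < N) z ^+ q.
pose A N := e * (\sum_(q < N) z ^+ q) + D.
have TN : T 0%N = 0 by rewrite /T big_ord0 mulr0 subrr.
(* Summation by parts as an induction: the left expression grows by z^n (1 - z) T (n + 1), the right
   one by the same with T (n + 1) replaced by its bound e (n + 1) + D. *)
have key n : `|E n - z ^+ n * T n| <= A n - z ^+ n * (e * n%:R + D).
  elim: n => [|n IH].
    by rewrite /E /A TN !big_ord0 expr0 !(mulr0, subr0, oppr0, add0r, mul1r) normr0 subrr.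
  rewrite (_ : E n.+1 - _ = (E n - z ^+ n * T n) + z ^+ n * (1 - z) * T n.+1); last first.
    by rewrite /E /T !big_ord_recr/= -natr1 exprS; ring.
  rewrite (_ : A n.+1 - _ = (A n - z ^+ n * (e * n%:R + D)) +
      z ^+ n * (1 - z) * (e * n.+1%:R + D)); last first.
    by rewrite /A !big_ord_recr/= -natr1 exprS; ring.
  apply: le_trans (ler_normD _ _) _; apply: lerD => //.
  have p : 0 <= z ^+ n * (1 - z) by rewrite mulr_ge0 ?exprn_ge0 ?subr_ge0.
  by rewrite normrM (ger0_norm p) ler_wpM2l// h.
have h2 : `|z ^+ N * T N| <= z ^+ N * (e * N%:R + D).
  by rewrite normrM ger0_norm ?exprn_ge0// ler_wpM2l ?exprn_ge0// h.
rewrite -/(E N) -/(A N); have := key N; rewrite -[E N in X in _ -> X](subrK (z ^+ N * T N)).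
move=> h1; apply: le_trans (ler_normD _ _) _; lra.
Qed.

(** * The zeta function at s = 1 + h, compared with a power series in z = rho ^ -h *)

Section Zeta.
Variables (g : I -> R) (M G : R).
Hypothesis g_ge0 : forall i, 0 <= g i.
Hypothesis g_le : forall i, g i <= M.
Hypothesis G_ge0 : 0 <= G.
Hypothesis gG : asymp (fun Q => \sum_(q < Q) lsum g q) G.

Let M_ge0 : 0 <= M.
Proof. by have [i _] := levels_infinite [::]; exact: le_trans (g_le i). Qed.

Variables (h z : R).
Hypothesis h_gt0 : 0 < h.
Hypothesis z_def : z = expR (- (h * ln rho)).

Let L_gt0 : 0 < ln rho. Proof. by rewrite ln_gt0. Qed.
Let hL_gt0 : 0 < h * ln rho. Proof. exact: mulr_gt0. Qed.
Let z_gt0 : 0 < z. Proof. by rewrite z_def expR_gt0. Qed.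
Let z_lt1 : z < 1.
Proof. by rewrite z_def -[ltRHS]expR0 ltr_expR oppr_lt0. Qed.

(** Only the factor a ^ h is estimated: there rho ^- lev becomes z ^ lev, and the constant becomes
    c1 ^ h = exp (h ln c1), which tends to 1 with h. So comparability of the weights suffices for an
    exact limit. *)
Lemma weight_powR_ge i : expR (h * ln c1) * (z ^+ lev i * a i) <= a i `^ (1 + h).
Proof.
have a0 := level_weight_gt0 i.
rewrite powRD ?(gt_eqF a0) ?implybT// powRr1 ?(ltW a0)// mulrA mulrC ler_wpM2l ?(ltW a0)//.
rewrite /powR (gt_eqF a0) z_def -expRM_natl -expRD ler_expR.
have : ln (c1 * rho ^- lev i) <= ln (a i).
  by rewrite ler_ln ?posrE ?mulr_gt0// ?a_ge.
rewrite lnM ?posrE// lnV ?posrE ?exprn_gt0// lnXn// => hh.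
by apply: le_trans (ler_wpM2l (ltW h_gt0) hh); rewrite -mulr_natl; apply: eq_ler; ring.
Qed.

Lemma weight_powR_le i : a i `^ (1 + h) <= expR (h * ln c2) * (z ^+ lev i * a i).
Proof.
have a0 := level_weight_gt0 i.
rewrite powRD ?(gt_eqF a0) ?implybT// powRr1 ?(ltW a0)// mulrA [leRHS]mulrC ler_wpM2l ?(ltW a0)//.
rewrite /powR (gt_eqF a0) z_def -expRM_natl -expRD ler_expR.
have : ln (a i) <= ln (c2 * rho ^- lev i).
  by rewrite ler_ln ?posrE ?mulr_gt0// ?a_le.
rewrite lnM ?posrE// lnV ?posrE ?exprn_gt0// lnXn// => hh.
by apply: le_trans (ler_wpM2l (ltW h_gt0) hh) _; rewrite -mulr_natl; apply: eq_ler; ring.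
Qed.

Lemma sum_geometric N : \sum_(q < N) z ^+ q = (1 - z ^+ N) / (1 - z).
Proof.
have z1 : 1 - z != 0 by rewrite subr_eq0 eq_sym lt_eqF.
apply: (mulIf z1); rewrite divfK//.
rewrite -[RHS]opprB subrX1; ring.
Qed.

Lemma sum_geometric_le N : \sum_(q < N) z ^+ q <= (1 - z)^-1.
Proof.
rewrite sum_geometric ler_pdivrMr ?subr_gt0// mulVf ?gt_eqF ?subr_gt0//.
by rewrite gerBl exprn_ge0// ltW.
Qed.

Lemma sum_below_weighted N :
  \sum_(i <- below N) g i * (z ^+ lev i * a i) = \sum_(q < N) z ^+ q * lsum g q.
Proof.
rewrite sum_below; apply: eq_bigr => q _; rewrite mulr_sumr !big_seq.
by apply: eq_bigr => i; rewrite mem_lv => /eqP <-; rewrite mulrCA.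
Qed.

Lemma zeta_bounded : bounded_sums (fun i => g i * a i `^ (1 + h)).
Proof.
exists (expR (h * ln c2) * (M * K2 * (1 - z)^-1)) => s us.
pose N := (\max_(i <- s) lev i).+1.
apply: (@le_trans _ _ (\sum_(i <- s) expR (h * ln c2) * (g i * (z ^+ lev i * a i)))).
  by apply: ler_sum => i _; rewrite mulrCA ler_wpM2l// weight_powR_le.
rewrite -mulr_sumr ler_wpM2l ?expR_ge0//.
apply: (@le_trans _ _ (\sum_(i <- below N) (g i * (z ^+ lev i * a i)))).
  apply: sum_le_below => // i.
    by rewrite !mulr_ge0 ?exprn_ge0 ?(ltW z_gt0)// ltW// level_weight_gt0.
  by move=> is_; rewrite ltnS; exact: leq_bigmax_seq.
rewrite sum_below_weighted.
apply: (@le_trans _ _ (\sum_(q < N) M * K2 * z ^+ q)).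
  apply: ler_sum => q _; rewrite mulrC ler_wpM2r ?exprn_ge0 ?(ltW z_gt0)//.
  apply: (@le_trans _ _ (\sum_(i <- lv q) M * a i)).
    by apply: ler_sum => i _; rewrite ler_wpM2r// ltW// level_weight_gt0.
  by rewrite -mulr_sumr ler_wpM2l.
by rewrite -mulr_sumr ler_wpM2l ?sum_geometric_le// mulr_ge0// ltW// K2_gt0.
Qed.

Let zeta_ge0 i : 0 <= g i * a i `^ (1 + h).
Proof. by rewrite mulr_ge0// powR_ge0. Qed.

(** With x = h ln rho, the bounds 1 - x <= exp (- x) <= 1 / (1 + x) squeeze h / (1 - z) between 1 /
    ln rho and (1 + x) / ln rho. This is where the factor 1 / ln rho of the limit originates. *)
Let gap_le : (1 - z) <= h * ln rho.
Proof. by rewrite z_def lerBlDr -lerBlDl -[X in _ <= X]opprK; have := expR_ge1Dx (- (h * ln rho)); lra. Qed.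

Let gap_ge : h * ln rho / (1 + h * ln rho) <= 1 - z.
Proof.
have p : 0 < 1 + h * ln rho by rewrite addr_gt0.
have : z <= (1 + h * ln rho)^-1.
  by rewrite z_def expRN lef_pV2 ?posrE ?expR_gt0// expR_ge1Dx.
move=> hz; have -> : h * ln rho / (1 + h * ln rho) = 1 - (1 + h * ln rho)^-1.
  by field; rewrite gt_eqF.
lra.
Qed.

Variables (e D : R).
Hypothesis eD : forall Q, `|\sum_(q < Q) lsum g q - G * Q%:R| <= e * Q%:R + D.
Hypothesis e_gt0 : 0 < e.

Let hz_le : h / (1 - z) <= (1 + h * ln rho) / ln rho.
Proof.
rewrite ler_pdivrMr ?subr_gt0// mulrC -ler_pdivrMr ?divr_gt0 ?addr_gt0//.
by apply: le_trans gap_ge; apply: eq_ler; field; rewrite !gt_eqF ?addr_gt0.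
Qed.

Let hz_ge : (ln rho)^-1 <= h / (1 - z).
Proof.
rewrite ler_pdivlMr ?subr_gt0// mulrC ler_pdivrMr//.
Qed.

Lemma zeta_le : h * nsum (fun i => g i * a i `^ (1 + h)) <=
  expR (h * ln c2) * ((G + e) * ((1 + h * ln rho) / ln rho) + h * D).
Proof.
have z1 : 0 < (1 - z)^-1 by rewrite invr_gt0 subr_gt0.
have : nsum (fun i => g i * a i `^ (1 + h)) <=
    expR (h * ln c2) * ((G + e) * (1 - z)^-1 + D).
  apply: nsum_le => // s us.
  pose N := (\max_(i <- s) lev i).+1.
  apply: (@le_trans _ _ (\sum_(i <- s) expR (h * ln c2) * (g i * (z ^+ lev i * a i)))).
    by apply: ler_sum => i _; rewrite mulrCA ler_wpM2l// weight_powR_le.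
  rewrite -mulr_sumr ler_wpM2l ?expR_ge0//.
  apply: (@le_trans _ _ (\sum_(i <- below N) (g i * (z ^+ lev i * a i)))).
    apply: sum_le_below => // i.
      by rewrite !mulr_ge0 ?exprn_ge0 ?(ltW z_gt0)// ltW// level_weight_gt0.
    by move=> is_; rewrite ltnS; exact: leq_bigmax_seq.
  rewrite sum_below_weighted.
  have := abel_bound N (ltW z_gt0) (ltW z_lt1) eD.
  have := ler_wpM2l G_ge0 (sum_geometric_le N).
  have := ler_wpM2l (ltW e_gt0) (sum_geometric_le N).
  move: (\sum_(_ < _) _) (\sum_(_ < _) _) => x y ? ?.
  by rewrite ler_norml => /andP[_]; lra.
move/(ler_wpM2l (ltW h_gt0)) => H; apply: le_trans H _.
rewrite mulrCA ler_wpM2l ?expR_ge0// mulrDr lerD2r mulrCA ler_wpM2l//.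
by rewrite addr_ge0// ltW.
Qed.

Lemma zeta_ge : expR (h * ln c1) * (G / ln rho
    - (e * ((1 + h * ln rho) / ln rho) + h * D)) <=
  h * nsum (fun i => g i * a i `^ (1 + h)).
Proof.
have z1 : 0 < (1 - z)^-1 by rewrite invr_gt0 subr_gt0.
pose A := expR (h * ln c1).
have key N : A * (G * (1 - z)^-1 - (e * (1 - z)^-1 + D)) - A * (G * (1 - z)^-1) * z ^+ N <=
    nsum (fun i => g i * a i `^ (1 + h)).
  apply: (@le_trans _ _ (\sum_(i <- below N) g i * a i `^ (1 + h))); last first.
    by apply: sum_le_nsum => //; [exact: zeta_bounded|exact: below_uniq].
  apply: (@le_trans _ _ (\sum_(i <- below N) A * (g i * (z ^+ lev i * a i)))); last first.
    by apply: ler_sum => i _; rewrite mulrCA ler_wpM2l// weight_powR_ge.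
  rewrite -mulr_sumr sum_below_weighted -mulrA -mulrBr ler_wpM2l ?expR_ge0//.
  have := abel_bound N (ltW z_gt0) (ltW z_lt1) eD.
  have := ler_wpM2l (ltW e_gt0) (sum_geometric_le N).
  rewrite sum_geometric ler_norml => H1 /andP[+ _].
  have -> : G * ((1 - z ^+ N) / (1 - z)) = G / (1 - z) - G / (1 - z) * z ^+ N by ring.
  lra.
(* The right-hand side of [key] is independent of [N], so the truncation error, a multiple of
   [z ^+ N], can be sent to 0. *)
have lim : A * (G * (1 - z)^-1 - (e * (1 - z)^-1 + D)) <= nsum (fun i => g i * a i `^ (1 + h)).
  have zN : (fun N => A * (G * (1 - z)^-1 - (e * (1 - z)^-1 + D)) - A * (G * (1 - z)^-1) * z ^+ N)
      @ \oo --> A * (G * (1 - z)^-1 - (e * (1 - z)^-1 + D)) - A * (G * (1 - z)^-1) * 0.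
    apply: cvgB; first exact: cvg_cst.
    by apply: cvgM; [exact: cvg_cst|apply: cvg_expr; rewrite ger0_norm ?ltW].
  rewrite -[leLHS]subr0 -[X in _ - X](mulr0 (A * (G * (1 - z)^-1))).
  by apply: (cvgr_to_le zN); exact: nearW.
move/(ler_wpM2l (ltW h_gt0)): lim; apply: le_trans.
rewrite [leRHS]mulrCA ler_wpM2l ?expR_ge0// mulrBr mulrDr lerB//.
  by rewrite mulrCA ler_wpM2l.
by rewrite lerD2r mulrCA ler_wpM2l ?(ltW e_gt0).
Qed.

End Zeta.

Lemma zeta_cvg (g : I -> R) (M G : R) : (forall i, 0 <= g i) -> (forall i, g i <= M) ->
  0 <= G -> asymp (fun Q => \sum_(q < Q) lsum g q) G ->
  (s - 1) * nsum (fun i => g i * a i `^ s) @[s --> 1^'+] --> G / ln rho.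
Proof.
move=> g0 gM G0 gG; have L0 : 0 < ln rho by rewrite ln_gt0.
apply/cvgrPdist_le => x x0.
(* In the limit e is divided by ln rho and contributes x / 2. The limits of [U] and [V] thus lie
   strictly within distance x of the target. *)
pose e := x * ln rho / 2; have e0 : 0 < e by rewrite divr_gt0// mulr_gt0.
have [D eD] := gG _ e0.
pose U s := expR ((s - 1) * ln c2) * ((G + e) * ((1 + (s - 1) * ln rho) / ln rho) + (s - 1) * D).
pose V s := expR ((s - 1) * ln c1) * (G / ln rho
    - (e * ((1 + (s - 1) * ln rho) / ln rho) + (s - 1) * D)).
have idc (c : R) : (s - 1) * c @[s --> 1^'+] --> (0 : R).
  rewrite -(mul0r c); apply: cvgM; last exact: cvg_cst.
  rewrite -(subrr 1); apply: cvgB; last exact: cvg_cst.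
  by apply: cvg_within.
have ec (c : R) : expR ((s - 1) * c) @[s --> 1^'+] --> (1 : R).
  have h : expR ((s - 1) * c) @[s --> 1^'+] --> (expR 0 : R).
    exact: (cvg_comp (fun s : R => (s - 1) * c) expR (idc c) (@continuous_expR R 0)).
  by rewrite expR0 in h.
have lc : (1 + (s - 1) * ln rho) / ln rho @[s --> 1^'+] --> (1 + 0) / ln rho.
  by apply: cvgM; [apply: cvgD; [exact: cvg_cst|exact: idc]|exact: cvg_cst].
have Uc : U s @[s --> 1^'+] --> 1 * ((G + e) * ((1 + 0) / ln rho) + 0).
  by apply: cvgM; [exact: ec|apply: cvgD; [apply: cvgM; [exact: cvg_cst|exact: lc]|exact: idc]].
have Vc : V s @[s --> 1^'+] --> 1 * (G / ln rho - (e * ((1 + 0) / ln rho) + 0)).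
  apply: cvgM; first exact: ec.
  apply: cvgB; first exact: cvg_cst.
  by apply: cvgD; [apply: cvgM; [exact: cvg_cst|exact: lc]|exact: idc].
have eL : e / ln rho = x / 2 by rewrite /e; field; rewrite gt_eqF.
have Ul : 1 * ((G + e) * ((1 + 0) / ln rho) + 0) < G / ln rho + x.
  by rewrite mul1r !addr0 div1r mulrDl eL; lra.
have Vl : G / ln rho - x < 1 * (G / ln rho - (e * ((1 + 0) / ln rho) + 0)).
  by rewrite mul1r !addr0 div1r eL; lra.
near=> s.
have s1 : 1 < s by near: s; exact: nbhs_right_gt.
have h0 : 0 < s - 1 by rewrite subr_gt0.
have hU : U s <= G / ln rho + x by near: s; exact: (cvgr_le _ Uc).
have hV : G / ln rho - x <= V s by near: s; exact: (cvgr_ge _ Vc).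

have := zeta_le g0 G0 h0 erefl eD e0; have := zeta_ge g0 gM G0 h0 erefl eD e0.
rewrite -/(U s) -/(V s) (addrC 1) subrK => H1 H2.
by rewrite ler_norml; apply/andP; split; lra.
Unshelve. all: by end_near. Qed.

Lemma level_weight_le i : a i <= c2.
Proof.
apply: le_trans (a_le i) _; rewrite ler_piMr ?(ltW c2_gt0)//.
by rewrite invf_le1 ?exprn_gt0// exprn_ege1// ltW.
Qed.

Lemma level_weight_vanishing (g : I -> R) (M : R) : (forall i, 0 <= g i) ->
  (forall i, g i <= M) -> vanishing (fun i => g i * a i).
Proof.
move=> g0 gM e e0.
have M0 : 0 <= M by have [i _] := levels_infinite [::]; exact: le_trans (g0 i) (gM i).
have lim : (fun n => M * c2 * rho^-1 ^+ n) @ \oo --> M * c2 * 0.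
  apply: cvgM; first exact: cvg_cst.
  by apply: cvg_expr; rewrite ger0_norm ?invr_ge0 ?(ltW rho_gt0)// invf_lt1.
rewrite mulr0 in lim; have [Q _ hQ] := cvgr_lt _ lim _ e0.
exists (below Q) => i; rewrite mem_below -leqNgt => Qi.
apply: le_lt_trans (hQ (lev i) Qi); rewrite -mulrA ler_pM ?(ltW (level_weight_gt0 i))//.
by rewrite exprVn.
Qed.

(** * Operators whose modulus is diagonal with coefficients g a *)

Section PositiveDiag.
Variables (g : I -> R) (M G : R) (T : ell2 R I -> ell2 R I).
Hypothesis g_ge0 : forall i, 0 <= g i.
Hypothesis g_le : forall i, g i <= M.
Hypothesis gG : asymp (fun Q => \sum_(q < Q) lsum g q) G.
Hypothesis absT : abs_op T = diag_op (fun i => (g i * a i)%:C).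

Lemma cbounded_level_weight : cbounded (fun i => (g i * a i)%:C).
Proof.
exists (M * c2) => i; rewrite normc_real ger0_norm.
  by rewrite ler_pM ?level_weight_le// ltW// level_weight_gt0.
by rewrite mulr_ge0// ltW// level_weight_gt0.
Qed.

Let ga_ge0 i : 0 <= g i * a i.
Proof. by rewrite mulr_ge0// ltW// level_weight_gt0. Qed.

Lemma singular_values_asymp e : 0 < e -> exists D : R, forall m,
  `|\sum_(j < m) singular_values T j - G / ln rho * ln m.+1%:R| <= e * ln m.+1%:R + D.
Proof.
move=> e0; have v := level_weight_vanishing g_ge0 g_le.
apply: (singular_sum_asymp g_ge0 g_le _ _ gG e0).
  move=> F n; exact: (sum_le_singular levels_infinite ga_ge0 v cbounded_level_weight absT).
move=> n; exact: (singular_le_sum levels_infinite ga_ge0 v cbounded_level_weight absT).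
Qed.

Lemma singular_values_cvg :
  (\sum_(j < n.+1) singular_values T j) / ln n.+2%:R @[n --> \oo] --> G / ln rho.
Proof.
apply/cvgrPdistC_le => e e0; have e2 : 0 < e / 2 by rewrite divr_gt0.
have [D hD] := singular_values_asymp e2; near=> n.
have n0 : (0 < n)%N by near: n; exists 1%N.
have ll : ln n%:R <= ln n.+2%:R :> R by rewrite ler_ln ?posrE ?ltr0n// ler_nat ltnW.
have l1 : 1 <= 1 * ln n%:R :> R by near: n; exact: ln_nat_large.
have lD : D <= e / 2 * ln n%:R by near: n; exact: ln_nat_large.
rewrite mul1r in l1; have l0 : 0 < ln n.+2%:R :> R by apply: lt_le_trans ll; apply: lt_le_trans l1.
have -> : (\sum_(j < n.+1) singular_values T j) / ln n.+2%:R - G / ln rho =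
    (\sum_(j < n.+1) singular_values T j - G / ln rho * ln n.+2%:R) / ln n.+2%:R.
  by rewrite mulrBl mulfK// gt_eqF.
rewrite normrM normfV (gtr0_norm l0) ler_pdivrMr//.
apply: le_trans (hD n.+1) _.
have := ler_wpM2l (ltW e2) ll; move: lD; lra.
Unshelve. all: by end_near. Qed.

Lemma dixmier_pos_level w : generalized_limit w ->
  dixmier_pos w T = (G / ln rho)%:C.
Proof. by move=> gw; apply: generalized_limit_cvg => //; exact: singular_values_cvg. Qed.

Lemma dixmier_macaev_level : compact_op T -> dixmier_macaev T.
Proof.
move=> cT; split => //.
have [D hD] := singular_values_asymp ltr01.
(* For n >= 2 one has n + 2 <= n^2, so ln (n + 2) <= 2 ln n, which gives the factor 2; the last 1
   absorbs [D], which is eventually at most ln n. The sum of the definition starts at index 1, and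
   dropping the term 0 only decreases it. *)
set B := (`|G / ln rho| + 1) * 2 + 1.
apply: (@le_lt_trans _ _ B%:E); last exact: ltry.
pose u n := (\sum_(1 <= j < n.+1) singular_values T j) / ln n%:R.
have uB : \forall n \near \oo, u n <= B.
  near=> n.
  have n2 : (2 <= n)%N by near: n; exists 2%N.
  have l1 : 1 <= 1 * ln n%:R :> R by near: n; exact: ln_nat_large.
  have lD : D <= 1 * ln n%:R by near: n; exact: ln_nat_large.
  rewrite mul1r in l1 lD; have l0 : 0 < ln n%:R :> R by apply: lt_le_trans l1.
  have ll : ln n.+2%:R <= 2 * ln n%:R :> R.
    have n0 : (0 < n)%N by apply: leq_trans n2.
    rewrite mulr_natl -lnXn ?ltr0n// ler_ln ?posrE ?exprn_gt0 ?ltr0n// -natrX ler_nat.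
    by rewrite expnS expn1 (leq_trans _ (leq_mul n2 (leqnn n)))// mul2n -addnn -addn2 leq_add2l.
  rewrite /u ler_pdivrMr//.
  have le1 : \sum_(1 <= j < n.+1) singular_values T j <= \sum_(j < n.+1) singular_values T j.
    rewrite -(big_mkord xpredT (singular_values T)) big_ltn// lerDr.
    exact: (singular_values_ge0 levels_infinite ga_ge0 (level_weight_vanishing g_ge0 g_le)
      cbounded_level_weight absT).
  apply: le_trans le1 _.
  have := hD n.+1; rewrite ler_norml => /andP[_]; rewrite mul1r.
  have := ler_norm (G / ln rho); have := normr_ge0 (G / ln rho).
  have l2 : 0 <= ln n.+2%:R :> R by rewrite ln_ge0// ler1n.
  rewrite /B; move: l2 ll l0 lD; move: (ln n.+2%:R) (ln n%:R) `|G / ln rho| (G / ln rho) => x y p q.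
  move=> x0 xy y0 Dy p0 qp; have h1 := ler_wpM2r x0 qp; have h2 := ler_wpM2l p0 xy; lra.
have [V Voo hV] : exists2 V, (\oo : set_system nat) V & forall n, V n -> u n <= B.
  by exists [set n | u n <= B].
apply: (@le_trans _ _ (ereal_sup [set (u x)%:E | x in V])).
  by apply: ereal_inf_lbound; exists V.
by apply: ub_ereal_sup => _ [n Vn <-]; rewrite lee_fin hV.
Unshelve. all: by end_near. Qed.

End PositiveDiag.

(** * Complex coefficients: the modulus controls the ideal, four nonnegative parts give the trace *)

Section ComplexDiag.
Local Notation C := R[i].
Local Notation nc := Normc.normc.
Variables (f : I -> C) (M G0 G1 G2 G3 G4 : R).
Hypothesis f_le : forall i, nc (f i) <= M.
Let f1 i := Num.max (complex.Re (f i)) 0.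
Let f2 i := Num.max (- complex.Re (f i)) 0.
Let f3 i := Num.max (complex.Im (f i)) 0.
Let f4 i := Num.max (- complex.Im (f i)) 0.
Hypothesis G0P : asymp (fun Q => \sum_(q < Q) lsum (fun i => nc (f i)) q) G0.
Hypothesis G1P : asymp (fun Q => \sum_(q < Q) lsum f1 q) G1.
Hypothesis G2P : asymp (fun Q => \sum_(q < Q) lsum f2 q) G2.
Hypothesis G3P : asymp (fun Q => \sum_(q < Q) lsum f3 q) G3.
Hypothesis G4P : asymp (fun Q => \sum_(q < Q) lsum f4 q) G4.

Let T := diag_op (fun i => f i * (a i)%:C) : ell2 R I -> ell2 R I.

Let pos0 (x : R) : 0 <= Num.max x 0. Proof. by rewrite le_max lexx orbT. Qed.
Let M_ge0 : 0 <= M.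
Proof. by have [i _] := levels_infinite [::]; exact: le_trans (normc_ge0 _) (f_le i). Qed.

Let max_le (x : R) : `|x| <= M -> Num.max x 0 <= M.
Proof. by move=> xM; rewrite ge_max M_ge0 andbT (le_trans (ler_norm _)). Qed.

Let Re_le i : `|complex.Re (f i)| <= M. Proof. exact: le_trans (abs_Re_le _) _. Qed.
Let Im_le i : `|complex.Im (f i)| <= M. Proof. exact: le_trans (abs_Im_le _) _. Qed.
Let f1_le i : f1 i <= M. Proof. exact: max_le. Qed.
Let f2_le i : f2 i <= M. Proof. by apply: max_le; rewrite normrN. Qed.
Let f3_le i : f3 i <= M. Proof. exact: max_le. Qed.
Let f4_le i : f4 i <= M. Proof. by apply: max_le; rewrite normrN. Qed.

Let f1_ge0 i : 0 <= f1 i. Proof. exact: pos0. Qed.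
Let f2_ge0 i : 0 <= f2 i. Proof. exact: pos0. Qed.
Let f3_ge0 i : 0 <= f3 i. Proof. exact: pos0. Qed.
Let f4_ge0 i : 0 <= f4 i. Proof. exact: pos0. Qed.

Let a_ge0 i : 0 <= a i. Proof. exact/ltW/level_weight_gt0. Qed.

Let bT : cbounded (fun i => f i * (a i)%:C).
Proof.
exists (M * c2) => i; rewrite Normc.normcM normc_real ger0_norm//.
by rewrite ler_pM ?normc_ge0// level_weight_le.
Qed.

Let ncT i : nc (f i * (a i)%:C) = nc (f i) * a i.
Proof. by rewrite Normc.normcM normc_real ger0_norm. Qed.

Let ReT i : complex.Re (f i * (a i)%:C) = complex.Re (f i) * a i.
Proof. by case: (f i) => x y /=; ring. Qed.

Let ImT i : complex.Im (f i * (a i)%:C) = complex.Im (f i) * a i.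
Proof. by case: (f i) => x y /=; ring. Qed.

Let maxM (x y : R) : 0 <= y -> Num.max (x * y) 0 = Num.max x 0 * y.
Proof. by move=> y0; rewrite maxr_pMl// mul0r. Qed.

Let abs_level (g : I -> R) : (forall i, 0 <= g i) -> (forall i, g i <= M) ->
  abs_op (diag_op (fun i => (g i * a i)%:C) : ell2 R I -> _) =
  diag_op (fun i => (g i * a i)%:C).
Proof.
move=> g0 gM; rewrite abs_diag; last exact: cbounded_level_weight g0 gM.
by congr diag_op; apply/funext => i; rewrite normc_real ger0_norm// mulr_ge0.
Qed.

Lemma dixmier_trace_level w : generalized_limit w ->
  dixmier_trace w T = ((G1 - G2) / ln rho) +i* ((G3 - G4) / ln rho).
Proof.
move=> gw; rewrite /dixmier_trace re_op_diag// im_op_diag//.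
have bR : cbounded (fun i => (complex.Re (f i) * a i)%:C).
  by have [K hK] := bT; exists K => i; rewrite normc_real -ReT (le_trans (abs_Re_le _)).
have bI : cbounded (fun i => (complex.Im (f i) * a i)%:C).
  by have [K hK] := bT; exists K => i; rewrite normc_real -ImT (le_trans (abs_Im_le _)).
rewrite (_ : (fun i => (complex.Re _)%:C) = fun i => (complex.Re (f i) * a i)%:C); last first.
  by apply/funext => i; rewrite ReT.
rewrite (_ : (fun i => (complex.Im _)%:C) = fun i => (complex.Im (f i) * a i)%:C); last first.
  by apply/funext => i; rewrite ImT.
rewrite !pos_part_diag// !neg_part_diag//.
rewrite (_ : (fun i => (Num.max (complex.Re (f i) * a i) 0)%:C) = fun i => (f1 i * a i)%:C); last first.
  by apply/funext => i; rewrite maxM.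
rewrite (_ : (fun i => (Num.max (- (complex.Re (f i) * a i)) 0)%:C) = fun i => (f2 i * a i)%:C); last first.
  by apply/funext => i; rewrite -mulNr maxM.
rewrite (_ : (fun i => (Num.max (complex.Im (f i) * a i) 0)%:C) = fun i => (f3 i * a i)%:C); last first.
  by apply/funext => i; rewrite maxM.
rewrite (_ : (fun i => (Num.max (- (complex.Im (f i) * a i)) 0)%:C) = fun i => (f4 i * a i)%:C); last first.
  by apply/funext => i; rewrite -mulNr maxM.
rewrite (dixmier_pos_level (g := f1) f1_ge0 f1_le G1P)//; last exact: abs_level.
rewrite (dixmier_pos_level (g := f2) f2_ge0 f2_le G2P)//; last exact: abs_level.
rewrite (dixmier_pos_level (g := f3) f3_ge0 f3_le G3P)//; last exact: abs_level.
rewrite (dixmier_pos_level (g := f4) f4_ge0 f4_le G4P)//; last exact: abs_level.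
by apply/eqP; rewrite eq_complex/= !mulrBl; apply/andP; split; apply/eqP; ring.
Qed.

Lemma compact_level : compact_op T.
Proof.
apply: compact_diag => // e e0.
have [s hs] := level_weight_vanishing (fun i => normc_ge0 (f i)) f_le e0.
by exists s => i /hs; rewrite ncT => /ltW.
Qed.

Lemma connes_measurable_level : connes_measurable T.
Proof.
split; last by eexists => w gw _; exact: dixmier_trace_level.
apply: (dixmier_macaev_level (g := fun i => nc (f i)) _ f_le G0P).
- by move=> i; exact: normc_ge0.
- by rewrite abs_diag//; congr diag_op; apply/funext => i; rewrite ncT.
exact: compact_level.
Qed.

(** Evaluating the chosen common value at one existing generalized limit pins it down. *)
Lemma connes_trace_level :
  connes_trace T = ((G1 - G2) / ln rho) +i* ((G3 - G4) / ln rho).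
Proof.
rewrite /connes_trace; have [w [gw dw]] := exists_generalized_limit R.
case: xgetP => [c _ hc|]; first by rewrite -(hc w gw dw) dixmier_trace_level.
move=> /(_ (((G1 - G2) / ln rho) +i* ((G3 - G4) / ln rho)))[] w' gw' _.
exact: dixmier_trace_level.
Qed.

Let apow s (i : I) : R := a i `^ s.
Let Ts s := diag_op (fun i => f i * (apow s i)%:C) : ell2 R I -> ell2 R I.

Let apow_ge0 s i : 0 <= apow s i. Proof. exact: powR_ge0. Qed.

Let bounded_apow s (g : I -> R) : 1 < s -> (forall i, 0 <= g i) -> (forall i, g i <= M) ->
  bounded_sums (fun i => g i * apow s i).
Proof.
move=> s1 g0 gM.
have := @zeta_bounded g M g0 gM (s - 1) _ _ erefl.
by rewrite addrCA subrr addr0 subr_gt0; apply.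
Qed.

Lemma cbounded_apow s : 1 < s -> cbounded (fun i => f i * (apow s i)%:C).
Proof.
move=> s1; exists (nsum (fun i => nc (f i) * apow s i)) => i.
rewrite Normc.normcM normc_real ger0_norm//.
have := @sum_le_nsum _ _ (fun i => nc (f i) * apow s i) [:: i].
rewrite big_seq1; apply => // [j|]; first by rewrite mulr_ge0// normc_ge0.
by apply: bounded_apow => // j; exact: normc_ge0.
Qed.

Lemma trace_class_level s : 1 < s -> trace_class (Ts s).
Proof.
move=> s1; have bs := cbounded_apow s1; rewrite /trace_class abs_diag//.
rewrite (_ : (fun i => _) = fun i => (nc (f i) * apow s i)%:E).
  apply/bounded_sumsP => [i|]; first by rewrite mulr_ge0// normc_ge0.
  by apply: bounded_apow => // j; exact: normc_ge0.
apply/funext => i; rewrite inner_diag_basis; last exact: cbounded_norm.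
by rewrite Normc.normcM normc_real ger0_norm.
Qed.

Lemma op_trace_level s : 1 < s -> op_trace (Ts s) =
  (nsum (fun i => f1 i * apow s i) - nsum (fun i => f2 i * apow s i)) +i*
  (nsum (fun i => f3 i * apow s i) - nsum (fun i => f4 i * apow s i)).
Proof.
move=> s1; have bs := cbounded_apow s1; rewrite /op_trace.
rewrite (_ : (fun i => inner _ _) = fun i => f i * (apow s i)%:C); last first.
  by apply/funext => i; rewrite inner_diag_basis.
have pm (x y : R) : x * y = Num.max x 0 * y - Num.max (- x) 0 * y.
  by rewrite -mulrBl; congr (_ * _); rewrite /Num.max; do 2 (case: ltP => ?); lra.
rewrite /csum; congr (_ +i* _).
- apply: rsum_diff => [i|i|||i]; try by rewrite mulr_ge0// pos0.
  + by apply: bounded_apow => // i; exact: pos0.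
  + by apply: bounded_apow => // i; exact: pos0.
  by rewrite -pm; case: (f i) => x y /=; ring.
apply: rsum_diff => [i|i|||i]; try by rewrite mulr_ge0// pos0.
+ by apply: bounded_apow => // i; exact: pos0.
+ by apply: bounded_apow => // i; exact: pos0.
by rewrite -pm; case: (f i) => x y /=; ring.
Qed.

Hypothesis G1_ge0 : 0 <= G1.
Hypothesis G2_ge0 : 0 <= G2.
Hypothesis G3_ge0 : 0 <= G3.
Hypothesis G4_ge0 : 0 <= G4.

Lemma op_trace_cvg : ((s - 1)%:C * op_trace (Ts s) : C^o) @[s --> 1^'+] -->
  (((G1 - G2) / ln rho) +i* ((G3 - G4) / ln rho) : C^o).
Proof.
pose Z (g : I -> R) s := (s - 1) * nsum (fun i => g i * apow s i).
have c (g : I -> R) G : (forall i, 0 <= g i) -> (forall i, g i <= M) -> 0 <= G ->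
    asymp (fun Q => \sum_(q < Q) lsum g q) G -> Z g s @[s --> 1^'+] --> G / ln rho.
  by move=> g0 gM Gp gG; exact: (zeta_cvg g0 gM Gp gG).
have c12 : (fun s => Z f1 s - Z f2 s) @ 1^'+ --> G1 / ln rho - G2 / ln rho.
  by apply: cvgB; exact: c.
have c34 : (fun s => Z f3 s - Z f4 s) @ 1^'+ --> G3 / ln rho - G4 / ln rho.
  by apply: cvgB; exact: c.
have lim := complex_cvg _ c12 c34.
have {}lim := lim (@at_right_proper_filter R 1).
rewrite -!mulrBl in lim; apply: cvg_trans lim; apply: near_eq_cvg; near=> s.
have s1 : 1 < s by near: s; exact: nbhs_right_gt.
rewrite op_trace_level// /Z /=; apply/eqP; rewrite eq_complex/=.
by apply/andP; split; apply/eqP; ring.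
Unshelve. all: by end_near. Qed.

End ComplexDiag.
End Levels.

(** * The mean ergodic theorem for positive matrices *)

Section MeanErgodic.
Variables (R : realType) (n : nat) (N : 'M[R]_n).
Let act q (u : 'rV[R]_n) := iter q (fun u => u *m N) u.
Hypothesis power_bounded : forall u : 'rV[R]_n, exists C : R, forall q i, `|act q u 0 i| <= C.

Let D := 1%:M - N.

Let sum_coboundary (v : 'rV[R]_n) Q : \sum_(q < Q) act q (v *m D) = v - act Q v.
Proof.
have actB q (a b : 'rV[R]_n) : act q (a - b) = act q a - act q b.
  by elim: q => //= q IH; rewrite /act/= -/(act q _) IH mulmxBl.
elim: Q => [|Q IH]; first by rewrite big_ord0 subrr.
rewrite big_ord_recr/= IH mulmxBr mulmx1 actB.
have -> : act Q (v *m N) = act Q.+1 v by rewrite /act iterSr.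
by rewrite addrA addrNK.
Qed.

Let act_fix (z : 'rV[R]_n) q : z *m D = 0 -> act q z = z.
Proof.
rewrite /D mulmxBr mulmx1 => /eqP; rewrite subr_eq0 => /eqP zN.
by elim: q => //= q IH; rewrite /act/= -/(act q z) IH -zN.
Qed.

Let bounded_mul0 (x C : R) : (forall Q : nat, `|Q%:R * x| <= C) -> x = 0.
Proof.
move=> h; apply/eqP; rewrite -normr_eq0; apply/negPn/negP => x0.
have xp : 0 < `|x| by rewrite lt_neqAle eq_sym x0 normr_ge0.
have := h (Num.bound (C / `|x|)); rewrite normrM normr_nat -ler_pdivlMr//.
by rewrite leNgt; have := archi_boundP (_ : 0 <= C / `|x|); move=> ->//;
  rewrite divr_ge0// (le_trans _ (h 0))//.
Qed.

(** If z is fixed and z = v D, then Q z is the telescoping sum v - v N^Q, which stays bounded in Q;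
    hence z = 0. *)
Let ker_disjoint : (kermx D :&: D = 0)%MS.
Proof.
apply/eqP/rowV0P => z; rewrite sub_capmx => /andP[/sub_kermxP zD /submxP[v vD]].
apply/rowP => i; rewrite mxE; have [C hC] := power_bounded v.
apply: (@bounded_mul0 _ (C + C)) => Q.
have := sum_coboundary v Q; rewrite -vD.
under eq_bigr do rewrite act_fix//.
rewrite sumr_const card_ord => /(congr1 (fun u : 'rV[R]_n => u 0 i)).
rewrite mulmxnE mulr_natl => ->; rewrite !mxE.
apply: le_trans (ler_normB _ _) _; apply: lerD; last exact: hC.
by have := hC 0 i.
Qed.

(** By rank-nullity, trivial intersection already makes the kernel and the image of [D] span the
    space. *)
Let decomposition (u : 'rV[R]_n) : exists z v, z *m D = 0 /\ u = z + v *m D.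
Proof.
have full : row_full (kermx D + D)%MS.
  by rewrite /row_full mxrank_disjoint_sum// mxrank_ker subnK// rank_leq_row.
have /sub_addsmxP[[a b] /= ->] : (u <= kermx D + D)%MS by exact: submx_full.
exists (a *m kermx D), b; split => //.
by rewrite -mulmxA mulmx_ker mulmx0.
Qed.

(** The fixed component contributes exactly Q z and the coboundary telescopes, so the error is
    bounded, not merely o(Q). *)
Lemma mean_ergodic_mx (u : 'rV[R]_n) : exists (z : 'rV[R]_n) (C : R),
  forall Q i, `|\sum_(q < Q) act q u 0 i - Q%:R * z 0 i| <= C.
Proof.
have [z [v [zD ->]]] := decomposition u.
have [C hC] := power_bounded v; exists z, (C + C) => Q i.
have actD q (a b : 'rV[R]_n) : act q (a + b) = act q a + act q b.
  by elim: q => //= q IH; rewrite /act/= -/(act q _) IH mulmxDl.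
have -> : \sum_(q < Q) act q (z + v *m D) 0 i =
    Q%:R * z 0 i + (v - act Q v) 0 i.
  rewrite -sum_coboundary summxE -[in Q%:R](card_ord Q) mulr_natl -sumr_const -big_split/=.
  by apply: eq_bigr => q _; rewrite actD act_fix// mxE.
rewrite addrAC subrr add0r !mxE.
apply: le_trans (ler_normB _ _) _; apply: lerD; last exact: hC.
by have := hC 0 i.
Qed.

End MeanErgodic.

Lemma seq_lbound (R : realType) (T : eqType) (s : seq T) (f : T -> R) :
  (forall i, 0 < f i) -> exists2 c, 0 < c & forall i, i \in s -> c <= f i.
Proof.
move=> f0; elim: s => [|x s [c c0 hc]]; first by exists 1.
exists (Num.min (f x) c); first by rewrite lt_min f0.
move=> i; rewrite inE => /predU1P[->|/hc]; rewrite ge_min ?lexx// => ->.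
by rewrite orbT.
Qed.

Lemma seq_ubound (R : realType) (T : eqType) (s : seq T) (f : T -> R) :
  exists2 c, 0 < c & forall i, i \in s -> f i <= c.
Proof.
elim: s => [|x s [c c0 hc]]; first by exists 1.
exists (Num.max (f x) c); first by rewrite lt_max c0 orbT.
move=> i; rewrite inE => /predU1P[->|/hc]; rewrite le_max ?lexx// => ->.
by rewrite orbT.
Qed.

(** * The ergodic theorem for positive operators with a positive fixed function *)

Section MeanErgodicFun.
Variables (R : realType) (V : eqType) (vs : seq V).
Hypothesis vs_uniq : uniq vs.
Hypothesis mem_vs : forall v, v \in vs.
Variable B : (V -> R) -> (V -> R).
Hypothesis B_linear : forall c h g, B (fun v => c * h v + g v) = fun v => c * B h v + B g v.
Hypothesis B_ge0 : forall h, (forall v, 0 <= h v) -> forall v, 0 <= B h v.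
Variable x : V -> R.
Hypothesis x_gt0 : forall v, 0 < x v.
Hypothesis B_fix : B x = x.

Lemma iter_fix q : iter q B x = x. Proof. by elim: q => //= q ->. Qed.

Lemma iter_linear q c h g :
  iter q B (fun v => c * h v + g v) = fun v => c * iter q B h v + iter q B g v.
Proof. by elim: q => //= q ->. Qed.

Lemma iter_ge0 q h : (forall v, 0 <= h v) -> forall v, 0 <= iter q B h v.
Proof. by move=> h0; elim: q => //= q IH; exact: B_ge0. Qed.

Lemma iter_0 q : iter q B (fun=> 0) = fun=> 0.
Proof.
have := iter_linear q 1 (fun=> 0) (fun=> 0); rewrite (_ : (fun v => _ + _) = fun=> 0).
  by move=> E; apply/funext => v; have := congr1 (fun f => f v) E; rewrite /=; lra.
by apply/funext => v; rewrite mulr0 addr0.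
Qed.

Lemma iter_scale q c h : iter q B (fun v => c * h v) = fun v => c * iter q B h v.
Proof.
have := iter_linear q c h (fun=> 0); rewrite iter_0.
rewrite (_ : (fun v => _ + 0) = fun v => c * h v); last by apply/funext => v; rewrite addr0.
by move=> ->; apply/funext => v; rewrite addr0.
Qed.

(** Positivity preserves the comparison with multiples of the fixed function [x]. Since [x] is
    positive on a finite set, every [h] is caught between two such multiples, and the powers of [B]
    are bounded. *)
Lemma iter_le q (c : R) h : (forall v, h v <= c * x v) -> forall v, iter q B h v <= c * x v.
Proof.
move=> hc v; have H : forall v, 0 <= -1 * h v + c * x v by move=> v'; have := hc v'; lra.
have := iter_ge0 q H v; rewrite iter_linear iter_scale iter_fix; lra.
Qed.

Lemma iter_ge q (c : R) h : (forall v, c * x v <= h v) -> forall v, c * x v <= iter q B h v.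
Proof.
move=> hc v; have H : forall v, 0 <= - c * x v + h v by move=> v'; have := hc v'; lra.
have := iter_ge0 q H v; rewrite iter_linear iter_fix; lra.
Qed.

Lemma B_sum (I : Type) (s : seq I) (c : I -> R) (h : I -> V -> R) v :
  B (fun v => \sum_(i <- s) c i * h i v) v = \sum_(i <- s) c i * B (h i) v.
Proof.
have B0 : B (fun=> 0) = fun=> 0 := iter_0 1.
elim: s v => [|i s IH] v.
  rewrite big_nil (_ : (fun v => _) = fun=> 0) ?B0//.
  by apply/funext => v'; rewrite big_nil.
rewrite big_cons -IH (_ : (fun v => _) = fun v => c i * h i v + \sum_(j <- s) c j * h j v).
  by rewrite B_linear.
by apply/funext => v'; rewrite big_cons.
Qed.

Lemma mean_ergodic h : exists (z : V -> R) (C : R), forall Q v,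
  `|\sum_(q < Q) iter q B h v - z v * Q%:R| <= C.
Proof.
pose n := size vs; pose e (i : 'I_n) := tnth (in_tuple vs) i.
have ilt v : (index v vs < n)%N by rewrite index_mem mem_vs.
pose idx v := Ordinal (ilt v).
have eK v : e (idx v) = v by rewrite /e (tnth_nth v)/= nth_index// mem_vs.
have idxK i : idx (e i) = i.
  by apply/val_inj; rewrite /= /e (tnth_nth (e i)) index_uniq.
pose row (g : V -> R) : 'rV[R]_n := \row_i g (e i).
pose fn (u : 'rV[R]_n) : V -> R := fun v => u 0 (idx v).
have rowK g : fn (row g) = g by apply/funext => v; rewrite /fn mxE eK.
have fnK u : row (fn u) = u by apply/rowP => i; rewrite mxE /fn idxK.
(* Row vectors act from the left, so row i holds the image of the indicator function of [e i]. *)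
pose N : 'M[R]_n := \matrix_(i, j) B (fun v => (v == e i)%:R) (e j).
have rowB g : row g *m N = row (B g).
  apply/rowP => j; rewrite !mxE.
  have {2}-> : g = fun v => \sum_(i <- enum 'I_n) g (e i) * (v == e i)%:R.
    apply/funext => v; rewrite big_enum/= (bigD1 (idx v))//= eK eqxx mulr1 big1 ?addr0// => i.
    have [->|] := eqVneq v (e i); last by rewrite mulr0.
    by rewrite idxK eqxx.
  by rewrite B_sum big_enum/=; apply: eq_bigr => i _; rewrite !mxE.
have rowBq q g : iter q (fun u => u *m N) (row g) = row (iter q B g).
  by elim: q => //= q ->; rewrite rowB.
have bounded (u : 'rV[R]_n) : exists C : R, forall q i, `|iter q (fun u => u *m N) u 0 i| <= C.
  have [c1 _ h1] := seq_ubound vs (fun v => `|fn u v| / x v).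
  have [c2 _ h2] := seq_ubound vs x.
  exists (c1 * c2) => q i; rewrite -[u]fnK rowBq mxE.
  have c1p : 0 <= c1 by apply: le_trans (h1 _ (mem_vs (e i))); rewrite divr_ge0// ltW.
  have ub v : `|fn u v| <= c1 * x v by rewrite -ler_pdivrMr// h1.
  apply: (@le_trans _ _ (c1 * x (e i))); last by rewrite ler_wpM2l// h2.
  rewrite ler_norml -mulNr iter_ge ?iter_le// => v; have := ub v; rewrite ler_norml.
    by move=> /andP[].
  by rewrite mulNr => /andP[].
have [z [C hC]] := mean_ergodic_mx bounded (row h).
exists (fn z), C => Q v; rewrite mulrC; have := hC Q (idx v).
by under eq_bigr do rewrite rowBq mxE eK.
Qed.

End MeanErgodicFun.

(** * Finite paths of the Bratteli diagram *)

Section Paths.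
Variables (R : realType) (k : nat) (L : kgraph k.+1).
Hypothesis L_finite : kgraph_finite L.
Local Notation V := (kobj L).
Local Notation K := k.+1.
Local Notation rho_ := (spectral_radius L R).
Local Notation edge := (V * V * nat)%type.
Implicit Types (h : V -> R) (v w : V).

Lemma finite_vertices : finite_set [set: V].
Proof.
have := finite_image (@krng _ L) (L_finite 0); apply: sub_finite_set => v _ /=.
by exists (idm v); [exact: deg_idm|exact: rng_idm].
Qed.

Definition vseq : seq V := fset_set [set: V].

Lemma vseq_uniq : uniq vseq. Proof. exact: fset_uniq. Qed.

Lemma mem_vseq v : v \in vseq.
Proof. by rewrite in_fset_set ?in_setT//; exact: finite_vertices. Qed.

Lemma sum_vertices h : \sum_(v \in [set: V]) h v = \sum_(v <- vseq) h v.
Proof. by rewrite fsbig_finite//; exact: finite_vertices. Qed.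

(** One spectral radius for each level crossed by a path of length [n]. Its value at [K] is the rho
    of the overview. *)
Definition prodrho n : R := \prod_(i < K) rho_ i ^+ (n %/ K + (i < n %% K)%N).

Lemma prodrho0 : prodrho 0 = 1.
Proof. by rewrite /prodrho big1// => i _; rewrite div0n mod0n ltn0 expr0. Qed.

Lemma prodrhoS n : prodrho n.+1 = prodrho n * rho_ (inZp n).
Proof.
have -> : rho_ (inZp n) = \prod_(i < K) rho_ i ^+ (i == inZp n :> 'I_K)%N.
  rewrite (bigD1 (inZp n))//= eqxx expr1 big1 ?mulr1// => i /negPf ->.
  by rewrite expr0.
rewrite /prodrho -big_split/=; apply: eq_bigr => i _; rewrite -exprD; congr (_ ^+ _).
rewrite divnS// modnS -val_eqE/=.
have := ltn_ord i; have := ltn_pmod n (ltn0Sn k).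
case: (boolP (K %| n.+1)%N) => [/dvdnP[q nq]|_] nK iK.
  have -> : (n %% K = k)%N.
    case: q nq => // q; rewrite mulSn addSn => -[->].
    by rewrite addnC modnMDl modn_small.
  by rewrite ltn0 addn0 addnC -addnA; congr addn; rewrite ltn_neqAle -ltnS iK andbT; case: eqP.
by rewrite add0n -addnA; congr addn; rewrite ltnS leq_eqVlt; case: ltngtP.
Qed.

Lemma prodrhoMD q n : prodrho (q * K + n) = prodrho K ^+ q * prodrho n.
Proof.
rewrite /prodrho -prodrXl -big_split/=; apply: eq_bigr => i _.
by rewrite divnn modnn ltn0 addn0 expr1 -exprD divnMDl// modnMDl addnA.
Qed.

Definition adjop (i : 'I_K) h v : R := \sum_(w <- vseq) (adj i v w)%:R * h w.

(** The product of the [n] consecutive adjacency matrices from level [m] on, applied to [h]; it sums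
    [h] over the sources of the paths starting there ([sum_fpaths]). *)
Fixpoint adjiter n m h : V -> R :=
  if n is n'.+1 then adjop (inZp m) (adjiter n' m.+1 h) else h.

Lemma adjop_linear i c h g :
  adjop i (fun v => c * h v + g v) = fun v => c * adjop i h v + adjop i g v.
Proof.
apply/funext => v; rewrite /adjop mulr_sumr -big_split/=.
by apply: eq_bigr => w _; ring.
Qed.

Lemma adjop_scale i c h : adjop i (fun v => c * h v) = fun v => c * adjop i h v.
Proof.
apply/funext => v; rewrite /adjop mulr_sumr; apply: eq_bigr => w _; ring.
Qed.

Lemma adjiter_scale n m c h : adjiter n m (fun v => c * h v) = fun v => c * adjiter n m h v.
Proof. by elim: n m => //= n IH m; rewrite IH adjop_scale. Qed.

Lemma adjiter_linear n m c h g :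
  adjiter n m (fun v => c * h v + g v) = fun v => c * adjiter n m h v + adjiter n m g v.
Proof. by elim: n m => //= n IH m; rewrite IH adjop_linear. Qed.

Lemma adjiter_ge0 n m h : (forall v, 0 <= h v) -> forall v, 0 <= adjiter n m h v.
Proof.
move=> h0; elim: n m => //= n IH m v.
by apply: sumr_ge0 => w _; rewrite mulr_ge0.
Qed.

Lemma adjiterD n1 n2 m h : adjiter (n1 + n2) m h = adjiter n1 m (adjiter n2 (m + n1) h).
Proof. by elim: n1 m => [|n1 IH] m; rewrite ?addn0//= IH addSnnS. Qed.

Lemma adjiter_shift n m j h : adjiter n (j * K + m) h = adjiter n m h.
Proof.
elim: n m => //= n IH m; rewrite -addnS IH; congr (adjop _ _).
by apply/val_inj; rewrite /= modnMDl.
Qed.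

Fixpoint fpaths n m v : seq (seq edge) :=
  if n is n'.+1 then
    [seq e :: s | e <- [seq (v, w, j) | w <- vseq, j <- iota 0 (adj (inZp m : 'I_K) v w)],
                  s <- fpaths n' m.+1 e.1.2]
  else [:: [::]].

Lemma mem_fpaths n m v s : (s \in fpaths n m v) = fpath_from m v s && (size s == n).
Proof.
elim: n m v s => [|n IH] m v s /=; first by case: s => [|e s]; rewrite ?andbF.
apply/allpairsPdep/idP => [[e [s' [+ + ->]]]|].
  move=> /allpairsPdep[w [j [_ + ->]]]; rewrite mem_iota add0n /= => jlt.
  by rewrite IH /erng /esrc /is_edge/= eqxx eqSS jlt.
case: s => [|[[v' w] j] s]; first by rewrite andbF.
rewrite /= eqSS /erng /esrc /is_edge/= => /andP[/and3P[/eqP -> jlt fp] sz].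
exists (v, w, j), s; split => //; last by rewrite IH fp.
by apply/allpairsPdep; exists w, j; split => //; [exact: mem_vseq|rewrite mem_iota].
Qed.

Lemma fpaths_uniq n m v : uniq (fpaths n m v).
Proof.
elim: n m v => //= n IH m v; apply: allpairs_uniq_dep => //.
- apply: allpairs_uniq_dep => [|w _|]; [exact: vseq_uniq|exact: iota_uniq|].
  by move=> [w j] [w' j'] _ _ /= [-> ->].
by move=> [e s] [e' s'] _ _ /= [-> ->].
Qed.

Lemma sum_fpaths n m v h :
  \sum_(s <- fpaths n m v) h (last v (map (@esrc _ L) s)) = adjiter n m h v.
Proof.
elim: n m v => [|n IH] m v /=; first by rewrite big_seq1.
rewrite big_allpairs_dep big_allpairs_dep/=; apply: eq_bigr => w _.
rewrite (eq_bigr (fun=> adjiter n m.+1 h w)); last by move=> j _; rewrite -IH.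
by rewrite big_const_seq count_predT size_iota iter_addr_0 mulr_natl.
Qed.

Lemma sum_fpaths_cat n1 n2 m v (F : seq edge -> R) :
  \sum_(s <- fpaths (n1 + n2) m v) F s =
  \sum_(s1 <- fpaths n1 m v)
    \sum_(s2 <- fpaths n2 (m + n1) (last v (map (@esrc _ L) s1))) F (s1 ++ s2).
Proof.
elim: n1 m v F => [|n1 IH] m v F; first by rewrite big_seq1 addn0.
rewrite /= !big_allpairs_dep; apply: eq_bigr => w _; apply: eq_bigr => j _.
by rewrite (IH _ _ (fun s => F ((v, w, j) :: s))); apply: eq_bigr => s _; rewrite addSnnS.
Qed.

Definition paths_of_length n : seq (fin_path L) :=
  pmap insub [seq (v, s) | v <- vseq, s <- fpaths n 0 v].

Lemma mem_paths_of_length n l : (l \in paths_of_length n) = (flen l == n).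
Proof.
rewrite mem_pmap_sub; apply/allpairsPdep/eqP => [[v [s [_ + ls]]]|ln].
  by rewrite mem_fpaths /flen /fedges ls => /andP[_ /eqP].
exists (frng l), (fedges l); rewrite mem_vseq mem_fpaths -ln eqxx andbT.
by split => //; [exact: (fpath_valP l)|exact: surjective_pairing].
Qed.

Lemma paths_of_length_uniq n : uniq (paths_of_length n).
Proof.
apply: pmap_sub_uniq; apply: allpairs_uniq_dep => [|v _|].
- exact: vseq_uniq.
- exact: fpaths_uniq.
by move=> [v s] [v' s'] _ _ /= [-> ->].
Qed.

Lemma sum_paths_of_length n (F : V * seq edge -> R) :
  \sum_(l <- paths_of_length n) F (fpath_val l) =
  \sum_(v <- vseq) \sum_(s <- fpaths n 0 v) F (v, s).
Proof.
rewrite -big_allpairs_dep -(big_map (@fpath_val _ L) xpredT F).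
congr (\sum_(i <- _) _); rewrite /paths_of_length (pmap_filter (insubK _)).
apply/all_filterP/allP => _ /allpairsPdep[v [s [_ + ->]]].
by rewrite mem_fpaths isSome_insub => /andP[].
Qed.

Definition path_prefix (l0 l : fin_path L) : bool :=
  (frng l == frng l0) && (take (flen l0) (fedges l) == fedges l0).

(** A length divisible by [K] lets the extensions of [l0] start with the first colour, so their
    count depends on [l0] only through its source. *)
Lemma sum_path_prefix (l0 : fin_path L) j n h : flen l0 = (j * K)%N ->
  \sum_(l <- paths_of_length (j * K + n) | path_prefix l0 l) h (fsrc l) =
  adjiter n 0 h (fsrc l0).
Proof.
move=> l0j; rewrite big_mkcond/=.
pose F (p : V * seq edge) := if (p.1 == frng l0) && (take (flen l0) p.2 == fedges l0)
  then h (last p.1 (map (@esrc _ L) p.2)) else 0.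
rewrite (sum_paths_of_length _ F) (bigD1_seq (frng l0)) ?mem_vseq ?vseq_uniq//=.
rewrite [X in _ + X]big1 ?addr0; last first.
  by move=> v /negPf vl0; rewrite big1// => s _; rewrite /F/= vl0.
rewrite (sum_fpaths_cat _ _ _ _ (fun s => F (frng l0, s))).
have el0 : fedges l0 \in fpaths (j * K) 0 (frng l0).
  by rewrite mem_fpaths -l0j eqxx andbT; exact: (fpath_valP l0).
rewrite (bigD1_seq (fedges l0)) ?fpaths_uniq//=.
rewrite [X in _ + X]big1_seq ?addr0; last first.
  move=> s /andP[/negPf sl0]; rewrite mem_fpaths => /andP[_ /eqP sj].
  rewrite big1// => s2 _; rewrite /F/= eqxx/= l0j -sj take_size_cat//.
  by rewrite sl0.
rewrite -/(fsrc l0) -[adjiter n 0 h]/(adjiter n 0 h) -(adjiter_shift n 0 j h) addn0 -sum_fpaths.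
apply: eq_bigr => s _; rewrite /F/= eqxx take_size_cat// eqxx/=.
by rewrite map_cat last_cat.
Qed.

Variables (xL : V -> R) (delta : R).
Hypothesis xL_PF : perron_frobenius_vector xL.
Hypothesis rho_gt0 : forall i, 0 < rho_ i.

Let xL_gt0 v : 0 < xL v. Proof. by have [] := xL_PF. Qed.

Lemma adjop_xL i : adjop i xL = fun v => rho_ i * xL v.
Proof.
have [_ _ h] := xL_PF; apply/funext => v.
by rewrite -h sum_vertices.
Qed.

Lemma prodrho_gt0 n : 0 < prodrho n.
Proof. by apply: prodr_gt0 => i _; rewrite exprn_gt0. Qed.

Lemma adjiter_xL n m v : prodrho m * adjiter n m xL v = prodrho (m + n) * xL v.
Proof.
elim: n m v => [|n IH] m v; first by rewrite addn0.
have E : adjiter n m.+1 xL = fun v => (prodrho m.+1)^-1 * prodrho (m.+1 + n) * xL v.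
  apply/funext => w; rewrite -mulrA -IH mulKf// gt_eqF// prodrho_gt0//.
rewrite /= E adjop_scale adjop_xL prodrhoS addSnnS.
have := prodrho_gt0 m; have := rho_gt0 (inZp m) => r0 p0.
by field; rewrite !gt_eqF.
Qed.

(** For n = K this is the matrix A / rho, and every [normop n] fixes [xL]. *)
Definition normop n h v : R := (prodrho n)^-1 * adjiter n 0 h v.

Local Notation B := (normop K).

Lemma normop_linear n c h g :
  normop n (fun v => c * h v + g v) = fun v => c * normop n h v + normop n g v.
Proof. by apply/funext => v; rewrite /normop adjiter_linear; ring. Qed.

Lemma normop_ge0 n h : (forall v, 0 <= h v) -> forall v, 0 <= normop n h v.
Proof.
by move=> h0 v; rewrite mulr_ge0 ?adjiter_ge0// invr_ge0 ltW// prodrho_gt0.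
Qed.

Lemma normop_xL n : normop n xL = xL.
Proof.
apply/funext => v; have := adjiter_xL n 0 v.
rewrite prodrho0 mul1r add0n /normop => ->.
by rewrite mulKf// gt_eqF// prodrho_gt0.
Qed.

Lemma normopMD q t h : normop (q * K + t) h = iter q B (normop t h).
Proof.
elim: q => [|q IH]; first by rewrite mul0n add0n.
rewrite iterS -IH; apply/funext => v.
have E : adjiter (q * K + t) K h = adjiter (q * K + t) 0 h.
  by have := adjiter_shift (q * K + t) 0 1 h; rewrite mul1n addn0.
rewrite mulSn -addnA {1}/normop adjiterD add0n E.
have P : prodrho (K + (q * K + t)) = prodrho K * prodrho (q * K + t).
  by have := prodrhoMD 1 (q * K + t); rewrite mul1n expr1.
by rewrite {1}/normop adjiter_scale P invfM; ring.
Qed.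

Definition weight0 v : R := xL v `^ delta.

(** The total weight of the paths of length below [K] with range [v]; applying (A / rho)^q to it
    gives the weights of block q. *)
Definition block_weight v : R := \sum_(t < K) normop t weight0 v.

(** For an admissible weight this is [w_delta] raised to the power delta, which cancels the exponent
    1 / delta ([w_delta_powR]): the decay rate no longer involves delta. *)
Definition pweight (l : fin_path L) : R := (prodrho (flen l))^-1 * weight0 (fsrc l).

Lemma weight0_gt0 v : 0 < weight0 v. Proof. by rewrite powR_gt0. Qed.

Lemma iter_block_weight q v :
  iter q B block_weight v = \sum_(t < K) normop (q * K + t) weight0 v.
Proof.
have E : block_weight = fun v => \sum_(t <- enum 'I_K) 1 * normop t weight0 v.
  by apply/funext => w; rewrite /block_weight big_enum; apply: eq_bigr => t _; rewrite mul1r.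
rewrite E (B_sum (B := iter q B)); last by move=> *; exact: (iter_linear (@normop_linear K)).
by rewrite big_enum; apply: eq_bigr => t _; rewrite mul1r normopMD.
Qed.

Lemma sum_level_weight q :
  \sum_(t < K) \sum_(l <- paths_of_length (q * K + t)) pweight l =
  \sum_(v <- vseq) iter q B block_weight v.
Proof.
transitivity (\sum_(t < K) \sum_(v <- vseq) normop (q * K + t) weight0 v).
  apply: eq_bigr => t _; set n := (q * K + t)%N.
  pose F (p : V * seq edge) := (prodrho n)^-1 * weight0 (last p.1 (map (@esrc _ L) p.2)).
  rewrite (eq_big_seq (fun l => F (fpath_val l))); last first.
    by move=> l; rewrite mem_paths_of_length /pweight /F => /eqP ->.
  rewrite sum_paths_of_length; apply: eq_bigr => v _.
  by rewrite /F /normop -mulr_sumr sum_fpaths.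
by rewrite exchange_big/=; apply: eq_bigr => v _; rewrite iter_block_weight.
Qed.

Lemma sum_prefix_level (l0 : fin_path L) j q : flen l0 = (j * K)%N -> (j <= q)%N ->
  \sum_(t < K) \sum_(l <- paths_of_length (q * K + t) | path_prefix l0 l) pweight l =
  prodrho K ^- j * iter (q - j) B block_weight (fsrc l0).
Proof.
move=> l0j jq.
rewrite iter_block_weight mulr_sumr; apply: eq_bigr => t _.
have -> : (q * K + t = j * K + ((q - j) * K + t))%N by rewrite addnA -mulnDl subnKC.
rewrite big_seq_cond.
rewrite (eq_bigr (fun l => (prodrho (j * K + ((q - j) * K + t)))^-1 * weight0 (fsrc l))); last first.
  by move=> l /andP[+ _]; rewrite mem_paths_of_length /pweight => /eqP ->.
rewrite -big_seq_cond -mulr_sumr sum_path_prefix// /normop mulrA; congr (_ * _).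
by rewrite (prodrhoMD j) invfM.
Qed.

Definition level (p : basis_index L) : nat := (flen p.1 %/ K)%N.

Definition level_paths q : seq (fin_path L) :=
  flatten [seq paths_of_length (q * K + t) | t <- iota 0 K].

Definition level_seq q : seq (basis_index L) :=
  [seq (l, b) | l <- level_paths q, b <- [:: true; false]].

Lemma mem_level_paths q l : (l \in level_paths q) = (flen l %/ K == q)%N.
Proof.
apply/flattenP/eqP => [[_ /mapP[t + ->]]|lq].
  rewrite mem_iota add0n mem_paths_of_length => /andP[_ tK] /eqP ->.
  by rewrite divnMDl// divn_small// addn0.
exists (paths_of_length (q * K + flen l %% K)).
  by apply/mapP; exists (flen l %% K)%N => //; rewrite mem_iota add0n ltn_pmod.
by rewrite mem_paths_of_length -lq -divn_eq.
Qed.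

Lemma level_paths_uniq q : uniq (level_paths q).
Proof.
suff H n m : uniq (flatten [seq paths_of_length (q * K + t) | t <- iota m n]) by exact: H.
elim: n m => //= n IH m.
rewrite cat_uniq paths_of_length_uniq IH andbT/=.
apply/hasPn => l /flattenP[_ /mapP[t + ->]]; rewrite mem_iota !mem_paths_of_length.
by move=> /andP[mt _] /eqP ->; rewrite eqn_add2l gtn_eqF.
Qed.

Lemma level_seq_uniq q : uniq (level_seq q).
Proof.
by apply: allpairs_uniq => //; [exact: level_paths_uniq|move=> [? ?] [? ?] _ _ /= [-> ->]].
Qed.

Lemma mem_level_seq q p : (p \in level_seq q) = (level p == q).
Proof.
rewrite /level -mem_level_paths; apply/allpairsP/idP => [[[l b] [/= h _ ->]]//|h].
by exists p; split; [|case: p.2|exact: surjective_pairing].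
Qed.

(** The factor 2 counts the two summands of C^2 attached to a path. *)
Lemma sum_level_seq q (F : basis_index L -> R) (G : fin_path L -> R) :
  (forall l b, flen l %/ K = q -> F (l, b) = G l)%N ->
  \sum_(p <- level_seq q) F p = 2 * \sum_(t < K) \sum_(l <- paths_of_length (q * K + t)) G l.
Proof.
move=> FG; rewrite big_allpairs/=.
rewrite (eq_big_seq (fun l => 2 * G l)); last first.
  by move=> l; rewrite mem_level_paths => /eqP lq; rewrite !big_cons big_nil !FG//; ring.
rewrite -mulr_sumr; congr (_ * _).
rewrite /level_paths big_flatten big_map -[iota 0 K]/(index_iota 0 K) big_mkord.
by [].
Qed.

End Paths.

(** * Cesaro limits on cylinders *)

Lemma asymp_eq_shift (R : realType) (c d : nat -> R) j G :
  (forall q, (j <= q)%N -> c q = d (q - j)%N) ->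
  asymp (fun Q => \sum_(q < Q) d q) G -> asymp (fun Q => \sum_(q < Q) c q) G.
Proof.
move=> cd dG e e0; have [D hD] := dG e e0.
pose A := \sum_(q < j) `|c q|.
have A0 : 0 <= A by apply: sumr_ge0.
have D0 : 0 <= D.
  by have := hD 0; rewrite big_ord0 !mulr0 subrr normr0 add0r.
have G0 := normr_ge0 G.
exists (A + `|G| * j%:R + D) => Q.
have [Qj|jQ] := leqP Q j.
  have h1 : `|\sum_(q < Q) c q| <= A.
    apply: le_trans (ler_norm_sum _ _ _) _; rewrite /A.
    rewrite -!(big_mkord xpredT (fun q => `|c q|)) (big_cat_nat (leq0n Q) Qj)/=.
    by rewrite lerDl sumr_ge0.
  have h2 : `|G * Q%:R| <= `|G| * j%:R.
    by rewrite normrM normr_nat ler_wpM2l// ler_nat.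
  apply: le_trans (ler_normB _ _) _.
  have : 0 <= e * Q%:R by rewrite mulr_ge0// ltW.
  lra.
have [n Qn] : exists n, Q = (j + n)%N by exists (Q - j)%N; rewrite subnKC// ltnW.
have -> : \sum_(q < Q) c q = \sum_(q < j) c q + \sum_(q < n) d q.
  rewrite Qn big_split_ord/=; congr (_ + _).
  by apply: eq_bigr => q _; rewrite cd ?leq_addr// addKn.
have h1 : `|\sum_(q < j) c q| <= A by exact: ler_norm_sum.
have h2 : `|G * j%:R| <= `|G| * j%:R by rewrite normrM normr_nat.
have h3 := hD n; rewrite Qn !natrD.
have h4 : 0 <= e * j%:R by rewrite mulr_ge0// ltW.
move: h1 h2 h3; rewrite !ler_norml => /andP[? ?] /andP[? ?] /andP[? ?].
by apply/andP; split; lra.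
Qed.

Lemma asympD (R : realType) (S T : nat -> R) G H : asymp S G -> asymp T H ->
  asymp (fun Q => S Q + T Q) (G + H).
Proof.
move=> SG TH e e0; have e2 : 0 < e / 2 by rewrite divr_gt0.
have [D hD] := SG _ e2; have [E hE] := TH _ e2; exists (D + E) => Q.
have := hD Q; have := hE Q; rewrite !ler_norml => /andP[? ?] /andP[? ?].
by apply/andP; split; lra.
Qed.

Lemma asympZ (R : realType) (c : R) (S : nat -> R) G : asymp S G ->
  asymp (fun Q => c * S Q) (c * G).
Proof.
move=> SG e e0; have c0 := normr_ge0 c.
have [|D hD] := SG (e / (`|c| + 1)); first by rewrite divr_gt0// ltr_wpDl.
exists (`|c| * D) => Q; rewrite -mulrA -mulrBr normrM.
apply: le_trans (ler_wpM2l c0 (hD Q)) _; rewrite mulrDr lerD2r mulrA.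
rewrite ler_wpM2r// mulrA ler_pdivrMr ?ltr_wpDl//.
by rewrite mulrC mulrDr mulr1 lerDl ltW.
Qed.

Lemma asymp0 (R : realType) : asymp (fun=> 0 : R) 0.
Proof.
move=> e e0; exists 0 => Q; rewrite mul0r subrr normr0 addr0.
by rewrite mulr_ge0// ltW.
Qed.

Lemma asymp_sum (R : realType) (T : eqType) (s : seq T) (S : T -> nat -> R) (G : T -> R) :
  (forall i, i \in s -> asymp (S i) (G i)) ->
  asymp (fun Q => \sum_(i <- s) S i Q) (\sum_(i <- s) G i).
Proof.
elim: s => [|i s IH] h.
  rewrite big_nil (_ : (fun Q => _) = fun=> 0); first exact: asymp0.
  by apply/funext => Q; rewrite big_nil.
rewrite big_cons (_ : (fun Q => _) = fun Q => S i Q + \sum_(j <- s) S j Q); last first.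
  by apply/funext => Q; rewrite big_cons.
apply: asympD; first by apply: h; rewrite inE eqxx.
by apply: IH => j js; apply: h; rewrite inE js orbT.
Qed.

(** * The decay constants, extracted from the properties of a weight *)

Section WeightConstants.
Variables (R : realType) (k : nat) (L : kgraph k.+1).
Hypothesis L_finite : kgraph_finite L.
Variables (xL : kobj L -> R) (delta : R).
Hypothesis xL_PF : perron_frobenius_vector xL.
Hypothesis delta_gt0 : 0 < delta.
Hypothesis w_weight : is_weight (w_delta xL delta).
Variable x0 : inf_path L.
Local Notation V := (kobj L).
Local Notation K := k.+1.
Local Notation rho_ := (spectral_radius L R).
Local Notation rho := (prodrho R L K).
Local Notation w := (w_delta xL delta).

Let xL_gt0 v : 0 < xL v. Proof. by have [] := xL_PF. Qed.

Lemma w_deltaE l : w l = prodrho R L (flen l) `^ (- delta^-1) * xL (fsrc l).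
Proof. by []. Qed.

(** Read off from the eigenvector equation, a nonnegative matrix being applied to a positive vector,
    rather than from the supremum. *)
Lemma spectral_radius_ge0 i : 0 <= rho_ i.
Proof.
have [_ _ h] := xL_PF; pose v := erng (x0 0%N).
rewrite -(pmulr_lge0 _ (xL_gt0 v)) -h sum_vertices//.
by apply: sumr_ge0 => u _; rewrite mulr_ge0// ltW.
Qed.

Lemma flen_initial (x : inf_path L) n : flen (initial_path x n) = n.
Proof. by rewrite /flen size_mkseq. Qed.

(** A nonzero power of 0 is 0 by convention, so a vanishing product would make [w] vanish on the
    paths of length [n], and [x0] provides such a path. *)
Lemma prodrho_neq0 n : prodrho R L n != 0.
Proof.
have [wpos _ _ _] := w_weight; have := wpos (initial_path x0 n).
rewrite w_deltaE flen_initial; apply: contraTneq => ->.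
by rewrite powR0 ?mul0r ?ltxx// oppr_eq0 invr_eq0 gt_eqF.
Qed.

Lemma spectral_radius_gt0 i : 0 < rho_ i.
Proof.
rewrite lt_neqAle spectral_radius_ge0 andbT eq_sym.
have := prodrho_neq0 K; apply: contra => /eqP ri0.
rewrite /prodrho (bigD1 i)//= ri0 divnn modnn ltn0 addn0 expr1 mul0r//.
Qed.

Let P_gt0 n : 0 < prodrho R L n.
Proof. exact: prodrho_gt0 spectral_radius_gt0 _. Qed.

Lemma prodrho_mul q : prodrho R L (q * K) = rho ^+ q.
Proof. by rewrite -[(q * K)%N]addn0 prodrhoMD prodrho0 mulr1. Qed.

(** If rho were at most 1, the weights along [x0] at the lengths N K would stay above the minimum of
    [xL], contradicting the decay of a weight. *)
Lemma prodrho_gt1 : 1 < rho.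
Proof.
rewrite ltNge; apply/negP => rho_le1; have [_ _ w0 _] := w_weight.
have [c c0 hc] := seq_lbound (vseq L) xL_gt0.
have [N _ hN] := cvgr_lt _ w0 _ c0.
have := hN (N * K)%N (leq_pmulr N (ltn0Sn k)); rewrite /= ltNge => /negP; apply.
(* Finiteness of the paths of this length bounds their weights, without which [sup] need not
   dominate them. *)
have [M _ hM] := seq_ubound (paths_of_length L (N * K)) w.
apply: (@le_trans _ _ (w (initial_path x0 (N * K)))).
  rewrite w_deltaE flen_initial prodrho_mul.
  apply: le_trans (hc _ (mem_vseq L_finite (fsrc (initial_path x0 (N * K))))) _.
  rewrite ler_peMl ?(ltW (xL_gt0 _))// powRN invf_ge1 ?powR_gt0 ?exprn_gt0//.
  apply: (@le_trans _ _ (1 `^ delta^-1)); last by rewrite powR1.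
  rewrite ge0_ler_powR ?nnegrE ?invr_ge0 ?(ltW delta_gt0) ?ler01//.
    by rewrite exprn_ge0// ltW.
  by rewrite exprn_ile1// ltW.
apply: ub_le_sup; last by exists (initial_path x0 (N * K)); rewrite /= ?flen_initial.
by exists M => _ [l /= ln <-]; apply: hM; rewrite mem_paths_of_length// ln.
Qed.

Lemma w_delta_powR l : w l `^ delta = pweight xL delta l.
Proof.
rewrite w_deltaE powRM ?powR_ge0 ?(ltW (xL_gt0 _))// -powRrM.
by rewrite mulNr mulVf ?gt_eqF// powR_inv1// ltW.
Qed.

Let a (p : basis_index L) : R := pweight xL delta p.1.

(** Up to the factor rho ^- level, a weight depends only on the length modulo [K] and on the source,
    so it takes finitely many positive values. *)
Lemma weight_bounds : exists c1 c2 : R, [/\ 0 < c1, 0 < c2,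
  (forall p, c1 * rho ^- level p <= a p) & (forall p, a p <= c2 * rho ^- level p)].
Proof.
pose F (tv : 'I_K * V) : R := (prodrho R L tv.1)^-1 * weight0 xL delta tv.2.
have F0 tv : 0 < F tv by rewrite mulr_gt0 ?invr_gt0 ?weight0_gt0.
pose s := [seq (t, v) | t <- enum 'I_K, v <- vseq L].
have [c1 c1p h1] := seq_lbound s F0; have [c2 c2p h2] := seq_ubound s F.
have aE p : exists2 tv, tv \in s & a p = rho ^- level p * F tv.
  exists (inord (flen p.1 %% K), fsrc p.1).
    by apply/allpairsP; exists (inord (flen p.1 %% K), fsrc p.1); rewrite mem_enum mem_vseq.
  rewrite /a /pweight /F/= inordK ?ltn_pmod// mulrA -invfM; congr (_^-1 * _).
  by rewrite -prodrhoMD /level -divn_eq.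
exists c1, c2; split => // p; have [tv tvs ->] := aE p; [rewrite mulrC|rewrite [leRHS]mulrC];
  by rewrite ler_wpM2l ?invr_ge0 ?exprn_ge0 ?(ltW (P_gt0 _))// ?h1 ?h2.
Qed.

Let B := normop (R := R) (L := L) K.
Let y := block_weight xL delta.

Let B_lin c h g : B (fun v => c * h v + g v) = fun v => c * B h v + B g v.
Proof. exact: normop_linear. Qed.
Let B_pos h : (forall v, 0 <= h v) -> forall v, 0 <= B h v.
Proof. exact: normop_ge0 spectral_radius_gt0 _ _. Qed.
Let B_xL : B xL = xL.
Proof. exact: (normop_xL L_finite xL_PF spectral_radius_gt0). Qed.

(** [block_weight] lies between two positive multiples of the fixed vector [xL], and so do its
    iterates; the entries of [xL] add up to 1. *)
Lemma level_sum_bounds : exists K1 K2 : R, [/\ 0 < K1,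
  (forall q, K1 <= \sum_(p <- level_seq L q) a p) &
  (forall q, \sum_(p <- level_seq L q) a p <= K2)].
Proof.
have y_gt0 v : 0 < y v.
  rewrite /y /block_weight (bigD1 ord0)//= ltr_pwDl//.
    by rewrite /normop/= prodrho0 invr1 mul1r weight0_gt0.
  apply: sumr_ge0 => t _; apply: (normop_ge0 spectral_radius_gt0) => u.
  exact/ltW/weight0_gt0.
have yx_gt0 v : 0 < y v / xL v by rewrite divr_gt0.
have [c1 c1p h1] := seq_lbound (vseq L) yx_gt0.
have [c2 c2p h2] := seq_ubound (vseq L) (fun v => y v / xL v).
have [_ xL1 _] := xL_PF; rewrite sum_vertices// in xL1.
have E q : \sum_(p <- level_seq L q) a p = 2 * \sum_(v <- vseq L) iter q B y v.
  by rewrite (sum_level_seq L_finite (G := pweight xL delta))// (sum_level_weight L_finite).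
exists (2 * c1), (2 * c2); split => [|q|q]; first by rewrite mulr_gt0.
  rewrite E ler_wpM2l// -[c1]mulr1 -xL1 mulr_sumr; apply: ler_sum => v _.
  apply: (iter_ge B_lin B_pos B_xL) => u.
  by rewrite -ler_pdivlMr// h1// mem_vseq.
rewrite E ler_wpM2l// -[c2]mulr1 -xL1 mulr_sumr; apply: ler_sum => v _.
apply: (iter_le B_lin B_pos B_xL) => u.
by rewrite -ler_pdivrMr// h2// mem_vseq.
Qed.

Variable tau : basis_index L -> inf_path L.
Hypothesis tau_cyl : forall p, cylinder p.1 (tau p).

(** For paths at least as long as [l0], whether the chosen point lies in the cylinder of [l0] is
    decided by the path alone. This removes the choice function from the limit. *)
Lemma cylinder_prefix (l0 l : fin_path L) (x : inf_path L) :
  (flen l0 <= flen l)%N -> cylinder l x ->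
  (cylinder l0 x) <-> path_prefix l0 l.
Proof.
move=> le0 /= xl; rewrite /cylinder/= /path_prefix -xl.
have tk : take (flen l0) (mkseq x (flen l)) = mkseq x (flen l0).
  by rewrite /mkseq -map_take take_iota (minn_idPl le0).
rewrite /frng /fedges/= tk; split.
  by move=> /(congr1 (@fpath_val _ L)) /= <- /=; rewrite !eqxx.
move=> /andP[/eqP e1 /eqP e2]; apply/val_inj => /=.
by rewrite e1 -/(fedges l0) e2; case: l0 {le0 tk e1 e2} => -[].
Qed.

Lemma cylinder_asymp (l0 : fin_path L) j : flen l0 = (j * K)%N ->
  exists G : R, asymp (fun Q => \sum_(q < Q)
    lsum (level_seq L) a (fun p => \1_(cylinder l0) (tau p)) q) G.
Proof.
move=> l0j; have [z [C hC]] := mean_ergodic (vseq_uniq L) (mem_vseq L_finite) B_lin B_pos xL_gt0 B_xL y.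
pose c := 2 * rho ^- j.
exists (c * z (fsrc l0)).
(* The paths in the blocks below [j] are shorter than [l0], so membership there depends on [tau];
   these finitely many blocks are a bounded perturbation. *)
apply: (@asymp_eq_shift _ _ (fun q => c * iter q B y (fsrc l0)) j).
  move=> q jq; rewrite /lsum.
  rewrite (sum_level_seq L_finite (G := fun l => if path_prefix l0 l then pweight xL delta l else 0)).
    rewrite /c -mulrA -(sum_prefix_level L_finite xL delta l0j jq); congr (_ * _).
    by apply: eq_bigr => t _; rewrite -big_mkcond.
  move=> l b lq; have le0 : (flen l0 <= flen l)%N.
    by rewrite l0j (leq_trans _ (leq_trunc_div (flen l) K))// lq leq_pmul2r.
  have := cylinder_prefix le0 (tau_cyl (l, b)); rewrite indicE /a/=.
  case: path_prefix => -[h1 h2].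
    by rewrite mem_set ?mul1r//; exact: h2.
  by rewrite memNset ?mul0r// => /h1.
rewrite (_ : (fun Q => _) = fun Q => c * \sum_(q < Q) iter q B y (fsrc l0)); last first.
  by apply/funext => Q; rewrite mulr_sumr.
apply: asympZ => e e0; exists C => Q; apply: le_trans (hC Q _) _.
by rewrite lerDr mulr_ge0// ltW.
Qed.

End WeightConstants.

(** * The path space *)

Section PathSpace.
Variables (k : nat) (L : kgraph k.+1).
Implicit Types (x y : inf_path L).

Lemma initial_path_inj x y n :
  initial_path x n = initial_path y n <->
  erng (x 0%N) = erng (y 0%N) /\ forall i, (i < n)%N -> x i = y i.
Proof.
split.
  move=> /(congr1 (@fpath_val _ L)) [e0 e1]; split => // i ni.
  have := congr1 (fun s => nth (x 0%N) s i) e1.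
  by rewrite !nth_mkseq.
move=> [e0 e1]; apply/val_inj; rewrite /= e0; congr pair.
by apply/eq_in_map => i; rewrite mem_iota => /andP[_ ni]; exact: e1.
Qed.

Lemma initial_path_le x y m n : (m <= n)%N ->
  initial_path x n = initial_path y n -> initial_path x m = initial_path y m.
Proof.
move=> mn /initial_path_inj[e0 e1]; apply/initial_path_inj; split => // i im.
by apply: e1; exact: leq_trans mn.
Qed.

Lemma cylinder_initial x n : cylinder (initial_path x n) x.
Proof. by rewrite /cylinder/= /flen size_mkseq. Qed.

Lemma cylinder_initialE x y n :
  cylinder (initial_path x n) y <-> initial_path y n = initial_path x n.
Proof. by rewrite /cylinder/= {1}/flen size_mkseq. Qed.

Lemma cylinder_eq x l : cylinder l x -> l = initial_path x (flen l).
Proof. by rewrite /cylinder/= => ->. Qed.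

(** Cylinders around a common point are nested, so a finite intersection of subbasic sets contains
    the longest one. *)
Lemma nbhs_cylinder x (A : set (inf_path L)) : nbhs x A ->
  exists n, cylinder (initial_path x n) `<=` A.
Proof.
rewrite nbhsE => -[B [[D' sD' DB] Bx] BA].
move: Bx; rewrite -DB => -[C D'C Cx].
have [F sF FC] := sD' _ D'C.
have CA : C `<=` A by apply: subset_trans BA; rewrite -DB => y Cy; exists C.
suff [n hn] : exists n, forall S, S \in F -> cylinder (initial_path x n) `<=` S.
  by exists n; apply: subset_trans CA; rewrite -FC => y hy S /= SF; exact: hn.
have xF S : S \in F -> S x by move=> SF; move: Cx; rewrite -FC; exact.
have cF S : S \in F -> exists n, cylinder (initial_path x n) `<=` S.
  move=> SF; have /set_mem[l _ lS] := sF _ SF; have := xF _ SF.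
  by rewrite -lS => /cylinder_eq xl; exists (flen l); rewrite -xl.
have /choice[g hg] : forall S : set (inf_path L),
    exists n, S \in F -> cylinder (initial_path x n) `<=` S.
  move=> S; have [SF|SF] := boolP (S \in F); last by exists 0%N.
  by have [n hn] := cF _ SF; exists n.
exists (\max_(S <- enum_fset F) g S)%N => S SF y hy; apply: hg => //.
apply/cylinder_initialE; move/cylinder_initialE: hy; apply: initial_path_le.
exact: leq_bigmax_seq.
Qed.

Lemma cylinder_open (l : fin_path L) : open (cylinder l).
Proof.
exists [set cylinder l]; last by rewrite bigcup_set1.
move=> _ ->; exists [fset cylinder l]%fset.
  by move=> S /fset1P ->; apply/mem_set; exists l.
apply/seteqP; split => y.
  by move=> h; apply: (h (cylinder l)); exact/fset1P.
by move=> ly S /fset1P ->.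
Qed.

Hypothesis L_finite : kgraph_finite L.

Lemma ultra_constant (T : eqType) (U : set_system nat) (u : nat -> T) (s : seq T) :
  UltraFilter U -> (forall n, u n \in s) -> exists t, U [set n | u n = t].
Proof.
move=> UU us; have UP : ProperFilter U by exact: ultra_proper.
suff H : U [set n | u n \in s] -> exists t, U [set n | u n = t].
  by apply: H; apply: filterS filterT => n _; exact: us.
elim: s {us} => [|t s IH] h.
  by have [n] := filter_ex h.
have [?|h'] := in_ultra_setVsetC [set n | u n = t] UU; first by exists t.
apply: IH; apply: filterS (filterI h h') => n [/=].
by rewrite inE => /predU1P[].
Qed.

(* A sequence of counterexamples would have a limit path along a free
   ultrafilter, since there are finitely many edges at each level. *)
Lemma path_space_compact (Q : fin_path L -> Prop) :
  (forall x, exists n, Q (initial_path x n)) ->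
  exists N, forall x, exists2 n, (n <= N)%N & Q (initial_path x n).
Proof.
move=> hQ; apply: contrapT => H.
have /choice[x hx] : forall N, exists x, forall n, (n <= N)%N -> ~ Q (initial_path x n).
  move=> N; apply: contrapT => h; apply: H; exists N => x; apply: contrapT => h'.
  by apply: h; exists x => n nN Qn; apply: h'; exists n.
have [U [UU Uoo]] := exists_free_ultrafilter.
have UP : ProperFilter U by exact: ultra_proper.
have /choice[y hy] : forall i, exists e, U [set N | x N i = e].
  move=> i; pose es := [seq (vw, j) | vw <- [seq (v, w) | v <- vseq L, w <- vseq L],
    j <- iota 0 (adj (inZp i : 'I_k.+1) vw.1 vw.2)].
  apply: (@ultra_constant _ U (fun N => x N i) es) => // N.
  apply/allpairsPdep; exists ((x N i).1), ((x N i).2).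
  rewrite mem_iota add0n /= -surjective_pairing; split => //; last exact: ip_edge.
  apply/allpairsP; exists (x N i).1; rewrite !mem_vseq//.
  by rewrite -surjective_pairing.
have ye n : is_edge n (y n) by have [N <-] := filter_ex (hy n); exact: ip_edge.
have yc n : esrc (y n) = erng (y n.+1).
  by have [N [<- <-]] := filter_ex (filterI (hy n) (hy n.+1)); exact: ip_comp.
have [n Qn] := hQ (IPath ye yc).
have Un m : U [set N | forall i, (i < m)%N -> x N i = y i].
  elim: m => [|m IH]; first by apply: filterS filterT.
  apply: filterS (filterI IH (hy m)) => N [h1 h2] i.
  by rewrite ltnS leq_eqVlt => /predU1P[->//|]; exact: h1.
(* One edge more than [n], so that the first edge, and with it the range of the path, agrees even
   for n = 0. *)
have [N nN hN] := ultra_infinite UU Uoo (Un n.+1) n.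
apply: (hx N n nN); suff <- : initial_path (IPath ye yc) n = initial_path (x N) n by [].
apply/initial_path_inj => /=; rewrite hN//; split => // i ni.
by rewrite hN// ltnS ltnW.
Qed.

End PathSpace.

(** * Uniform continuity on the path space and integrals of step functions *)

Section UniformContinuity.
Variables (R : realType) (k : nat) (L : kgraph k.+1).
Hypothesis L_finite : kgraph_finite L.
Local Notation K := k.+1.
Local Notation nc := Normc.normc.
Implicit Types (x y : inf_path L).

Lemma normc_le_norm (z e : R[i]) : `|z| < e -> nc z < complex.Re e.
Proof. by rewrite ltcE => /andP[_]. Qed.

Lemma uniformly_continuous_path (f : inf_path L -> R[i]) :
  continuous (f : inf_path L -> R[i]^o) ->
  forall e : R, 0 < e -> exists j, forall x y,
    initial_path x (j * K) = initial_path y (j * K) -> nc (f x - f y) <= e.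
Proof.
move=> fc e e0; have e2 : 0 < (e / 2)%:C by rewrite ltcR divr_gt0.
pose Q l := forall x y, cylinder l x -> cylinder l y -> nc (f x - f y) <= e.
have [|N hN] := @path_space_compact k L L_finite Q.
  move=> x; have /nbhs_cylinder[n hn] : nbhs x [set y | `|(f y : R[i]^o) - f x| < (e / 2)%:C].
    exact: (cvgr_distC_lt _ _ (fc x) _ e2).
  exists n => y z yc zc; have /normc_le_norm hy := hn _ yc; have /normc_le_norm hz := hn _ zc.
  rewrite (_ : f y - f z = (f y - f x) - (f z - f x)); last by rewrite opprB addrA subrK.
  apply: le_trans (le_normcD _ _) _; rewrite -[e](@divfK _ 2)// mulr_natr mulr2n.
  apply: lerD; first exact: ltW.
  by rewrite normc_opp; exact: ltW.
(* The depth is enlarged from N to N K, because the Cesaro limits are available for cylinders whose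
   length is a multiple of [K]. *)
exists N => x y xy; have [n nN Qn] := hN x; apply: Qn.
  exact: cylinder_initial.
apply/cylinder_initialE; apply: (@initial_path_le _ _ _ _ _ (N * K)) => //.
by rewrite (leq_trans nN)// leq_pmulr.
Qed.

Definition path_uniform (g : inf_path L -> R) := forall e : R, 0 < e ->
  exists j, forall x y, initial_path x (j * K) = initial_path y (j * K) ->
    `|g x - g y| <= e.

Lemma path_uniform_lip (f : inf_path L -> R[i]) (phi : R[i] -> R) :
  continuous (f : inf_path L -> R[i]^o) ->
  (forall z w, `|phi z - phi w| <= nc (z - w)) -> path_uniform (phi \o f).
Proof.
move=> fc hphi e e0; have [j hj] := uniformly_continuous_path fc e0.
by exists j => x y xy; apply: le_trans (hphi _ _) (hj _ _ xy).
Qed.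

Variable pt : fin_path L -> inf_path L.
Hypothesis pt_cyl : forall l, cylinder l (pt l).

Lemma initial_pt x n : initial_path (pt (initial_path x n)) n = initial_path x n.
Proof. exact/cylinder_initialE/pt_cyl. Qed.

Lemma path_uniform_bounded g : path_uniform g -> exists M, forall x, `|g x| <= M.
Proof.
move=> gu; have [j hj] := gu _ ltr01.
have [M M0 hM] := seq_ubound (paths_of_length L (j * K)) (fun l => `|g (pt l)|).
exists (1 + M) => x; rewrite -[g x](subrK (g (pt (initial_path x (j * K))))).
apply: le_trans (ler_normD _ _) _; apply: lerD.
  by apply: hj; rewrite initial_pt.
by apply: hM; rewrite mem_paths_of_length// /flen size_mkseq.
Qed.

Definition step (g : inf_path L -> R) n x : R :=
  \sum_(l <- paths_of_length L n) g (pt l) * \1_(cylinder l) x.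

Lemma stepE g n x : step g n x = g (pt (initial_path x n)).
Proof.
rewrite /step (bigD1_seq (initial_path x n)) ?paths_of_length_uniq//=; last first.
  by rewrite mem_paths_of_length// /flen size_mkseq.
rewrite indicE mem_set ?mulr1; last exact: cylinder_initial.
rewrite big1_seq ?addr0// => l /andP[lx]; rewrite mem_paths_of_length// => /eqP ln.
rewrite indicE memNset ?mulr0// => /cylinder_eq lE.
by move: lx; rewrite lE ln eqxx.
Qed.

Variable x0 : inf_path L.
Variable mu : {finite_measure set (borel_inf_path x0) -> \bar R}.

Lemma measurable_cylinder l : measurable (cylinder l : set (borel_inf_path x0)).
Proof. by apply: sub_sigma_algebra; exact: cylinder_open. Qed.

Lemma measurable_step g n :
  measurable_fun [set: borel_inf_path x0] (step g n : borel_inf_path x0 -> R).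
Proof.
apply: measurable_sum => l; apply: measurable_funM; first exact: measurable_cst.
by apply: measurable_indic; exact: measurable_cylinder.
Qed.

(** A pointwise limit of step functions on cylinders, the m-th of which approximates [g] to within 1
    / (m + 1). *)
Lemma measurable_path_uniform g : path_uniform g ->
  measurable_fun [set: borel_inf_path x0] (g : borel_inf_path x0 -> R).
Proof.
move=> gu.
have /choice[j hj] : forall m, exists j, forall x y,
    initial_path x (j * K) = initial_path y (j * K) -> `|g x - g y| <= m.+1%:R^-1.
  by move=> m; apply: gu; rewrite invr_gt0.
apply: (@measurable_fun_cvg _ (borel_inf_path x0) R setT
  (fun m => (step g (j m * K) : borel_inf_path x0 -> R))).
  by move=> m; exact: measurable_step.
move=> x _; apply/cvgrPdist_le => e e0; near=> m.
rewrite stepE; apply: (@le_trans _ _ m.+1%:R^-1).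
  by apply: hj; rewrite initial_pt.
by apply: ltW; near: m; exact: (near_infty_natSinv_lt (PosNum e0)).
Unshelve. all: by end_near. Qed.

Lemma integrable_path_bounded (g : borel_inf_path x0 -> R) (M : R) :
  measurable_fun [set: borel_inf_path x0] g -> (forall x, `|g x| <= M) ->
  mu.-integrable [set: borel_inf_path x0] (EFin \o g).
Proof.
move=> mg gM; apply: measurable_bounded_integrable => //.
  by rewrite ltey_eq fin_num_measure.
exists M; split; first exact: num_real.
by move=> r Mr x _ /=; apply: le_trans (gM x) (ltW Mr).
Qed.

Lemma integrable_path_uniform g : path_uniform g ->
  mu.-integrable [set: borel_inf_path x0] (EFin \o (g : borel_inf_path x0 -> R)).
Proof.
move=> gu; have [M hM] := path_uniform_bounded gu.
exact: integrable_path_bounded (measurable_path_uniform gu) hM.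
Qed.

Lemma integrable_step g n :
  mu.-integrable [set: borel_inf_path x0] (EFin \o (step g n : borel_inf_path x0 -> R)).
Proof.
have [M M0 hM] := seq_ubound (paths_of_length L n) (fun l => `|g (pt l)|).
apply: integrable_path_bounded (measurable_step _ _) _ => x; rewrite stepE.
by apply: hM; rewrite mem_paths_of_length// /flen size_mkseq.
Qed.

Lemma integral_step g n : \int[mu]_x step g n x =
  \sum_(l <- paths_of_length L n) g (pt l) * fine (mu (cylinder l)).
Proof.
rewrite /step; elim: (paths_of_length L n) => [|l s IH].
  rewrite big_nil (_ : (fun x => _) = cst 0); last by apply/funext => x; rewrite big_nil.
  by rewrite Rintegral_cst// mul0r.
have ii l' : mu.-integrable [set: borel_inf_path x0] (EFin \o \1_(cylinder l')).
  by apply: integrable_indic; exact: measurable_cylinder.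
have is' : mu.-integrable [set: borel_inf_path x0] (EFin \o
    ((fun x => \sum_(l <- s) g (pt l) * \1_(cylinder l) x) : borel_inf_path x0 -> R)).
  apply: (@integrable_path_bounded _ (\sum_(l <- s) `|g (pt l)|)).
    apply: measurable_sum => l'; apply: measurable_funM; first exact: measurable_cst.
    by apply: measurable_indic; exact: measurable_cylinder.
  move=> x; apply: le_trans (ler_norm_sum _ _ _) _; apply: ler_sum => l' _.
  rewrite normrM -[leRHS]mulr1 ler_wpM2l// indicE normr_nat.
  by case: (_ \in _); rewrite ?lexx ?ler01.
rewrite big_cons -IH (_ : (fun x => _) = fun x => g (pt l) * \1_(cylinder l) x +
    \sum_(l <- s) g (pt l) * \1_(cylinder l) x); last first.
  by apply/funext => x; rewrite big_cons.
rewrite RintegralD//; last first.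
  have := integrableZl measurableT (g (pt l)) (ii l); congr integrable.
congr (_ + _); rewrite RintegralZl//; congr (_ * _).
rewrite /Rintegral integral_indic ?setIT//; exact: measurable_cylinder.
Qed.

Lemma integral_step_dist g n (e : R) : path_uniform g -> 0 <= e ->
  (forall x y, initial_path x n = initial_path y n -> `|g x - g y| <= e) ->
  `|\int[mu]_x g x - \sum_(l <- paths_of_length L n) g (pt l) * fine (mu (cylinder l))|
    <= e * fine (mu [set: borel_inf_path x0]).
Proof.
move=> gu e0 ge; rewrite -integral_step.
have ig := integrable_path_uniform gu; have is' := integrable_step g n.
rewrite -RintegralB//.
have id : mu.-integrable [set: borel_inf_path x0]
    (EFin \o ((fun x => g x - step g n x) : borel_inf_path x0 -> R)).
  exact: (integrableB measurableT ig is').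
apply: le_trans (le_normr_Rintegral measurableT id) _.
rewrite -(Rintegral_cst mu measurableT e).
apply: le_Rintegral => //.
- exact: (integrable_norm id).
- apply: (@integrable_path_bounded _ e); first exact: measurable_cst.
  by move=> x; rewrite ger0_norm.
by move=> x _; rewrite stepE; apply: ge; rewrite initial_pt.
Qed.

End UniformContinuity.

Lemma asymp_lsum_eq (R : realType) (I : choiceType) (lv : nat -> seq I) (a g h : I -> R) G :
  g =1 h -> asymp (fun Q => \sum_(q < Q) lsum lv a g q) G ->
  asymp (fun Q => \sum_(q < Q) lsum lv a h q) G.
Proof. by move=> /funext ->. Qed.

Lemma asymp_lsum0 (R : realType) (I : choiceType) (lv : nat -> seq I) (a g : I -> R) :
  (forall i, g i = 0) -> asymp (fun Q => \sum_(q < Q) lsum lv a g q) 0.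
Proof.
move=> g0; rewrite (_ : (fun Q => _) = fun=> 0); first exact: asymp0.
by apply/funext => Q; rewrite big1// => q _; rewrite /lsum big1// => i _; rewrite g0 mul0r.
Qed.

(** * From indicator functions of cylinders to uniformly continuous functions *)

Section RiemannSums.
Variables (R : realType) (k : nat) (L : kgraph k.+1).
Hypothesis L_finite : kgraph_finite L.
Variables (x0 : inf_path L) (mu : {finite_measure set (borel_inf_path x0) -> \bar R}).
Variables (pt : fin_path L -> inf_path L) (tau : basis_index L -> inf_path L).
Hypothesis pt_cyl : forall l, cylinder l (pt l).
Variables (a : basis_index L -> R) (K2 c : R).
Hypothesis a_ge0 : forall p, 0 <= a p.
Hypothesis a_sum : forall q, \sum_(p <- level_seq L q) a p <= K2.
Hypothesis c_ge0 : 0 <= c.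
Hypothesis cyl_asymp : forall l j, flen l = (j * k.+1)%N ->
  asymp (fun Q => \sum_(q < Q) lsum (level_seq L) a (fun p => \1_(cylinder l) (tau p)) q)
    (c * fine (mu (cylinder l))).

Lemma riemann_asymp g : path_uniform g ->
  asymp (fun Q => \sum_(q < Q) lsum (level_seq L) a (fun p => g (tau p)) q)
    (c * \int[mu]_x g x).
Proof.
move=> gu e e0; set m := fine (mu [set: borel_inf_path x0]).
have m0 : 0 <= m by exact: fine_ge0.
have K20 : 0 <= K2 by apply: le_trans (a_sum 0); apply: sumr_ge0.
(* Replacing [g] by a step function within e1 costs at most e1 K2 per block and c e1 m per block on
   the side of the integral, together at most e / 2; the other half is left for the step function.
   The summand 1 keeps the denominator positive. *)
pose e1 := e / 2 / (K2 + c * m + 1).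
have den : 0 < K2 + c * m + 1 by rewrite ltr_wpDl// addr_ge0// mulr_ge0.
have e1p : 0 < e1 by rewrite !divr_gt0.
have [j hj] := gu _ e1p; pose n := (j * k.+1)%N; pose P := paths_of_length L n.
have e2 : 0 < e / 2 by rewrite divr_gt0.
pose S (h : basis_index L -> R) Q := \sum_(q < Q) lsum (level_seq L) a h q.
have stepS Q : S (fun p => step pt g n (tau p)) Q =
    \sum_(l <- P) g (pt l) * S (fun p => \1_(cylinder l) (tau p)) Q.
  transitivity (\sum_(q < Q) \sum_(l <- P)
      g (pt l) * lsum (level_seq L) a (fun p => \1_(cylinder l) (tau p)) q).
    apply: eq_bigr => q _; rewrite /lsum /step.
    under eq_bigr do rewrite mulr_suml.
    rewrite exchange_big/=; apply: eq_bigr => l _; rewrite mulr_sumr.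
    by apply: eq_bigr => p _; rewrite mulrA.
  by rewrite exchange_big/=; apply: eq_bigr => l _; rewrite /S mulr_sumr.
have AS : asymp (S (fun p => step pt g n (tau p)))
    (c * \sum_(l <- P) g (pt l) * fine (mu (cylinder l))).
  rewrite (_ : S _ = fun Q => \sum_(l <- P) g (pt l) * S (fun p => \1_(cylinder l) (tau p)) Q).
    rewrite mulr_sumr (eq_bigr (fun l => g (pt l) * (c * fine (mu (cylinder l))))); last first.
      by move=> l _; rewrite mulrCA.
    apply: asymp_sum => l; rewrite mem_paths_of_length// => /eqP ln.
    by apply: asympZ; exact: (cyl_asymp ln).
  by apply/funext => Q; exact: stepS.
have [D hD] := AS _ e2.
exists D => Q.
have h1 : `|S (fun p => g (tau p)) Q - S (fun p => step pt g n (tau p)) Q| <= e1 * K2 * Q%:R.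
  rewrite /S -sumrB; apply: le_trans (ler_norm_sum _ _ _) _.
  rewrite -[in Q%:R](card_ord Q) mulr_natr -sumr_const; apply: ler_sum => q _.
  rewrite /lsum -sumrB; apply: le_trans (ler_norm_sum _ _ _) _.
  apply: (@le_trans _ _ (\sum_(p <- level_seq L q) e1 * a p)).
    apply: ler_sum => p _; rewrite -mulrBl normrM (ger0_norm (a_ge0 p)) ler_wpM2r//.
    by rewrite stepE//; apply: hj; rewrite initial_pt.
  by rewrite -mulr_sumr ler_wpM2l// ltW.
have h2 := @integral_step_dist R k L L_finite pt pt_cyl x0 mu g n e1 gu (ltW e1p) hj.
have h3 : `|c * \int[mu]_x g x * Q%:R
    - c * (\sum_(l <- P) g (pt l) * fine (mu (cylinder l))) * Q%:R| <= c * (e1 * m) * Q%:R.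
  rewrite -mulrBl -mulrBr !normrM normr_nat (ger0_norm c_ge0) ler_wpM2r// ler_wpM2l//.
have h4 := hD Q.
have h5 : e1 * K2 * Q%:R + c * (e1 * m) * Q%:R <= e / 2 * Q%:R.
  rewrite -mulrDl ler_wpM2r// (_ : _ + _ = e1 * (K2 + c * m)); last by ring.
  rewrite /e1 mulrAC ler_pdivrMr// ler_wpM2l ?(ltW e2)//; lra.
move: h1 h3 h4; rewrite -/(S _ Q) !ler_norml => /andP[? ?] /andP[? ?] /andP[? ?].
by apply/andP; split; lra.
Qed.

End RiemannSums.

(** * Identification of the block averages with integrals against [mu] *)

Theorem theorem3p23 (R : realType) (k : nat) (L : kgraph k.+1)
  (L_finite : kgraph_finite L)
  (L_connected : strongly_connected L)
  (xL : kobj L -> R) (xL_PF : perron_frobenius_vector xL)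
  (delta : R) (delta01 : 0 < delta < 1)
  (w_weight : is_weight (w_delta xL delta))
  (w_diam : forall l : fin_path L, w_delta xL delta l = diam (w_delta xL delta) l)
  (tau : fin_path L -> inf_path L * inf_path L)
  (tau_choice : choice_function (w_delta xL delta) tau)
  (x0 : inf_path L)
  (mu : {finite_measure set (borel_inf_path x0) -> \bar R})
  (mu_cylinder : forall l : fin_path L,
     (fine (mu (cylinder l)))%:C =
     connes_trace (pi_tau tau (cylinder_indic R l) \o
                   absD_inv_pow (w_delta xL delta) delta)) :
  forall f : inf_path L -> R[i], continuous (f : inf_path L -> R[i]^o) ->
    [/\ connes_measurable
          (pi_tau tau f \o absD_inv_pow (w_delta xL delta) delta),
        connes_trace (pi_tau tau f \o absD_inv_pow (w_delta xL delta) delta)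
          = cintegral mu f,
        (forall s : R, 1 < s ->
           trace_class
             (pi_tau tau f \o absD_inv_pow (w_delta xL delta) (delta * s))) &
        (s - 1)%:C *
          op_trace (pi_tau tau f \o absD_inv_pow (w_delta xL delta) (delta * s))
          @[s --> 1^'+] --> (cintegral mu f : R[i]^o)].
Proof.
have [delta_gt0 _] := andP delta01.
pose rho := prodrho R L k.+1.
have rho_gt1 : 1 < rho := prodrho_gt1 L_finite xL_PF delta_gt0 w_weight x0.
have lnrho_gt0 : 0 < ln rho by rewrite ln_gt0.
pose a (p : basis_index L) := pweight xL delta p.1.
pose T (p : basis_index L) := if p.2 then (tau p.1).1 else (tau p.1).2.
have T_cyl p : cylinder p.1 (T p).
  by have [h1 h2 _] := tau_choice p.1; rewrite /T; case: p.2.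
have a_diam p : diam (w_delta xL delta) p.1 `^ delta = a p.
  by rewrite -w_diam; exact: (w_delta_powR L_finite xL_PF delta_gt0 w_weight x0).
have [c1 [c2 [c1_gt0 c2_gt0 a_ge a_le]]] :=
  weight_bounds L_finite xL_PF delta_gt0 w_weight x0.
have [K1 [K2 [K1_gt0 sum_ge sum_le]]] :=
  level_sum_bounds L_finite xL_PF delta_gt0 w_weight x0.
have lvU := level_seq_uniq L_finite; have lvM := mem_level_seq L_finite.
have a_ge0 p : 0 <= a p.
  by apply: le_trans (a_ge p); rewrite mulr_ge0 ?invr_ge0 ?exprn_ge0 ?ltW// (lt_trans ltr01).
have a_le_c2 p : a p <= c2.
  exact: (level_weight_le rho_gt1 c2_gt0 a_le).
(* Both coefficient families must be bounded: [diag_op] sends vectors outside its domain to 0, so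
   composition is coefficientwise only if no vector leaves ell^2. *)
have opE (f : inf_path L -> R[i]) s : 0 <= s -> (exists M, forall x, Normc.normc (f x) <= M) ->
    pi_tau tau f \o absD_inv_pow (w_delta xL delta) (delta * s) =
    diag_op (fun p => f (T p) * (a p `^ s)%:C).
  move=> s0 [M hM]; rewrite /pi_tau /absD_inv_pow diag_op_comp.
  - by congr diag_op; apply/funext => p; rewrite powRrM a_diam.
  - by exists M.
  exists (c2 `^ s) => p; rewrite normc_real ger0_norm ?powR_ge0// powRrM a_diam.
  by rewrite ge0_ler_powR ?nnegrE ?a_ge0 ?(ltW c2_gt0).
have opE1 (f : inf_path L -> R[i]) : (exists M, forall x, Normc.normc (f x) <= M) ->
    pi_tau tau f \o absD_inv_pow (w_delta xL delta) delta =
    diag_op (fun p => f (T p) * (a p)%:C).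
  move=> bf; have := opE f 1 ler01 bf; rewrite mulr1 => ->.
  by congr diag_op; apply/funext => p; rewrite powRr1.
have cyl_asymp l j : flen l = (j * k.+1)%N ->
    asymp (fun Q => \sum_(q < Q) lsum (level_seq L) a (fun p => \1_(cylinder l) (T p)) q)
      (ln rho * fine (mu (cylinder l))).
  move=> lj.
  have [G hG] := cylinder_asymp L_finite xL_PF delta_gt0 w_weight x0 T_cyl lj.
  have ind_ge0 x : 0 <= (\1_(cylinder l) x : R) by rewrite indicE.
  have b01 x : Normc.normc (cylinder_indic R l x) <= 1.
    by rewrite normc_real indicE normr_nat lern1 leq_b1.
  (* The indicator function is its own positive part and its three other parts vanish, so its trace
     is G / ln rho. *)
  have := mu_cylinder l; rewrite opE1; last by exists 1.
  rewrite (connes_trace_level lvU lvM rho_gt1 c1_gt0 c2_gt0 a_ge a_le K1_gt0 sum_ge sum_le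
    (f := fun p => cylinder_indic R l (T p)) (M := 1) (G1 := G) (G2 := 0) (G3 := 0) (G4 := 0)).
  - move=> /(congr1 (@complex.Re R)) /= ->; rewrite subr0 mulrC divfK ?gt_eqF//.
  - by move=> p; exact: b01.
  - by apply: asymp_lsum_eq hG => p; apply/esym/max_l/ind_ge0.
  - by apply: asymp_lsum0 => p; apply/max_r; rewrite oppr_le0; exact: ind_ge0.
  - by apply: asymp_lsum0 => p; exact: maxxx.
  - by apply: asymp_lsum0 => p; rewrite /= oppr0 maxxx.
pose pt l := (tau l).1.
have pt_cyl l : cylinder l (pt l) by have [] := tau_choice l.
move=> f fc.
pose f0 x := Normc.normc (f x).
pose f1 x := Num.max (complex.Re (f x)) 0.
pose f2 x := Num.max (- complex.Re (f x)) 0.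
pose f3 x := Num.max (complex.Im (f x)) 0.
pose f4 x := Num.max (- complex.Im (f x)) 0.
have lip (u v : R) : `|Num.max u 0 - Num.max v 0| <= `|u - v|.
  have h1 := ler_norm (u - v); have h2 := ler_norm (v - u); rewrite distrC in h2.
  by rewrite ler_norml /Num.max; do 2 (case: ltP => ?); apply/andP; split; lra.
have u0 : path_uniform f0.
  apply: (path_uniform_lip L_finite (phi := fun z => Normc.normc z) fc) => z w.
  have h1 := le_normcD (z - w) w; have h2 := le_normcD (w - z) z.
  rewrite subrK in h1; rewrite subrK -(opprB z) normc_opp in h2.
  by rewrite ler_norml; apply/andP; split; lra.
have ReB (z w : R[i]) : complex.Re (z - w) = complex.Re z - complex.Re w.
  by case: z w => ? ? [].
have ImB (z w : R[i]) : complex.Im (z - w) = complex.Im z - complex.Im w.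
  by case: z w => ? ? [].
have u1 : path_uniform f1.
  apply: (path_uniform_lip L_finite (phi := fun z => Num.max (complex.Re z) 0) fc) => z w.
  by apply: le_trans (lip _ _) _; rewrite -ReB abs_Re_le.
have u2 : path_uniform f2.
  apply: (path_uniform_lip L_finite (phi := fun z => Num.max (- complex.Re z) 0) fc) => z w.
  by apply: le_trans (lip _ _) _; rewrite -opprD normrN -ReB abs_Re_le.
have u3 : path_uniform f3.
  apply: (path_uniform_lip L_finite (phi := fun z => Num.max (complex.Im z) 0) fc) => z w.
  by apply: le_trans (lip _ _) _; rewrite -ImB abs_Im_le.
have u4 : path_uniform f4.
  apply: (path_uniform_lip L_finite (phi := fun z => Num.max (- complex.Im z) 0) fc) => z w.
  by apply: le_trans (lip _ _) _; rewrite -opprD normrN -ImB abs_Im_le.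
have [M hM0] := path_uniform_bounded L_finite pt_cyl u0.
have hM x : Normc.normc (f x) <= M.
  by apply: le_trans (hM0 x); exact: ler_norm.
have bf : exists M, forall x, Normc.normc (f x) <= M by exists M.
have fTM p : Normc.normc (f (T p)) <= M by [].
have A g : path_uniform g -> asymp (fun Q => \sum_(q < Q)
    lsum (level_seq L) a (fun p => g (T p)) q) (ln rho * \int[mu]_x g x).
  exact: (riemann_asymp L_finite pt_cyl a_ge0 sum_le (ltW lnrho_gt0) cyl_asymp).
have int_ge0 (g : inf_path L -> R) : (forall x, 0 <= g x) -> 0 <= ln rho * \int[mu]_x g x.
  by move=> g0; rewrite mulr_ge0 ?(ltW lnrho_gt0)// Rintegral_ge0.
have pos (u : R) : 0 <= Num.max u 0 by rewrite le_max lexx orbT.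
have posneg (u : R) : Num.max u 0 - Num.max (- u) 0 = u.
  by rewrite /Num.max; do 2 (case: ltP => ?); lra.
(* The integral is brought into the form (G1 - G2) / ln rho and (G3 - G4) / ln rho in which the
   trace lemmas state their values. *)
have intE : cintegral mu f = ((ln rho * \int[mu]_x f1 x - ln rho * \int[mu]_x f2 x) / ln rho)
    +i* ((ln rho * \int[mu]_x f3 x - ln rho * \int[mu]_x f4 x) / ln rho).
  rewrite -!mulrBr !(mulrC (ln rho)) !mulfK ?gt_eqF//.
  have ig g : path_uniform g -> mu.-integrable [set: borel_inf_path x0]
      (EFin \o (g : borel_inf_path x0 -> R)).
    exact: (integrable_path_uniform L_finite pt_cyl).
  rewrite -!RintegralB//; try exact: ig.
  rewrite /cintegral; congr (_ +i* _); apply: eq_Rintegral => x _; exact/esym/posneg.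
split.
- rewrite opE1//.
  exact: (connes_measurable_level lvU lvM rho_gt1 c1_gt0 c2_gt0 a_ge a_le K1_gt0 sum_ge sum_le
    fTM (A _ u0) (A _ u1) (A _ u2) (A _ u3) (A _ u4)).
- rewrite opE1// intE.
  exact: (connes_trace_level lvU lvM rho_gt1 c1_gt0 c2_gt0 a_ge a_le K1_gt0 sum_ge sum_le
    fTM (A _ u1) (A _ u2) (A _ u3) (A _ u4)).
- move=> s s1; rewrite opE//; last by rewrite ltW// (lt_trans ltr01).
  exact: (trace_class_level lvU lvM rho_gt1 c1_gt0 c2_gt0 a_ge a_le K1_gt0 sum_ge sum_le
    fTM s1).
rewrite intE.
have lim := op_trace_cvg lvU lvM rho_gt1 c1_gt0 c2_gt0 a_ge a_le K1_gt0 sum_ge sum_le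
    fTM (A _ u1) (A _ u2) (A _ u3) (A _ u4) (int_ge0 _ (fun x => pos _))
    (int_ge0 _ (fun x => pos _)) (int_ge0 _ (fun x => pos _)) (int_ge0 _ (fun x => pos _)).
apply: cvg_trans lim; apply: near_eq_cvg; near=> s.
by rewrite opE// ltW//; apply: lt_trans ltr01 _; near: s; exact: nbhs_right_gt.
Unshelve. all: by end_near. Qed.
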